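(* Let $T$ be any triangle in the tessellation $\mathcal{T}$ of $\mathbb{H}^*=\mathbb{H}\cup\mathbb{Q}\cup\{\infty\}$ obtained by successive reflections in the sides of $T_0$, and let $T'$ be the complementary triangle of $T$. Then $\overline p$ is an anti-conformal map of $T$ onto $T'$ that fixes the vertices of $T$.
   Context: $\mathbb{H}=\{\tau\in\mathbb{C}:\operatorname{Im}(\tau)>0\}$ and $\widehat{\mathbb{C}}=\mathbb{C}\cup\{\infty\}$ is the Riemann sphere. Definition of $p$ and $\overline p$. Let $\omega_1,\omega_2\in\mathbb{C}\setminus\{0\}$ be linearly independent over $\mathbb{R}$ with $\tau=\omega_1/\omega_2\in\mathbb{H}$, and let $\Gamma=\{k\omega_1+n\omega_2: k,n\in\mathbb{Z}\}$. The Weierstrass zeta-function is $$\zeta(u)=\frac1u+\sum_{\gamma\in\Gamma\setminus\{0\}}\Bigl(\frac{1}{u-\gamma}+\frac1\gamma+\frac{u}{\gamma^2}\Bigr).$$ Its quasi-periods $\eta_1,\eta_2\in\mathbb{C}$ are the constants with $\zeta(u+\omega_k)=\zeta(u)+\eta_k$ for $k=1,2$. They do not both vanish, and $\eta_1/\eta_2\in\widehat{\mathbb{C}}$ depends only on $\tau$. Define $p(\tau)=\eta_1/\eta_2\in\widehat{\mathbb{C}}$ (one may take $\omega_1=\tau$, $\omega_2=1$) and $\overline p(\tau)=\overline{p(\tau)}$, with $\overline\infty=\infty$. At a vertex of $T$ lying in $\mathbb{Q}\cup\{\infty\}$ the value of $\overline p$ is understood as the limit of $\overline p(\tau)$ as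 $\tau\in T\cap\mathbb{H}$ tends to this vertex. A closed Jordan region in $\widehat{\mathbb{C}}$ is a compact set $X$ homeomorphic to a closed disk; $\operatorname{inte}(X)=X\setminus\partial X$. A circular arc triangle is a closed Jordan region in $\widehat{\mathbb{C}}$ whose boundary is decomposed into three non-overlapping circular arcs (arcs of circles in $\widehat{\mathbb{C}}$, lines together with $\infty$ counting as circles), called its sides; the three endpoints of these arcs are its vertices. A map $f$ is a conformal map between two circular arc triangles $X$ and $Y$ if it is a homeomorphism from $X$ onto $Y$ that sends the vertices of $X$ to the vertices of $Y$ and is a biholomorphism between $\operatorname{inte}(X)$ and $\operatorname{inte}(Y)$. It is an anti-conformal map between $X$ and $Y$ if $z\in X\mapsto\overline{f(z)}$ is a conformal map between $X$ and $\overline Y=\{\overline w:w\in Y\}$. The triangle $T_0= \{ \tau\in \mathbb{C}: 0\le \operatorname{Re}(\tau) \le 1/2,\ \operatorname{Im}(\tau)>0,\ |\tau|\ge 1\} \cup\{\infty\}$ is a circular arc triangle with vertices $\infty$, $i$, $\tfrac12(1+i\sqrt3)$ and angles $0$, $\pi/2$, $\pi/3$ there, respectively. Let $G$ be the group of conformal or anti-conformal homeomorphisms of $\widehat{\mathbb{C}}$ generated by the reflections in (the circles containing) the three sides of $T_0$. The tessellation $\mathcal{T}$ consists of the triangles $S(T_0)$, $S\in G$, with vertices the images of the vertices of $T_0$; each has angles $0,\pi/2,\pi/3$. Complementary triangle. Any circular arc triangle $T\subseteq\widehat{\mathbb{C}}$ with angles $0,\pi/2,\pi/3$ is contained in the intersection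 $D_1\cap D_2$ of two closed disks $D_1,D_2$ in $\widehat{\mathbb{C}}$, each bounded by a circle in $\widehat{\mathbb{C}}$ containing one of the sides of $T$, and such that these bounding circles touch at the vertex of $T$ with angle $0$. The complementary triangle $T'$ of $T$ is the closure of $(D_1\cap D_2)\setminus T$; it is a circular arc triangle with the same vertices as $T$, and $D_1\cap D_2=T\cup T'$. *)

(* Defs.v *)
From HB Require Import structures.
From mathcomp Require Import all_boot all_order all_algebra.
From mathcomp Require Import complex.
From mathcomp Require Import all_classical all_reals all_analysis.
From mathcomp Require Import summability.

Set Implicit Arguments.
Unset Strict Implicit.
Unset Printing Implicit Defensive.

Import Order.TTheory GRing.Theory Num.Theory.
Import numFieldNormedType.Exports.

Local Open Scope classical_set_scope.
Local Open Scope ring_scope.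
Local Open Scope complex_scope.

(* R[i] as a normed space over itself: [derivable f z 1] is then complex
   differentiability of f at z. *)
Set Warnings "-redundant-canonical-projection".
HB.instance Definition _ (R : realType) := NormedModule.copy R[i] R[i]^o.
Set Warnings "redundant-canonical-projection".

(* The Riemann sphere; [None] is the point at infinity. *)
Notation sphere R := (one_point_compactification R[i]).

Section Definitions.
Variable R : realType.
Local Notation C := R[i].
Local Notation S2 := (sphere R).
Local Notation Re := complex.Re.
Local Notation Im := complex.Im.

Definition sconj (z : S2) : S2 := omap conjc z.

(* * Homeomorphisms and biholomorphisms *)

Definition boundary (S : topologicalType) (X : set S) : set S :=
  closure X `\` interior X.

Definition inte (S : topologicalType) (X : set S) : set S := X `\` boundary X.

Definition homeomorphism_onto (S U : topologicalType) (X : set S) (Y : set U)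
    (f : S -> U) : Prop :=
  [/\ set_bij X Y f, {within X, continuous f} &
      exists2 g : U -> S, {in X, cancel f g} & {within Y, continuous g}].

Definition sinv (z : S2) : S2 :=
  if z is Some t then (if t == 0 then None else Some t^-1) else Some 0.

(* A holomorphic coordinate near [a]: z itself if [a] is finite, 1/z if
   [a] is infinite.  The value 0 at the point not covered by the coordinate is
   irrelevant for maps that are continuous at the point considered. *)
Definition chart (a z : S2) : C :=
  odflt 0 (if a is Some _ then z else sinv z).

Definition unchart (a : S2) (t : C) : S2 :=
  if a is Some _ then Some t else sinv (Some t).

Definition holomorphic_at (f : S2 -> S2) (a : S2) : Prop :=
  {for a, continuous f} /\
  derivable (fun t : C => chart (f a) (f (unchart a t))) (chart a a) (1 : C).

Definition biholomorphic_onto (U V : set S2) (f : S2 -> S2) : Prop :=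
  [/\ set_bij U V f, forall z, U z -> holomorphic_at f z &
      exists2 g : S2 -> S2, {in U, cancel f g} &
        forall w, V w -> holomorphic_at g w].

(* * Circles and disks in the sphere *)

(* [Line a b] is the line Re (conj a * z) = b, with infinity added. *)
Variant gcircle := Circle of C & R | Line of C & R.

Definition proper_circle (K : gcircle) : bool :=
  match K with Circle _ r => 0 < r | Line a _ => a != 0 end.

Definition circle_pts (K : gcircle) : set S2 :=
  match K with
  | Circle c r => Some @` [set t | `|t - c| = r%:C]
  | Line a b => [set None] `|` Some @` [set t | Re (conjc a * t) = b]
  end.

(* The two closed disks bounded by K. *)
Definition disk_le (K : gcircle) : set S2 :=
  match K with
  | Circle c r => Some @` [set t | `|t - c| <= r%:C]
  | Line a b => [set None] `|` Some @` [set t | Re (conjc a * t) <= b]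
  end.

Definition disk_ge (K : gcircle) : set S2 :=
  match K with
  | Circle c r => [set None] `|` Some @` [set t | r%:C <= `|t - c|]
  | Line a b => [set None] `|` Some @` [set t | b <= Re (conjc a * t)]
  end.

Definition disk_bounded_by (K : gcircle) (D : set S2) : Prop :=
  proper_circle K /\ (D = disk_le K \/ D = disk_ge K).

Definition reflection (K : gcircle) (z : S2) : S2 :=
  match K, z with
  | Circle c r, None => Some c
  | Circle c r, Some t =>
      if t == c then None else Some (c + r%:C ^+ 2 / conjc (t - c))
  | Line a b, None => None
  | Line a b, Some t => Some ((2 * b%:C - a * conjc t) / conjc a)
  end.

(* * Circular arc triangles *)

Definition closed_jordan_region (X : set S2) : Prop :=
  compact X /\
  exists h : C -> S2, homeomorphism_onto [set t : C | `|t| <= 1] X h.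

Definition circular_arc (A : set S2) (a b : S2) : Prop :=
  (exists2 K, proper_circle K & A `<=` circle_pts K) /\
  exists2 h : R -> S2, homeomorphism_onto (`[0, 1]%classic : set R) A h &
    h 0 = a /\ h 1 = b.

(* A candidate triangle: a region together with its three vertices.  For the
   triangles of the tessellation the labelling is such that the vertices
   0, 1, 2 are those with angles 0, pi/2, pi/3. *)
Record triangle := Triangle { region : set S2; vertex : 'I_3 -> S2 }.

(* The side [s i] is the one opposite to the vertex i; it joins the vertices
   i + 1 and i - 1 modulo 3. *)
Definition triangle_sides (T : triangle) (s : 'I_3 -> set S2) : Prop :=
  [/\ boundary (region T) = \bigcup_i s i,
      forall i, circular_arc (s i) (vertex T (ordS i)) (vertex T (ord_pred i)) &
      forall i, s i `&` s (ordS i) = [set vertex T (ord_pred i)]].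

Definition circular_arc_triangle (T : triangle) : Prop :=
  closed_jordan_region (region T) /\ exists s, triangle_sides T s.

Definition image_triangle (f : S2 -> S2) (T : triangle) : triangle :=
  Triangle (f @` region T) (f \o vertex T).

Definition conformal_map (X Y : triangle) (f : S2 -> S2) : Prop :=
  [/\ circular_arc_triangle X /\ circular_arc_triangle Y,
      homeomorphism_onto (region X) (region Y) f,
      f @` range (vertex X) = range (vertex Y) &
      biholomorphic_onto (inte (region X)) (inte (region Y)) f].

Definition anti_conformal_map (X Y : triangle) (f : S2 -> S2) : Prop :=
  conformal_map X (image_triangle sconj Y) (sconj \o f).

(* * The tessellation *)

Definition T0 : triangle := Triangle
  ([set None] `|`
   Some @` [set t : C | [/\ 0 <= Re t <= 2^-1, 0 < Im t & 1 <= `|t|]])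
  (fun k => if k == 0 then None
            else if k == 1 then Some 'i
            else Some (2^-1 +i* (Num.sqrt 3 / 2))).

(* The circle containing the side of T0 opposite to the vertex k. *)
Definition T0_circle (k : 'I_3) : gcircle :=
  if k == 0 then Circle 0 1 else if k == 1 then Line 1 2^-1 else Line 1 0.

(* Reflections are involutions, so the group they generate consists of their
   compositions. *)
Inductive reflection_group : (S2 -> S2) -> Prop :=
| reflection_group_id : reflection_group id
| reflection_group_comp (k : 'I_3) (S : S2 -> S2) :
    reflection_group S -> reflection_group (reflection (T0_circle k) \o S).

Definition in_tessellation (T : triangle) : Prop :=
  exists2 S, reflection_group S & T = image_triangle S T0.

(* [T'] is the complementary triangle of [T], where the angle of [T] at the
   vertex 0 is 0.  Two distinct circles touch at v iff v is their only common
   point. *)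
Definition complementary_triangle (T T' : triangle) : Prop :=
  exists s K1 K2 D1 D2,
    [/\ triangle_sides T s,
        [/\ disk_bounded_by K1 D1, disk_bounded_by K2 D2,
            (exists i, s i `<=` circle_pts K1),
            (exists i, s i `<=` circle_pts K2) &
            circle_pts K1 `&` circle_pts K2 = [set vertex T 0]],
        region T `<=` D1 `&` D2,
        region T' = closure ((D1 `&` D2) `\` region T) &
        vertex T' = vertex T].

(* * The function p *)

Definition lattice (w1 w2 : C) : set C :=
  [set g | exists k n : int, g = k%:~R * w1 + n%:~R * w2].

(* Weierstrass zeta-function (summation over finite subsets of the set of
   nonzero periods). *)
Definition wzeta (w1 w2 u : C) : C :=
  u^-1 + sum (fun g : (lattice w1 w2 `\ 0 : set C) =>
                (u - val g)^-1 + (val g)^-1 + u / val g ^+ 2).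

Definition quasi_period (w1 w2 w : C) : C :=
  get [set e | forall u, ~ lattice w1 w2 u ->
                 wzeta w1 w2 (u + w) = wzeta w1 w2 u + e].

Definition eta_ratio (w1 w2 : C) : S2 :=
  let eta1 := quasi_period w1 w2 w1 in
  let eta2 := quasi_period w1 w2 w2 in
  if eta2 == 0 then None else Some (eta1 / eta2).

Definition p (t : C) : S2 := eta_ratio t 1.

Definition HH : set S2 := Some @` [set t | 0 < Im t].

(* Only the values on the upper half-plane matter. *)
Definition pbar (z : S2) : S2 := if z is Some t then sconj (p t) else None.

(* [pbar] on the triangle T, extended by limits to the vertices outside the
   upper half-plane. *)
Definition pbar_on (T : triangle) (z : S2) : S2 :=
  if z \in HH then pbar z
  else lim (pbar @ within (region T `&` HH) (nbhs z)).

End Definitions.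

(* Main.v *)
Require Import Defs.
From mathcomp Require Import all_boot all_order all_algebra.
From mathcomp Require Import complex finmap.
From mathcomp Require Import all_classical all_reals all_analysis.
From mathcomp Require Import summability ring lra zify.

(* With q = exp(2 pi i t), the quasi-periods of the lattice Z t + Z are
   eta_2 = G2(t) = (pi^2 / 3) E2(q) and eta_1 = t G2(t) - 2 pi i, so that
   p(t) = t - 6 i / (pi E2(q)).  The transformation rules of G2 under t + 1 and
   -1/t show that pbar commutes with the three generating reflections; hence
   pbar maps each side of T0 into the circle carrying it, and it suffices to
   treat T = T0.

   On the strip 0 <= Re t <= 1/2, Im t >= sqrt 3 / 2 one has |q| < 1/160, and
   p' = N(q) / E2(q)^2 with N(q) = N(q(rho)) + 240 (q - q(rho)) + small error,
   where N(q(rho)) = 0 because the derivative of p vanishes at rho by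
   equivariance under t -> 1 - 1/t.  Since q - q(rho) lies in the first quadrant,
   Re ((1 - i) p') > 0 away from rho, so p is injective on the strip.  By the
   intermediate value theorem the boundary of T0 is mapped onto that of T0', and
   a connectedness argument gives that the interior is mapped onto the interior.

   For T = S(T0) everything is transported by S.  The two touching disks pull
   back under S to half planes bounded by parallel lines through i and rho that
   contain T0, which forces the lines to be vertical and determines T'. *)

Set Implicit Arguments.
Unset Strict Implicit.
Unset Printing Implicit Defensive.

Import Order.TTheory GRing.Theory Num.Theory.
Import numFieldNormedType.Exports ComplexField.Normc.

Local Open Scope classical_set_scope.
Local Open Scope ring_scope.
Local Open Scope complex_scope.

Local Notation Re := complex.Re.
Local Notation Im := complex.Im.

(** * The complex plane and the Riemann sphere *)

(** Residues and the argument principle are replaced by finite and topological arguments. The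
    partial fractions of the cotangent and of pi^2 / sin^2 are limits of duplication formulas, which
    are exact for finite sums; unconditional summation by rows then yields the quasi-periods. The
    rule for -1/t is read off from the zeta-function, whose series may be reindexed freely, rather
    than from the conditionally convergent sum over omega^-2. The obstacle is the vertex rho. There
    the angle pi/3 of T0 becomes the angle 2 pi/3 of T0', so p has a critical point on the boundary
    and is not a small perturbation of an injective linear map near it. Hence p' has to be compared
    with its own value at rho, in a half plane that the perturbation cannot leave. Injectivity is
    proved on the whole strip because the argument runs along segments, and T0, bounded below by a
    circular arc, is not convex. The images of the boundary and of the interior are separated
    without winding numbers: p is open where p' does not vanish, images of compact sets are closed,
    and the model regions are path connected. *)

Section ComplexBasics.
Variable R : realType.
Local Notation C := R[i].
Local Notation S2 := (sphere R).
Implicit Types (z w : C) (x y : R).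

Lemma cReD z w : Re (z + w) = Re z + Re w. Proof. by case: z w => [? ?] []. Qed.
Lemma cImD z w : Im (z + w) = Im z + Im w. Proof. by case: z w => [? ?] []. Qed.
Lemma cReN z : Re (- z) = - Re z. Proof. by case: z. Qed.
Lemma cImN z : Im (- z) = - Im z. Proof. by case: z. Qed.
Lemma cReM z w : Re (z * w) = Re z * Re w - Im z * Im w.
Proof. by case: z w => [? ?] []. Qed.
Lemma cImM z w : Im (z * w) = Re z * Im w + Im z * Re w.
Proof. by case: z w => [? ?] []. Qed.
Lemma cReJ z : Re (conjc z) = Re z. Proof. by case: z. Qed.
Lemma cImJ z : Im (conjc z) = - Im z. Proof. by case: z. Qed.
Lemma cRe1 : Re (1 : C) = 1. Proof. by []. Qed.
Lemma cIm1 : Im (1 : C) = 0. Proof. by []. Qed.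
Lemma Renat n : Re (n%:R : C) = n%:R.
Proof. by rewrite -(rmorph_nat (real_complex R)). Qed.
Lemma Imnat n : Im (n%:R : C) = 0.
Proof. by rewrite -(rmorph_nat (real_complex R)). Qed.
Lemma Reint (n : int) : Re (n%:~R : C) = n%:~R.
Proof. by rewrite -(rmorph_int (real_complex R)). Qed.
Lemma Imint (n : int) : Im (n%:~R : C) = 0.
Proof. by rewrite -(rmorph_int (real_complex R)). Qed.

Definition cE := (cReD, cImD, cReN, cImN, cReM, cImM, cReJ, cImJ, cRe1, cIm1, Renat, Imnat).

Lemma eqReIm z w : Re z = Re w -> Im z = Im w -> z = w.
Proof. by case: z w => [? ?] [? ?] /= -> ->. Qed.

Lemma normcE z : `|z| = (normc z)%:C. Proof. by case: z. Qed.
Lemma normc_ge0 z : 0 <= normc z. Proof. by case: z => a b; exact: sqrtr_ge0. Qed.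
Lemma sqr_normcE z : normc z ^+ 2 = Re z ^+ 2 + Im z ^+ 2.
Proof. by case: z => a b /=; rewrite sqr_sqrtr // addr_ge0 ?sqr_ge0. Qed.
Lemma normcD z w : normc (z + w) <= normc z + normc w. Proof. exact: le_normcD. Qed.
Lemma normcN z : normc (- z) = normc z. Proof. exact: complex.normcN. Qed.
Lemma normcBC z w : normc (z - w) = normc (w - z).
Proof. by rewrite -normcN opprB. Qed.
Lemma normcB z w : normc (z - w) <= normc z + normc w.
Proof. by rewrite -(normcN w); exact: normcD. Qed.
Lemma lenB z w : normc z - normc w <= normc (z - w).
Proof. by rewrite lerBlDr -{1}(subrK w z) normcD. Qed.
Lemma lenD z w : normc z - normc w <= normc (z + w).
Proof. by rewrite -(normcN w) -{2}(opprK w) lenB. Qed.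
Lemma normc_triangle u z w : normc (z - w) <= normc (z - u) + normc (u - w).
Proof. by have := normcD (z - u) (u - w); rewrite addrA subrK. Qed.
Lemma normc_eq0 z : (normc z == 0) = (z == 0).
Proof. by apply/eqP/eqP => [/eq0_normc //|->]; rewrite normc0. Qed.
Lemma normc_gt0 z : (0 < normc z) = (z != 0).
Proof. by rewrite lt_def normc_eq0 normc_ge0 andbT. Qed.
Lemma normcX z n : normc (z ^+ n) = normc z ^+ n.
Proof. by elim: n => [|n IH]; rewrite ?expr0 ?normc1 // !exprS normcM IH. Qed.
Lemma normcJ' z : normc (conjc z) = normc z.
Proof. by case: z => a b /=; rewrite sqrrN. Qed.
Lemma normc_real x : normc x%:C = `|x|.
Proof. by rewrite /= expr0n addr0 sqrtr_sqr. Qed.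
Lemma normc_nat n : normc (n%:R : C) = n%:R.
Proof. by rewrite -(rmorph_nat (real_complex R)) normc_real ger0_norm. Qed.
Lemma normc_int (n : int) : normc (n%:~R : C) = `|n%:~R|.
Proof. by rewrite -(rmorph_int (real_complex R)) normc_real. Qed.
Lemma normc_i : normc ('i%C : C) = 1.
Proof. by rewrite /= expr0n add0r expr1n sqrtr1. Qed.
Lemma normc_sum (I : Type) (r : seq I) (P : pred I) (f : I -> C) :
  normc (\sum_(i <- r | P i) f i) <= \sum_(i <- r | P i) normc (f i).
Proof.
elim/big_rec2 : _ => [|i a b _ IH]; first by rewrite normc0.
by rewrite (le_trans (normcD _ _)) // lerD2l.
Qed.
Lemma Re_le_normc z : `|Re z| <= normc z.
Proof.
rewrite -(ler_pXn2r (n := 2)) ?nnegrE ?normc_ge0 // sqr_normcE real_normK ?num_real //.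
by rewrite lerDl sqr_ge0.
Qed.
Lemma Im_le_normc z : `|Im z| <= normc z.
Proof.
rewrite -(ler_pXn2r (n := 2)) ?nnegrE ?normc_ge0 // sqr_normcE real_normK ?num_real //.
by rewrite lerDr sqr_ge0.
Qed.
Lemma normc_le_ReIm z : normc z <= `|Re z| + `|Im z|.
Proof.
rewrite -(ler_pXn2r (n := 2)) ?nnegrE ?normc_ge0 ?addr_ge0 // sqr_normcE.
rewrite sqrrD !real_normK ?num_real // lerD2r lerDl mulrn_wge0 // mulr_ge0.
Qed.
Lemma normc_le z x : 0 <= x -> Re z ^+ 2 + Im z ^+ 2 <= x ^+ 2 -> normc z <= x.
Proof. by move=> x0 h; rewrite -(ler_pXn2r (n := 2)) ?nnegrE ?normc_ge0 // sqr_normcE. Qed.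
Lemma le_normc z x : 0 <= x -> x ^+ 2 <= Re z ^+ 2 + Im z ^+ 2 -> x <= normc z.
Proof. by move=> x0 h; rewrite -(ler_pXn2r (n := 2)) ?nnegrE ?normc_ge0 // sqr_normcE. Qed.

(** The norm of [R[i]] takes values in [R[i]] itself; this restates neighbourhoods with the real
    modulus [normc], so that all later estimates take place in the ordered field [R]. *)
Lemma nbhsC z (U : set C) :
  nbhs z U <-> exists2 e : R, 0 < e & forall w, normc (w - z) < e -> U w.
Proof.
split=> [/nbhs_ballP[e /= e0 h]|[e e0 h]].
  exists (Re e); first by move: e0; rewrite ltcE => /andP[].
  move=> w wz; apply: h; rewrite -ball_normE /= normcE normcBC ltcE /=.
  by move: e0; rewrite ltcE => /andP[/= -> _].
apply/nbhs_ballP; exists e%:C; first by rewrite /= ltcR.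
by move=> w; rewrite -ball_normE /= normcE ltcR normcBC => /h.
Qed.

Lemma nbhsS_some z (U : set S2) :
  nbhs (Some z : S2) U <->
  exists2 e : R, 0 < e & forall w, normc (w - z) < e -> U (Some w).
Proof. exact: nbhsC. Qed.

Lemma compact_bbox (M : R) : compact [set z : C | `|Re z| <= M /\ `|Im z| <= M].
Proof.
pose f (u : R * R) : C := u.1 +i* u.2.
have -> : [set z : C | `|Re z| <= M /\ `|Im z| <= M] =
    f @` (`[- M, M] `*` `[- M, M]).
  apply/seteqP; split => [[a b] /= [ha hb]|_ [[a b] /= [ha hb] <-] /=].
    by exists (a, b) => //=; rewrite !in_itv /= -!ler_norml.
  by move: ha hb; rewrite !in_itv /= -!ler_norml.
apply: continuous_compact; last first.
  by apply: compact_setX; exact: segment_compact.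
apply: continuous_subspaceT => -[a b] U /nbhsC[e e0 h].
exists (ball a (e / 2), ball b (e / 2)).
  by split; apply: nbhsx_ballx; rewrite divr_gt0.
move=> [x y] [/= hx hy]; apply: h; apply: le_lt_trans (normc_le_ReIm _) _.
move: hx hy; rewrite -!ball_normE /= => hx hy.
by rewrite [ltRHS]splitr ltrD // distrC.
Qed.

Lemma closedC_norm (f : C -> R) (M : R) : continuous f -> closed [set z | f z <= M].
Proof.
move=> cf; apply: (@closed_comp _ _ f [set x | x <= M]) => [x _|]; [exact: cf|exact: closed_le].
Qed.

Lemma continuousC_lip (f : C -> R) (K : R) :
  (forall z w, `|f z - f w| <= K * normc (z - w)) -> continuous f.
Proof.
move=> h z U /nbhs_ballP[e /= e0 hU]; apply/nbhsC.
exists (e / (`|K| + 1)); first by rewrite divr_gt0 // ltr_wpDl.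
move=> w wz; apply: hU; rewrite -ball_normE /=.
apply: le_lt_trans (h _ _) _; rewrite normcBC.
apply: le_lt_trans (_ : (`|K| + 1) * normc (w - z) < _).
  by rewrite ler_wpM2r ?normc_ge0 // (le_trans (ler_norm _)) // lerDl.
by rewrite mulrC -ltr_pdivlMr // ltr_wpDl.
Qed.

Lemma continuous_normc : continuous (@normc R).
Proof.
apply: (continuousC_lip (K := 1)) => z w; rewrite mul1r ler_norml lenB andbT.
by rewrite lerNl opprB normcBC lenB.
Qed.
Lemma continuous_Re : continuous (@complex.Re R).
Proof.
apply: (continuousC_lip (K := 1)) => z w; rewrite mul1r.
by have := Re_le_normc (z - w); rewrite !cE.
Qed.
Lemma continuous_Im : continuous (@complex.Im R).
Proof.
apply: (continuousC_lip (K := 1)) => z w; rewrite mul1r.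
by have := Im_le_normc (z - w); rewrite !cE.
Qed.

Lemma compact_disk (M : R) : compact [set z : C | normc z <= M].
Proof.
apply: (subclosed_compact _ (@compact_bbox M)).
  exact/closedC_norm/continuous_normc.
by move=> z /= h; split; apply: le_trans h; [exact: Re_le_normc|exact: Im_le_normc].
Qed.

Lemma compact_bounded_normc (K : set C) : compact K ->
  exists M : R, forall z, K z -> normc z <= M.
Proof.
move=> cK; have := continuous_compact (continuous_subspaceT continuous_normc) cK.
move/compact_bounded => [M [_ h]]; exists (M + 1) => z Kz.
apply: le_trans (ler_norm _) _; apply: (h (M + 1)); first by rewrite ltrDl.
by exists z.
Qed.

(** Compact sets of the plane are bounded and closed disks are compact, so complements of disks form
    a basis at infinity. *)
Lemma nbhsS_none (U : set S2) :
  nbhs (None : S2) U <->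
  U None /\ exists M : R, forall w, M < normc w -> U (Some w).
Proof.
split=> [[K [cK clK] h]|[UN [M h]]].
  have [M hM] := compact_bounded_normc cK.
  split; first by apply: h; right.
  exists M => w Mw; apply: h; left; exists w => // Kw.
  by have := hM _ Kw; rewrite leNgt Mw.
exists [set z | normc z <= M].
  by split; [exact: compact_disk|apply: closedC_norm; exact: continuous_normc].
move=> _ [[w /= /negP + <-]|-> //]; rewrite -ltNge; exact: h.
Qed.

Lemma hausdorffC : hausdorff_space C. Proof. exact: norm_hausdorff. Qed.

Lemma hausdorffS : hausdorff_space S2.
Proof.
apply: one_point_compactification_hausdorff; last exact: hausdorffC.
move=> z _; exists [set w | normc (w - z) <= 1].
  rewrite withinET; apply/nbhsC; exists 1 => // w; exact: ltW.
split.
  apply: (subclosed_compact _ (@compact_disk (1 + normc z))).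
    apply: closedC_norm; apply: (continuousC_lip (K := 1)) => a b.
    rewrite mul1r; have h1 := normc_triangle b a z; have h2 := normc_triangle a b z.
    have h3 := normcBC a b; rewrite ler_norml; lra.
  by move=> w /= h; have := normcD (w - z) z; rewrite subrK; lra.
apply: closedC_norm; apply: (continuousC_lip (K := 1)) => a b.
rewrite mul1r; have h1 := normc_triangle b a z; have h2 := normc_triangle a b z.
have h3 := normcBC a b; rewrite ler_norml; lra.
Qed.

End ComplexBasics.

(** * Unconditional sums *)

Section HasSum.
Variable R : realType.
Local Notation C := R[i].

(* Convergence of the net of finite partial sums; finite subsets are
   represented by duplicate-free sequences. *)
Definition has_sum (I : choiceType) (f : I -> C) (s : C) : Prop :=
  forall e : R, 0 < e -> exists A : seq I, forall B : seq I, uniq B ->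
    {subset A <= B} -> normc (\sum_(i <- B) f i - s) < e.

Definition bsum (I : choiceType) (g : I -> R) (M : R) : Prop :=
  (forall i, 0 <= g i) /\ forall B : seq I, uniq B -> \sum_(i <- B) g i <= M.

Section Basic.
Variable I : choiceType.
Implicit Types (f g : I -> C) (s t : C).

Lemma small_eq (x : R) : (forall e : R, 0 < e -> x < e) -> x <= 0.
Proof. by move=> h; case: (leP x 0) => // /h; rewrite ltxx. Qed.

Lemma small_eqC (z : C) : (forall e : R, 0 < e -> normc z < e) -> z = 0.
Proof.
move=> /small_eq h; apply/eqP; rewrite -normc_eq0; apply/eqP/le_anti.
by rewrite h normc_ge0.
Qed.

Lemma has_sum_unique f s t : has_sum f s -> has_sum f t -> s = t.
Proof.
move=> hs ht; apply/eqP; rewrite -subr_eq0; apply/eqP/small_eqC => e e0.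
have e2 : 0 < e / 2 by rewrite divr_gt0.
have [A hA] := hs _ e2; have [B hB] := ht _ e2.
have := hA (undup (A ++ B)) (undup_uniq _) _.
have := hB (undup (A ++ B)) (undup_uniq _) _.
move=> h1 h2; rewrite (le_lt_trans (normc_triangle (\sum_(i <- undup (A ++ B)) f i) _ _)) //.
rewrite normcBC (splitr e) ltrD ?h1 ?h2 // => x;
  by rewrite mem_undup mem_cat => ->; rewrite ?orbT.
Qed.

Lemma has_sum_ext f g s : f =1 g -> has_sum f s -> has_sum g s.
Proof. by move=> /funext ->. Qed.

Lemma has_sum0 : has_sum (fun _ : I => 0) 0.
Proof. by move=> e e0; exists [::] => B _ _; rewrite big1 // subr0 normc0. Qed.

Lemma has_sumD f g s t : has_sum f s -> has_sum g t ->
  has_sum (fun i => f i + g i) (s + t).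
Proof.
move=> hs ht e e0; have e2 : 0 < e / 2 by rewrite divr_gt0.
have [A hA] := hs _ e2; have [B hB] := ht _ e2.
exists (A ++ B) => D uD sD; rewrite big_split /= opprD addrACA.
rewrite (le_lt_trans (normcD _ _)) // (splitr e) ltrD ?hA ?hB // => x xA;
  by rewrite sD // mem_cat xA ?orbT.
Qed.

Lemma has_sumZ f s (c : C) : has_sum f s -> has_sum (fun i => c * f i) (c * s).
Proof.
move=> hs e e0; have c0 : 0 < normc c + 1 by rewrite ltr_wpDl ?normc_ge0.
have [A hA] := hs (e / (normc c + 1)) (divr_gt0 e0 c0).
exists A => B uB sB; rewrite -big_distrr /= -mulrBr normcM.
apply: le_lt_trans (_ : (normc c + 1) * normc (\sum_(i <- B) f i - s) < _).
  by rewrite ler_wpM2r ?normc_ge0 // lerDl.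
by rewrite mulrC -ltr_pdivlMr // hA.
Qed.

Lemma has_sumN f s : has_sum f s -> has_sum (fun i => - f i) (- s).
Proof.
by move/(has_sumZ (-1)); rewrite mulN1r; apply: has_sum_ext => i; rewrite mulN1r.
Qed.

Lemma has_sumB f g s t : has_sum f s -> has_sum g t ->
  has_sum (fun i => f i - g i) (s - t).
Proof. by move=> hs ht; apply: has_sumD => //; exact: has_sumN. Qed.

Lemma has_sum_J f s : has_sum f s -> has_sum (fun i => conjc (f i)) (conjc s).
Proof.
move=> hs e /hs[A hA]; exists A => B uB sB.
by rewrite -(rmorph_sum (@conjc R)) -rmorphB normcJ' hA.
Qed.

Lemma has_sum_bigsum (K : Type) (r : seq K) (F : K -> I -> C) (S : K -> C) :
  (forall k, has_sum (F k) (S k)) ->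
  has_sum (fun i => \sum_(k <- r) F k i) (\sum_(k <- r) S k).
Proof.
move=> h; elim: r => [|k r IH].
  by rewrite big_nil; apply: has_sum_ext has_sum0 => i; rewrite big_nil.
rewrite big_cons; apply: has_sum_ext (has_sumD (h k) IH) => i.
by rewrite big_cons.
Qed.

Lemma has_sum1 (i0 : I) (c : C) : has_sum (fun i => if i == i0 then c else 0) c.
Proof.
move=> e e0; exists [:: i0] => B uB sB.
rewrite (bigD1_seq i0) //=; last by apply: sB; rewrite inE.
rewrite eqxx big1 ?addr0 ?subrr ?normc0 // => i /negbTE -> //.
Qed.

Lemma has_sum_norm_le f s (M : R) : has_sum f s ->
  (forall B, uniq B -> normc (\sum_(i <- B) f i) <= M) -> normc s <= M.
Proof.
move=> hs hM; rewrite -subr_le0; apply: small_eq => e /hs[A hA].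
have h := hA _ (undup_uniq A) _; have h' := hM _ (undup_uniq A).
rewrite ltrBlDl; apply: le_lt_trans (_ : normc (s - \sum_(i <- undup A) f i) +
  normc (\sum_(i <- undup A) f i) < _).
  by rewrite -{1}(subrK (\sum_(i <- undup A) f i) s) normcD.
rewrite addrC ler_ltD // normcBC h // => x; by rewrite mem_undup.
Qed.

Lemma has_sum_normB f s (g : I -> R) (M : R) : has_sum f s -> bsum g M ->
  (forall i, normc (f i) <= g i) -> normc s <= M.
Proof.
move=> hs [g0 gM] fg; apply: (has_sum_norm_le hs) => B uB.
apply: le_trans (gM B uB); apply: le_trans (normc_sum _ _ _) _.
exact: ler_sum.
Qed.

Lemma has_sum_ge0 (g : I -> R) (M : R) : bsum g M ->
  exists s : R, has_sum (fun i => (g i)%:C) s%:C.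
Proof.
move=> [g0 gM].
pose S : set R := [set x | exists2 B : seq I, uniq B & x = \sum_(i <- B) g i].
have hS : has_sup S.
  split; first by exists 0; exists [::] => //; rewrite big_nil.
  by exists M => _ [B uB ->]; exact: gM.
exists (sup S) => e e0; have [_ [A uA ->] hA] := sup_adherent e0 hS.
exists A => B uB sB.
rewrite -(rmorph_sum (real_complex R)) -rmorphB normc_real ltr_norml.
have h1 : \sum_(i <- B) g i <= sup S by apply: ub_le_sup; [case: hS|exists B].
have h2 : \sum_(i <- A) g i <= \sum_(i <- B) g i.
  rewrite [leRHS](bigID (mem A)) /= -[leLHS]addr0 lerD ?sumr_ge0 //.
  rewrite -[leRHS]big_filter le_eqVlt; apply/orP; left; apply/eqP.
  apply: perm_big; apply: uniq_perm => //; first exact: filter_uniq.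
  by move=> x; rewrite mem_filter /=; case xA: (x \in A); rewrite //= sB.
apply/andP; split; lra.
Qed.

Lemma has_sum_ex f (g : I -> R) (M : R) : bsum g M ->
  (forall i, normc (f i) <= g i) -> exists s, has_sum f s.
Proof.
move=> bg fg; have [t ht] := has_sum_ge0 bg.
(* A signed family dominated by [g] is the difference of [h + g] and [g], both nonnegative with
   bounded finite sums. *)
have part (h : I -> R) : (forall i, `|h i| <= g i) ->
    exists s, has_sum (fun i => (h i)%:C) s.
  move=> hh; have bb : bsum (fun i => h i + g i) (M + M).
    split=> [i|B uB]; first by have := hh i; rewrite ler_norml; lra.
    rewrite big_split /= lerD // ?(bg.2) //; apply: le_trans (bg.2 B uB).
    by apply: ler_sum => i _; rewrite (le_trans (ler_norm _)).
  have [u hu] := has_sum_ge0 bb; exists (u%:C - t%:C).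
  by apply: has_sum_ext (has_sumB hu ht) => i; rewrite rmorphD /= addrK.
have [a ha] := part (fun i => Re (f i)) (fun i => le_trans (Re_le_normc _) (fg i)).
have [b hb] := part (fun i => Im (f i)) (fun i => le_trans (Im_le_normc _) (fg i)).
exists (a + 'i%C * b); apply: has_sum_ext (has_sumD ha (has_sumZ 'i%C hb)) => i.
by rewrite [RHS]complexE.
Qed.

Lemma bsum_scale (g : I -> R) (M K : R) : 0 <= K -> bsum g M ->
  bsum (fun i => K * g i) (K * M).
Proof.
move=> K0 [g0 gM]; split=> [i|B uB]; first exact: mulr_ge0.
by rewrite -big_distrr /= ler_wpM2l // gM.
Qed.

Lemma bsum_D1 (g : I -> R) (M : R) (i0 : I) : bsum g M ->
  bsum (fun i => if i == i0 then 0 else g i) (M - g i0).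
Proof.
move=> [g0 gM]; split=> [i|B uB]; first by case: ifP.
rewrite lerBrDr; pose B' := i0 :: [seq i <- B | i != i0].
have uB' : uniq B' by rewrite /= mem_filter eqxx filter_uniq.
apply: le_trans (gM B' uB'); rewrite /B' big_cons addrC lerD2l.
by rewrite big_filter [leRHS]big_mkcond /=; apply: ler_sum => i _; case: eqP.
Qed.

End Basic.

Lemma sum_pmap (I J : choiceType) (h : J -> I) (h' : I -> option J) (f : I -> C) :
  (forall i, h' i = None -> f i = 0) -> (forall i j, h' i = Some j -> h j = i) ->
  forall B : seq I, \sum_(i <- B) f i = \sum_(j <- pmap h' B) f (h j).
Proof.
move=> h1 h2; elim=> [|i B IH]; first by rewrite !big_nil.
rewrite big_cons /= IH; case E: (h' i) => [j|] /=.
  by rewrite big_cons (h2 _ _ E).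
by rewrite h1 // add0r.
Qed.

Lemma has_sum_reindex (I J : choiceType) (h : J -> I) (h' : I -> option J)
    (f : I -> C) (s : C) :
  pcancel h h' -> (forall i, h' i = None -> f i = 0) ->
  (forall i j, h' i = Some j -> h j = i) ->
  has_sum f s <-> has_sum (f \o h) s.
Proof.
move=> hK h1 h2; split=> hs e /hs[A hA].
  exists (pmap h' A) => B uB sB.
  (* The members of [A] outside the range of [h] contribute nothing, but they must be adjoined for
     the finite set to contain [A]. *)
  pose N := [seq a <- undup A | h' a == None].
  have N0 : \sum_(i <- N) f i = 0.
    by rewrite big_filter big1 // => i /eqP /h1.
  have := hA (map h B ++ N) _ _; rewrite big_cat /= N0 addr0 big_map; apply.
    rewrite cat_uniq (map_inj_uniq (pcan_inj hK)) uB filter_uniq ?undup_uniq //= andbT.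
    apply/hasP => -[k]; rewrite mem_filter => /andP[/eqP hk _] /mapP[j _ kj].
    by rewrite kj hK in hk.
  move=> a aA; rewrite mem_cat; case E: (h' a) => [j|].
    rewrite -(h2 _ _ E) map_f // sB // mem_pmap -E; exact: map_f.
  by rewrite mem_filter E /= mem_undup aA orbT.
exists (map h A) => B uB sB; rewrite (sum_pmap h1 h2).
apply: hA.
  elim: B uB {sB} => //= i B IH /andP[iB uB]; case E: (h' i) => [j|] /=; last exact: IH.
  rewrite IH // andbT; apply: contra iB; rewrite mem_pmap => /mapP[k kB jk].
  by rewrite -(h2 _ _ E) (h2 k j).
move=> j jA; rewrite mem_pmap -(hK j); apply: map_f; apply: sB; exact: map_f.
Qed.

Lemma has_sum_pull (I J : choiceType) (h : J -> I) (h' : I -> option J)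
    (f : I -> C) (s : C) :
  pcancel h h' -> (forall i, h' i = None -> f i = 0) ->
  (forall i j, h' i = Some j -> h j = i) -> has_sum f s -> has_sum (f \o h) s.
Proof. by move=> a b c; case: (has_sum_reindex s a b c). Qed.

Lemma has_sum_push (I J : choiceType) (h : J -> I) (h' : I -> option J)
    (f : I -> C) (s : C) :
  pcancel h h' -> (forall i, h' i = None -> f i = 0) ->
  (forall i j, h' i = Some j -> h j = i) -> has_sum (f \o h) s -> has_sum f s.
Proof. by move=> a b c; case: (has_sum_reindex s a b c). Qed.

Lemma has_sum_bij (I J : choiceType) (h : J -> I) (h' : I -> J) (f : I -> C) (s : C) :
  cancel h h' -> cancel h' h -> has_sum f s -> has_sum (f \o h) s.
Proof.
move=> hK h'K; apply: (has_sum_pull (h' := Some \o h')) => //.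
  by move=> j /=; rewrite hK.
by move=> i j [<-].
Qed.

(** Fubini for unconditional sums: finitely many rows are approximated simultaneously over one
    finite set of columns, and the resulting rectangle contains the finite set prescribed by the
    double sum. *)
Lemma has_sum_rows (I J : choiceType) (f : I * J -> C) (r : I -> C) (s : C) :
  has_sum f s -> (forall i, has_sum (fun j => f (i, j)) (r i)) -> has_sum r s.
Proof.
move=> hs hr e e0; have e2 : 0 < e / 2 by rewrite divr_gt0.
have [A hA] := hs _ e2; exists (map fst A) => B uB sB.
have [D hD] := has_sum_bigsum B hr e2.
pose E := undup (D ++ map snd A); pose F := [seq (i, j) | i <- B, j <- E].
have := hA F _ _; have := hD E (undup_uniq _) _.
rewrite exchange_big /= -big_allpairs -/F => h1 h2.
rewrite (le_lt_trans (normc_triangle (\sum_(i <- F) f i) _ _)) //.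
rewrite normcBC (splitr e) ltrD //.
  by apply: h1 => x xD; rewrite mem_undup mem_cat xD.
apply: h2; first by apply: allpairs_uniq => //; [exact: undup_uniq|move=> [? ?] [? ?]].
move=> [i j] ij; apply/allpairsP; exists (i, j) => /=; split=> //.
  by apply: sB; apply/mapP; exists (i, j).
by rewrite mem_undup mem_cat (_ : j \in map snd A) ?orbT //; apply/mapP; exists (i, j).
Qed.

(** A finite set of pairs lies in the rectangle spanned by its two projections, where the sum
    factors. *)
Lemma bsum_prod (I J : choiceType) (g : I -> R) (h : J -> R) (M N : R) :
  bsum g M -> bsum h N -> bsum (fun u : I * J => g u.1 * h u.2) (M * N).
Proof.
move=> [g0 gM] [h0 hN]; split=> [u|B uB]; first exact: mulr_ge0.
pose X := undup (map fst B); pose Y := undup (map snd B).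
pose F := [seq (i, j) | i <- X, j <- Y].
have uF : uniq F.
  by apply: allpairs_uniq => //; rewrite ?undup_uniq //; move=> [? ?] [? ?].
have BF : {subset B <= F}.
  move=> [i j] ij; apply/allpairsP; exists (i, j) => /=.
  by split=> //; rewrite mem_undup; apply/mapP; exists (i, j).
apply: (@le_trans _ _ (\sum_(u <- F) g u.1 * h u.2)).
  rewrite [leRHS](bigID (mem B)) /= -[leLHS]addr0 lerD ?sumr_ge0 //; last first.
    by move=> i _; exact: mulr_ge0.
  rewrite -[leRHS]big_filter le_eqVlt; apply/orP; left; apply/eqP.
  apply: perm_big; apply: uniq_perm => //; first exact: filter_uniq.
  by move=> x; rewrite mem_filter /=; case xB: (x \in B); rewrite //= BF.
rewrite big_allpairs /=.
under eq_bigr do rewrite -big_distrr /=.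
rewrite -big_distrl /=; apply: ler_pM; rewrite ?sumr_ge0 //.
  by rewrite gM // undup_uniq.
by rewrite hN // undup_uniq.
Qed.

(** Ties [has_sum] to the limit [sum] over finite sets, in terms of which [wzeta] is defined. *)
Lemma has_sum_sum (I : choiceType) (f : I -> C) (s : C) : has_sum f s -> sum f = s.
Proof.
move=> hs; have FF := @totally_filter I; apply: cvg_lim; first exact: hausdorffC.
move=> U /nbhsC[e e0 hU]; have [A hA] := hs _ e0.
exists [fset x in A]%fset => // B AB; apply: hU; rewrite /= /partial_sum.
rewrite -(big_seq_fsetE _ B xpredT f); apply: hA; first exact: fset_uniq.
by move=> x xA; apply: (fsubsetP AB); rewrite inE.
Qed.

Lemma has_sum_shift (f : nat -> C) (s : C) :
  has_sum f s -> has_sum (fun n => f n.+1) (s - f 0).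
Proof.
move=> hs; pose f0 n := if n == 0 then 0 else f n.
have h0 : has_sum f0 (s - f 0).
  apply: has_sum_ext (has_sumB hs (has_sum1 0 (f 0))) => -[|n].
    by rewrite eqxx subrr.
  by rewrite subr0.
apply: (has_sum_pull (h := S) (h' := fun n => if n is k.+1 then Some k else None) (f := f0)) h0 => //.
  by case.
by case=> // n j [->].
Qed.

(** The window from -N to N - 1 has 2 N members; for N a power of two it is the window produced by
    the iterated duplication formulas. *)
Lemma has_sum_sym (f : int -> C) (s : C) : has_sum f s ->
  forall e : R, 0 < e -> exists N0 : nat, forall N : nat, (N0 <= N)%N ->
    normc (\sum_(k < N + N) f (k%:Z - N%:Z) - s) < e.
Proof.
move=> hs e /hs[A hA]; exists (\sum_(a <- A) `|a|%N.+1)%N => N hN.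
rewrite -(big_mkord xpredT (fun k : nat => f (k%:Z - N%:Z))) /index_iota subn0.
rewrite -(big_map (fun k : nat => (k%:Z - N%:Z)) xpredT f); apply: hA.
  by rewrite map_inj_uniq ?iota_uniq // => i j /addIr [].
move=> a aA; have aN : (`|a|%N.+1 <= N)%N.
  apply: leq_trans hN; rewrite (big_rem a) //= leq_addr //.
apply/mapP; exists (absz (a + N%:Z)); rewrite ?mem_iota; lia.
Qed.

Lemma has_sum_pairs (f : int -> C) (t : C) : (forall m, f (- m) = f m) ->
  has_sum (fun n : nat => f n.+1%:Z) t -> has_sum f (f 0 + 2 * t).
Proof.
move=> fN ht.
pose fp (m : int) := if m is Posz n.+1 then f m else 0.
pose fm (m : int) := if m is Negz n then f m else 0.
have hp : has_sum fp t.
  apply: (has_sum_push (h := fun n : nat => n.+1%:Z)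
    (h' := fun m : int => if m is Posz n.+1 then Some n else None)) => //.
    by case=> // -[|n].
  by case=> [[|n]|n] j // [->].
have hm : has_sum fm t.
  apply: (has_sum_push (h := Negz)
    (h' := fun m : int => if m is Negz n then Some n else None)).
  - by [].
  - by case.
  - by case=> [n|n] j // [->].
  by apply: has_sum_ext ht => n /=; rewrite /fm NegzE fN.
have := has_sumD (has_sumD (has_sum1 (0 : int) (f 0)) hp) hm.
have -> : f 0 + t + t = f 0 + 2 * t by ring.
apply: has_sum_ext; by case=> [[|n]|n] /=; rewrite ?addr0 ?add0r.
Qed.

End HasSum.

(** * The complex exponential *)

Section ComplexExp.
Variable R : realType.
Local Notation C := R[i].
Implicit Types (z w : C) (x y : R).

Lemma mvt (f df : R -> R) (a b : R) : (forall x : R, is_derive x 1 f (df x)) ->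
  exists2 c, `|c - a| <= `|b - a| & f b - f a = df c * (b - a).
Proof.
move=> hf.
have cf : continuous f by move=> x; apply/differentiable_continuous/derivable1_diffP.
case: (leP a b) => ab.
  have [c cab ->] := MVT_segment ab (fun x _ => hf x) (continuous_subspaceT cf).
  by exists c => //; move: cab; rewrite in_itv /= => /andP[? ?]; rewrite !ger0_norm; lra.
have [c cab E] := MVT_segment (ltW ab) (fun x _ => hf x) (continuous_subspaceT cf).
exists c; last by rewrite -opprB E -mulrN opprB.
move: cab; rewrite in_itv /= => /andP[? ?].
by rewrite ler0_norm ?ler0_norm; lra.
Qed.

Lemma mvt0 (f df : R -> R) x : (forall x : R, is_derive x 1 f (df x)) ->
  exists2 c, `|c| <= `|x| & f x - f 0 = df c * x.
Proof. by move=> /(mvt 0 x)[c]; rewrite !subr0; exists c. Qed.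

Lemma norm_sin_le x : `|sin x| <= `|x|.
Proof.
have [c _] := mvt0 x (@is_derive_sin R); rewrite sin0 subr0 => ->.
by rewrite normrM ler_piMl // cos_max.
Qed.

Lemma cos_sub1 x : 0 <= 1 - cos x <= x ^+ 2 / 2.
Proof.
rewrite subr_ge0 cos_le1 /=.
have E : (x / 2) *+ 2 = x by rewrite -mulr_natr; field.
have := cos_mulr2n (x / 2); rewrite E cos2sin2 -mulr_natr => ->.
have := norm_sin_le (x / 2); rewrite -(ler_pXn2r (n := 2)) ?nnegrE //.
rewrite !real_normK ?num_real //; rewrite expr_div_n; lra.
Qed.

Lemma sin_subx x : `|sin x - x| <= `|x| ^+ 3 / 2.
Proof.
have h y : is_derive y 1 (fun z : R => sin z - z) (cos y - 1) by apply: is_deriveB.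
have [c cx] := mvt0 x h; rewrite sin0 !subr0 => ->.
rewrite normrM exprSr mulrAC ler_wpM2r //.
have /andP[h0 h1] := cos_sub1 c; rewrite distrC ger0_norm //.
apply: le_trans h1 _; rewrite ler_pM2r // -[c ^+ 2]real_normK ?num_real //.
by rewrite ler_pXn2r ?nnegrE.
Qed.

Lemma expR_sub1 (B x : R) : `|x| <= B -> `|expR x - 1| <= expR B * `|x|.
Proof.
move=> xB; have [c cx] := mvt0 x (@is_derive_expR R).
rewrite expR0 => ->; rewrite normrM ger0_norm ?expR_ge0 // ler_wpM2r // ler_expR.
by have := ler_norm c; lra.
Qed.

Lemma expR_sub1x (B x : R) : `|x| <= B -> `|expR x - 1 - x| <= expR B * `|x| ^+ 2.
Proof.
move=> xB.
have h y : is_derive y 1 (fun z : R => expR z - 1 - z) (expR y - 0 - 1) by apply: is_deriveB.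
have [c cx] := mvt0 x h; rewrite expR0 !subrr !subr0 => ->.
rewrite normrM exprSr mulrA ler_wpM2r //; apply: le_trans (expR_sub1 (_ : `|c| <= B)) _.
  exact: le_trans xB.
by rewrite ler_wpM2l // expR_ge0.
Qed.

Lemma sinh_subx (B x : R) : `|x| <= B ->
  `|(expR x - expR (- x)) / 2 - x| <= expR B * `|x| ^+ 3.
Proof.
move=> xB.
have h y : is_derive y 1 (fun z : R => (expR z - expR (- z)) / 2 - z)
    ((expR y + expR (- y)) / 2 - 1).
  have h1 : is_derive y 1 (fun z : R => expR (- z)) (- expR (- y)).
    have h2 : is_derive y 1 (fun z : R => - z) (-1) by apply: is_deriveN.
    have h := is_derive1_comp (is_derive_expR (- y)) h2.
    by apply: is_derive_eq h _; rewrite mulrN1.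
  have h3 := is_deriveB (is_derive_expR y) h1.
  have h4 : is_derive y 1 (fun z : R => (expR z - expR (- z)) / 2)
      ((expR y + expR (- y)) / 2).
    rewrite (_ : (fun z : R => _) = 2^-1 \*: (expR - (fun z : R => expR (- z)))); last first.
      by apply/funext => z /=; rewrite /GRing.scale /= mulrC.
    by apply: is_derive_eq (is_deriveZ (2^-1 : R) h3) _; rewrite opprK /GRing.scale /= mulrC.
  exact: is_deriveB h4 _.
have [c cx] := mvt0 x h; rewrite !(oppr0, subrr, mul0r, addr0) => ->.
rewrite normrM exprSr mulrA ler_wpM2r //.
have cB : `|c| <= B by lra.
have h1 := expR_sub1x cB; have h2 : `|- c| <= B by rewrite normrN.
have := expR_sub1x h2; rewrite normrN => h3.
have h4 : expR B * `|c| ^+ 2 <= expR B * `|x| ^+ 2.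
  by rewrite ler_wpM2l ?expR_ge0 // ler_pXn2r ?nnegrE.
have -> : (expR c + expR (- c)) / 2 - 1 =
  (expR c - 1 - c) / 2 + (expR (- c) - 1 - - c) / 2 by field.
apply: le_trans (ler_normD _ _) _; rewrite !normrM.
have -> : `|2^-1 : R| = 2^-1 by rewrite ger0_norm.
by lra.
Qed.

Definition cexp z : C := (expR (Re z))%:C * (cos (Im z) +i* sin (Im z)).

Lemma cexpD z w : cexp (z + w) = cexp z * cexp w.
Proof.
rewrite /cexp !cE expRD cosD sinD; apply: eqReIm; rewrite !cE /=; ring.
Qed.
Lemma cexp0 : cexp 0 = 1.
Proof. by rewrite /cexp /= expR0 cos0 sin0 mul1r. Qed.
Lemma normc_cexp z : normc (cexp z) = expR (Re z).
Proof.
rewrite /cexp normcM normc_real ger0_norm ?expR_ge0 //=.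
by rewrite cos2Dsin2 sqrtr1 mulr1.
Qed.
Lemma cexp_neq0 z : cexp z != 0.
Proof. by rewrite -normc_gt0 normc_cexp expR_gt0. Qed.
Lemma cexpN z : cexp (- z) = (cexp z)^-1.
Proof.
apply: (mulfI (cexp_neq0 z)); rewrite -cexpD subrr cexp0 divff //; exact: cexp_neq0.
Qed.
Lemma cexpJ z : cexp (conjc z) = conjc (cexp z).
Proof. by rewrite /cexp cReJ cImJ cosN sinN; apply: eqReIm; rewrite !cE /=; ring. Qed.
Lemma cexpX z n : cexp (n%:R * z) = cexp z ^+ n.
Proof.
elim: n => [|n IH]; first by rewrite mul0r cexp0.
by rewrite -natr1 mulrDl mul1r cexpD IH exprSr.
Qed.

(** The function is odd, so the remainder after the linear term is cubic. With only a quadratic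
    bound, pi / sin(pi z) - 1/z would merely be bounded near 0 instead of O(z). *)
Lemma cexp_odd_bound (B : R) : 0 <= B -> exists2 K : R, 0 < K & forall z, normc z <= B ->
  normc (cexp z - cexp (- z) - 2 * z) <= K * normc z ^+ 3.
Proof.
move=> B0; have E0 := expR_gt0 B; have E1 : 1 <= expR B by have := expR_ge1Dx B; lra.
exists (8 * expR B * (1 + B ^+ 2)); first by rewrite !mulr_gt0 // ltr_wpDr // sqr_ge0.
move=> [x y] hz; have hx := le_trans (Re_le_normc _) hz.
have hy := le_trans (Im_le_normc _) hz; rewrite /= in hx hy.
set n := normc _ in hz *; have n0 : 0 <= n by exact: normc_ge0.
have xn : `|x| <= n by exact: (Re_le_normc (x +i* y)).
have yn : `|y| <= n by exact: (Im_le_normc (x +i* y)).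
apply: le_trans (normc_le_ReIm _) _; rewrite /cexp !cE /= cosN sinN.
set A := _ - _ - (2 * x - _); set D := _ - _ - (2 * y + _).
have -> : A = 2 * (((expR x - expR (- x)) / 2 - x) * cos y - x * (1 - cos y)).
  by rewrite /A; field.
have -> : D = 2 * (((expR x - 1 - x) + (expR (- x) - 1 - - x)) / 2 * sin y + (sin y - y)).
  by rewrite /D; field.
have h1 := sinh_subx hx; have h2 := expR_sub1x hx.
have h3 : `|- x| <= B by rewrite normrN.
have h4 := expR_sub1x h3; rewrite normrN in h4.
have h5 := sin_subx y; have h6 := norm_sin_le y; have /andP[h7 h8] := cos_sub1 y.
have h9 := cos_max y.
have x3 : `|x| ^+ 3 <= n ^+ 3 by rewrite ler_pXn2r ?nnegrE.
have y3 : `|y| ^+ 3 <= n ^+ 3 by rewrite ler_pXn2r ?nnegrE.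
have x2 : `|x| ^+ 2 <= n ^+ 2 by rewrite ler_pXn2r ?nnegrE.
have y2 : y ^+ 2 <= n ^+ 2 by rewrite -[y ^+ 2]real_normK ?num_real // ler_pXn2r ?nnegrE.
have a1 : `|((expR x - expR (- x)) / 2 - x) * cos y| <= expR B * n ^+ 3.
  rewrite normrM; apply: le_trans (ler_wpM2l _ h9) _ => //; rewrite mulr1.
  by apply: le_trans h1 _; rewrite ler_wpM2l // ltW.
have a2 : `|x * (1 - cos y)| <= n ^+ 3.
  rewrite normrM (ger0_norm h7) [n ^+ 3]exprS ler_pM //; lra.
have n2 : `|2^-1 : R| = 2^-1 by rewrite ger0_norm.
have a3 : `|((expR x - 1 - x) + (expR (- x) - 1 - - x)) / 2 * sin y| <= expR B * n ^+ 3.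
  rewrite normrM exprSr mulrA ler_pM //; last lra.
  rewrite normrM n2.
  have := ler_normD (expR x - 1 - x) (expR (- x) - 1 - - x).
  have : expR B * `|x| ^+ 2 <= expR B * n ^+ 2 by rewrite ler_wpM2l // ltW.
  lra.
have a4 : `|sin y - y| <= n ^+ 3 by have := exprn_ge0 3 (normr_ge0 y); lra.
have n2' : `|2 : R| = 2 by rewrite ger0_norm.
rewrite 2!normrM n2'.
have b1 := ler_normB (((expR x - expR (- x)) / 2 - x) * cos y) (x * (1 - cos y)).
have b2 := ler_normD (((expR x - 1 - x) + (expR (- x) - 1 - - x)) / 2 * sin y) (sin y - y).
have n3 : n ^+ 3 <= expR B * n ^+ 3 by rewrite ler_peMl // exprn_ge0.
have b3 : 0 <= expR B * n ^+ 3 * B ^+ 2 by rewrite mulr_ge0 ?sqr_ge0 // mulr_ge0 ?exprn_ge0 // ltW.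
have n30 : 0 <= n ^+ 3 by rewrite exprn_ge0.
have := mulr_ge0 n30 (ltW E0); lra.
Qed.

End ComplexExp.

(** * Summable weights, and linear lower bounds for distances to discrete sets *)

Section Bounds.
Variable R : realType.
Local Notation C := R[i].

Lemma bsum_nat (g : nat -> R) (M : R) : (forall n, 0 <= g n) ->
  (forall N, \sum_(k < N) g k <= M) -> bsum g M.
Proof.
move=> g0 gM; split=> // B uB; pose N := (\sum_(b <- B) b.+1)%N.
apply: le_trans (gM N); rewrite -(big_mkord xpredT g) /index_iota subn0.
rewrite [leRHS](bigID (mem B)) /= -[leLHS]addr0 lerD ?sumr_ge0 //.
rewrite -[leRHS]big_filter le_eqVlt; apply/orP; left; apply/eqP.
apply: perm_big; apply: uniq_perm => //; first by rewrite filter_uniq ?iota_uniq.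
move=> x; rewrite mem_filter /=; case xB: (x \in B); rewrite //= mem_iota /= add0n.
by rewrite /N (big_rem x) //= leq_addr.
Qed.

Lemma bsum_int (g : nat -> R) (M : R) : bsum g M ->
  bsum (fun k : int => g `|k|%N) (M + M).
Proof.
move=> [g0 gM]; split=> [k|B uB]; first exact: g0.
pose P := pmap (fun k : int => if k is Posz n then Some n else None) B.
pose N := pmap (fun k : int => if k is Negz n then Some n else None) B.
have -> : \sum_(k <- B) g `|k|%N = \sum_(n <- P) g n + \sum_(n <- map S N) g n.
  rewrite big_map {}/P {}/N; elim: B {uB} => [|[n|n] B IH].
  - by rewrite !big_nil addr0.
  - by rewrite /= !big_cons /= IH addrA.
  - by rewrite /= !big_cons /= IH addrCA.
have uu (h : int -> option nat) (k : nat -> int) : ocancel h k -> uniq (pmap h B).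
  by move=> hk; apply: (pmap_uniq hk).
rewrite lerD ?gM //; last rewrite map_inj_uniq; last by move=> ? ? [].
  by apply: (uu _ Posz); case.
by apply: (uu _ Negz); case.
Qed.

(* Exponent 3/2, so that the product of two such weights is summable over the
   lattice and dominates (1 + |m| + |n|)^-3. *)
Definition wt (n : nat) : R := (n.+1%:R * Num.sqrt n.+1%:R)^-1.

Lemma wt_gt0 n : 0 < wt n.
Proof. by rewrite invr_gt0 mulr_gt0 // sqrtr_gt0. Qed.

Lemma bsum_wt : bsum wt 3.
Proof.
apply: bsum_nat => [n|N]; first exact/ltW/wt_gt0.
(* Telescoping: for consecutive square roots a and b, with b^2 = a^2 + 1, one has b^-3 <= 2/a -
   2/b. *)
suff h n : \sum_(k < n.+1) wt k <= 3 - 2 / Num.sqrt n.+1%:R.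
  case: N => [|n]; first by rewrite big_ord0.
  apply: le_trans (h n) _; rewrite gerBl divr_ge0 // sqrtr_ge0.
elim: n => [|n IH].
  by rewrite big_ord_recr big_ord0 /= /wt sqrtr1 add0r mul1r !invr1; lra.
rewrite big_ord_recr /=; apply: le_trans (lerD IH (lexx _)) _; rewrite /wt.
set a := Num.sqrt n.+1%:R; set b := Num.sqrt n.+2%:R.
have a0 : 0 < a by rewrite sqrtr_gt0.
have b0 : 0 < b by rewrite sqrtr_gt0.
have a2 : a ^+ 2 = n.+1%:R by rewrite sqr_sqrtr.
have b2 : b ^+ 2 = n.+2%:R by rewrite sqr_sqrtr.
have E : b ^+ 2 = a ^+ 2 + 1 by rewrite a2 b2 -natr1.
have ab : a < b by rewrite -(ltr_pXn2r (n := 2)) ?nnegrE ?ltW // E ltrDl.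
rewrite -b2.
suff : (b ^+ 2 * b)^-1 <= 2 / a - 2 / b by lra.
have -> : 2 / a - 2 / b = 2 * (b - a) / (a * b) by field; rewrite ?gt_eqF.
rewrite -[X in X <= _]mul1r ler_pdivrMr ?mulr_gt0 ?exprn_gt0 //.
rewrite mulrAC ler_pdivlMr ?mulr_gt0 // mul1r.
have h1 : 1 = (b - a) * (b + a) by rewrite -subr_sqr; lra.
have h2 : a * b <= (b - a) * (b + a) * (b ^+ 2).
  by rewrite -h1 mul1r expr2 ler_wpM2r // ltW.
have b3 : 0 < b ^+ 2 by rewrite exprn_gt0.
have h3 : (b + a) * b ^+ 2 <= 2 * b * b ^+ 2 by rewrite ler_wpM2r ?ltW //; lra.
have h4 : 0 <= b - a by lra.
have := ler_wpM2l h4 h3; lra.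
Qed.

Lemma wt_sqr n : ((n.+1%:R : R) ^+ 2)^-1 <= wt n.
Proof.
rewrite /wt lef_pV2 ?posrE ?exprn_gt0 ?mulr_gt0 ?sqrtr_gt0 //.
rewrite expr2 ler_wpM2l // -[leRHS]sqr_sqrtr // expr2 ler_peMl ?sqrtr_ge0 //.
by rewrite -[leLHS]sqrtr1 ler_sqrt ?ler1n.
Qed.

(** Everything follows from (m + 1)(n + 1) <= (m + n + 1)^2, used once as it stands and once under
    the square root. *)
Lemma wt_cube m n : (((m + n).+1%:R : R) ^+ 3)^-1 <= wt m * wt n.
Proof.
rewrite /wt -invfM lef_pV2 ?posrE ?exprn_gt0 ?mulr_gt0 ?sqrtr_gt0 //.
rewrite mulrACA -sqrtrM //.
have h : (m.+1%:R * n.+1%:R : R) <= (m + n).+1%:R ^+ 2.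
  by rewrite -natrM -natrX ler_nat; nia.
rewrite exprSr ler_pM ?sqrtr_ge0 //.
by rewrite -(ler_pXn2r (n := 2)) ?nnegrE ?sqrtr_ge0 // sqr_sqrtr.
Qed.

Lemma finite_pos_lower (T : eqType) (s : seq T) (f : T -> R) :
  (forall x, x \in s -> 0 < f x) ->
  exists2 c : R, 0 < c & forall x, x \in s -> c <= f x.
Proof.
elim: s => [|y s IH] h; first by exists 1.
have [|c c0 hc] := IH; first by move=> x xs; apply: h; rewrite inE xs orbT.
exists (Num.min c (f y)); first by rewrite lt_min c0 h // mem_head.
by move=> x; rewrite inE ge_min => /predU1P[->|/hc ->]; rewrite ?lexx ?orbT.
Qed.

(** Where [h] is large, |f - u| >= |f| - |u| is comparable with [h]; the finitely many remaining
    indices have a positive minimal distance to [u]. It serves both the integers and the lattice. *)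
Lemma affine_lower (I : eqType) (f : I -> C) (h : I -> R) (K : R) (u : C) :
  0 < K -> (forall i, 0 <= h i <= K * normc (f i)) ->
  (forall B : R, exists s : seq I, forall i, h i <= B -> i \in s) ->
  (forall i, f i != u) ->
  exists2 c : R, 0 < c & forall i, c * (1 + h i) <= normc (f i - u).
Proof.
move=> K0 hK fin fu; pose B := 2 * K * (normc u + 1).
have u0 := normc_ge0 u; have B0 : 0 < B by rewrite !mulr_gt0 // ltr_wpDl.
have [s hs] := fin B.
have [|c0 c0p hc0] := @finite_pos_lower _ s (fun i => normc (f i - u)).
  by move=> i _; rewrite normc_gt0 subr_eq0.
pose c := Num.min (c0 / (1 + B)) (Num.min 1 (1 / (2 * K))).
exists c; first by rewrite !lt_min !divr_gt0 ?ltr01 ?mulr_gt0 ?addr_gt0.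
move=> i; have /andP[h0 h1] := hK i.
case: (leP (h i) B) => hB.
  apply: le_trans (hc0 _ (hs _ hB)).
  apply: le_trans (_ : c0 / (1 + B) * (1 + B) <= _).
    apply: ler_pM; rewrite ?addr_ge0 ?lerD2l //; last by rewrite ge_min lexx.
    by rewrite !le_min !divr_ge0 ?mulr_ge0 ?addr_ge0 ?ltW.
  by rewrite divfK // gt_eqF // addr_gt0.
apply: le_trans (lenB _ _).
have h2 : h i / K <= normc (f i) by rewrite ler_pdivrMr // mulrC.
have h3 : normc u + 1 <= h i / (2 * K) by rewrite ler_pdivlMr ?mulr_gt0 // mulrC ltW.
have h4 : h i / K = 2 * (h i / (2 * K)) by field; rewrite gt_eqF.
apply: le_trans (_ : 1 + h i / (2 * K) <= _); last by lra.
rewrite mulrDr mulr1 lerD //; first by rewrite !ge_min lexx !orbT.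
by rewrite mulrC ler_wpM2l // -[leRHS]mul1r !ge_min lexx !orbT.
Qed.

Definition int_box (N : nat) : seq int := [seq k%:Z - N%:Z | k <- iota 0 (N + N).+1].

Lemma mem_int_box N (n : int) : (absz n <= N)%N -> n \in int_box N.
Proof.
by move=> h; apply/mapP; exists (absz (n + N%:Z)); rewrite ?mem_iota; lia.
Qed.

Lemma int_lower (w : C) : (forall n : int, w != n%:~R) ->
  exists2 c : R, 0 < c & forall n : int, c * (absz n).+1%:R <= normc (w - n%:~R).
Proof.
move=> hw.
have [|||n|c c0 hc] := @affine_lower int (fun n => n%:~R) (fun n => (absz n)%:R) 1 w.
- by [].
- by move=> n; rewrite ler0n mul1r normc_int natr_absz intr_norm lexx.
- move=> B; exists (int_box (Num.truncn `|B|)) => n hn; apply: mem_int_box.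
  rewrite -ltnS -(ltr_nat R); apply: le_lt_trans (truncnS_gt _).
  exact: le_trans hn (ler_norm _).
- by rewrite eq_sym.
by exists c => // n; rewrite normcBC -natr1 addrC.
Qed.

End Bounds.

(** * Cotangent sums over rows of the lattice *)

Section Cotangent.
Variable R : realType.
Local Notation C := R[i].
Local Notation pic := ((pi : R)%:C).
Implicit Types (z w : C).

Definition qe z : C := cexp (2 * pic * 'i%C * z).

Lemma qeD z w : qe (z + w) = qe z * qe w.
Proof. by rewrite /qe mulrDr cexpD. Qed.
Lemma qe_neq0 z : qe z != 0. Proof. exact: cexp_neq0. Qed.
Lemma qeN z : qe (- z) = (qe z)^-1. Proof. by rewrite /qe mulrN cexpN. Qed.
Lemma qeX z n : qe (n%:R * z) = qe z ^+ n.
Proof. by rewrite /qe mulrCA cexpX. Qed.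

Lemma qe_arg z : 2 * pic * 'i%C * z = (- (2 * pi * Im z)) +i* (2 * pi * Re z).
Proof. by apply: eqReIm; rewrite !cE /= ?cE /=; ring. Qed.

Lemma normc_qe z : normc (qe z) = expR (- (2 * pi * Im z)).
Proof. by rewrite /qe normc_cexp qe_arg. Qed.

Lemma qe_half : qe 2^-1 = -1.
Proof.
have E : (2^-1 : C) = (2^-1)%:C.
  by rewrite (fmorphV (real_complex R)) (rmorph_nat (real_complex R)).
rewrite E /qe qe_arg /cexp /=.
rewrite mulr0 oppr0 expR0 (_ : 2 * pi * 2^-1 = pi) ?cospi ?sinpi; last by field.
by apply: eqReIm; rewrite !cE /=; ring.
Qed.

Lemma qe1 : qe 1 = 1.
Proof.
have E : (1 : C) = 2^-1 + 2^-1 by field.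
by rewrite [X in qe X]E qeD qe_half mulrNN mulr1.
Qed.

Lemma qe_int (n : int) : qe n%:~R = 1.
Proof.
have h (k : nat) : qe k%:R = 1 by rewrite -[k%:R]mulr1 qeX qe1 expr1n.
case: n => n; first exact: h.
by rewrite NegzE rmorphN /= qeN -pmulrn h invr1.
Qed.

Lemma qeDint z (n : int) : qe (z + n%:~R) = qe z.
Proof. by rewrite qeD qe_int mulr1. Qed.
Lemma qeBint z (n : int) : qe (z - n%:~R) = qe z.
Proof. by rewrite -(qeDint _ n) subrK. Qed.

Lemma qe_NJ z : qe (- conjc z) = conjc (qe z).
Proof.
rewrite /qe -cexpJ; congr cexp; rewrite !qe_arg; case: z => x y. by apply: eqReIm => /=; ring.
Qed.

(** The modulus forces the imaginary part to vanish. For the fractional part r of the real part,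
    cos(2 pi r) = 1 gives sin(pi r) = 0, hence r = 0 as 0 <= r < 1. *)
Lemma qe_eq1 z : qe z = 1 -> exists n : int, z = n%:~R.
Proof.
move=> h; have h0 : expR (- (2 * pi * Im z)) = expR 0 by rewrite -normc_qe h normc1 expR0.
have /eqP := expR_inj h0; rewrite oppr_eq0 mulf_eq0 gt_eqF ?mulr_gt0 ?pi_gt0 //= => /eqP z0.
exists (Num.floor (Re z)); apply/eqP; rewrite -subr_eq0; apply/eqP.
set n := Num.floor _; pose r : R := Re z - n%:~R.
have r01 : 0 <= r < 1.
  have := Num.Theory.floor_le (Re z); have := Num.Theory.floorD1_gt (Re z).
  by rewrite intrD1 /r /n; lra.
have E : z - n%:~R = r%:C by apply: eqReIm; rewrite !cE ?Reint ?Imint /r //= z0 subrr.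
have := qeBint z n; rewrite h E /qe qe_arg /= mulr0 oppr0 /cexp /= expR0 mul1r.
move=> /(congr1 (@complex.Re R)) /=.
have -> : 2 * pi * r = (pi * r) *+ 2 by rewrite -mulr_natr; ring.
rewrite cos_mulr2n cos2sin2 => h2.
have /eqP : sin (pi * r) ^+ 2 = 0 by move: h2; rewrite -mulr_natr; lra.
rewrite sqrf_eq0; case/andP: r01 => r0 r1.
move: r0; rewrite le_eqVlt => /predU1P[<- _|r0]; first by [].
rewrite gt_eqF // sin_gt0_pi // mulr_gt0 ?pi_gt0 //=.
by rewrite -[ltRHS]mulr1 ltr_pM2l ?pi_gt0.
Qed.

Definition nint z := forall n : int, z != n%:~R.

Lemma nint_qe z : nint z -> qe z - 1 != 0.
Proof.
by move=> h; rewrite subr_eq0; apply/eqP => /qe_eq1[n zn]; have := h n; rewrite zn eqxx.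
Qed.

(** This is 2 i sin(pi z). *)
Definition hs z : C := cexp (pic * 'i%C * z) - cexp (- (pic * 'i%C * z)).

Lemma qe_hs z : qe z - 1 = cexp (pic * 'i%C * z) * hs z.
Proof.
rewrite /hs mulrBr -!cexpD subrr cexp0 /qe; congr (cexp _ - _); ring.
Qed.

Lemma nint_hs z : nint z -> hs z != 0.
Proof. by move=> /nint_qe; rewrite qe_hs mulf_eq0 negb_or => /andP[]. Qed.

(** One has 2 pi i [cotL z] = pi cot(pi z) - pi i; the additive constant cancels in the differences
    that occur below. *)
Definition cotL z : C := (qe z - 1)^-1.

Lemma cotL_diff z w : nint z -> nint w -> cotL z - cotL w = hs (w - z) / (hs z * hs w).
Proof.
move=> hz hw; have z0 := nint_hs hz; have w0 := nint_hs hw.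
have h1 := cexp_neq0 (pic * 'i%C * z); have h2 := cexp_neq0 (pic * 'i%C * w).
rewrite /cotL !qe_hs.
have -> : hs (w - z) = cexp (pic * 'i%C * w) / cexp (pic * 'i%C * z)
    - cexp (pic * 'i%C * z) / cexp (pic * 'i%C * w).
  by rewrite /hs mulrBr opprB !cexpD !cexpN.
have E : cexp (pic * 'i%C * w) * hs w - cexp (pic * 'i%C * z) * hs z =
    cexp (pic * 'i%C * w) ^+ 2 - cexp (pic * 'i%C * z) ^+ 2.
  by rewrite /hs !cexpN; field; rewrite h1 h2.
transitivity ((cexp (pic * 'i%C * w) * hs w - cexp (pic * 'i%C * z) * hs z) /
  (cexp (pic * 'i%C * w) * hs w * (cexp (pic * 'i%C * z) * hs z))).
  by field; rewrite z0 w0 h1 h2.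
by rewrite E; field; rewrite z0 w0 h1 h2.
Qed.

(** Up to 1/pi the Taylor bound applies, and on [1/pi, 3/4] the sine has a positive minimum. The
    value 3/4 leaves room beyond 1/2 for the rescaled windows, whose real parts exceed 1/2 by a
    small amount. *)
Lemma sin_lower : exists2 c : R, 0 < c &
  forall x : R, `|x| <= 3 / 4 -> c * `|x| <= `|sin (pi * x)|.
Proof.
have p0 := pi_gt0 R.
have cs : {within `[(pi^-1 : R), 3 / 4], continuous (fun x : R => sin (pi * x))}.
  apply: continuous_subspaceT => x.
  apply: (@continuous_comp _ _ _ (fun x : R => pi * x) (@sin R)).
    by apply: mulrl_continuous.
  exact: continuous_sin.
have p2 := pi_ge2 R.
have pp : (pi : R)^-1 <= 3 / 4.
  rewrite -[leRHS]mul1r -[leLHS]mul1r mul1r mul1r; apply: le_trans (_ : 2^-1 <= _); last lra.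
  by rewrite lef_pV2 ?posrE.
have [c cI hc] := EVT_min pp cs; rewrite in_itv /= in cI; case/andP: cI => c1 c2.
have c0 : 0 < c by apply: lt_le_trans c1; rewrite invr_gt0.
have sc : 0 < sin (pi * c).
  apply: sin_gt0_pi; rewrite mulr_gt0 //= -[ltRHS]mulr1 ltr_pM2l //; lra.
pose k := Num.min 1 (sin (pi * c)).
have k1 : k <= 1 by rewrite ge_min lexx.
have k2 : k <= sin (pi * c) by rewrite ge_min lexx orbT.
have k0 : 0 < k by rewrite lt_min ltr01 sc.
exists k => // x hx; wlog x0 : x hx / 0 <= x.
  move=> W; case: (leP 0 x) => [|/ltW x0]; first exact: W.
  by have := W (- x); rewrite !normrN mulrN sinN normrN; apply; rewrite // oppr_ge0.
rewrite ger0_norm // in hx *.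
case: (leP (pi^-1) x) => hx1.
  have h := hc x; rewrite in_itv /= hx1 hx in h.
  apply: le_trans (le_trans (h isT) (ler_norm _)); apply: le_trans k2.
  by rewrite ler_piMr ?ltW //; lra.
have y1 : pi * x <= 1 by rewrite -(divff (lt0r_neq0 p0)) ler_pM2l // ltW.
have y0 : 0 <= pi * x by rewrite mulr_ge0 // ltW.
have := sin_subx (pi * x); rewrite (ger0_norm y0) => hs.
have h3 : (pi * x) ^+ 3 <= pi * x.
  by rewrite exprSr ler_piMl // exprn_ile1.
have h4 : (pi * x) / 2 <= sin (pi * x) by move: hs; rewrite ler_norml; lra.
apply: le_trans (ler_norm _); apply: le_trans h4.
apply: le_trans (_ : x <= _); first by rewrite ler_piMl.
by rewrite mulrAC ler_peMl //; lra.
Qed.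

Lemma hs_arg z : hs z = ((expR (- (pi * Im z)) - expR (pi * Im z)) * cos (pi * Re z)) +i*
   ((expR (- (pi * Im z)) + expR (pi * Im z)) * sin (pi * Re z)).
Proof.
have E : pic * 'i%C * z = (- (pi * Im z)) +i* (pi * Re z).
  by apply: eqReIm; rewrite !cE /= ?cE /=; ring.
by rewrite /hs E /cexp /= cosN sinN opprK; apply: eqReIm; rewrite !cE /=; ring.
Qed.

(** The imaginary part of [hs z] controls Re z through the sine; the difference of the moduli of the
    two exponentials controls Im z. *)
Lemma hs_lower : exists2 c : R, 0 < c &
  forall z, `|Re z| <= 3 / 4 -> c * normc z <= normc (hs z).
Proof.
have [c c0 hc] := sin_lower; have p2 := pi_ge2 R.
exists (Num.min c 1 / 2); first by rewrite divr_gt0 // lt_min c0 /=.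
move=> z hz; have h1 := normc_le_ReIm z.
have h2 : c * `|Re z| <= normc (hs z).
  apply: le_trans (hc _ hz) _; apply: le_trans (Im_le_normc _); rewrite hs_arg /=.
  rewrite normrM ler_peMl //.
  have a := expR_ge1Dx (- (pi * Im z)); have b := expR_ge1Dx (pi * Im z).
  rewrite ger0_norm; lra.
have h3 : `|Im z| <= normc (hs z).
  apply: le_trans (_ : `|expR (- (pi * Im z)) - expR (pi * Im z)| <= _); last first.
    rewrite /hs; set a := cexp _; set b := cexp _.
    have -> : expR (- (pi * Im z)) = normc a.
      by rewrite /a normc_cexp !cE /=; congr expR; ring.
    have -> : expR (pi * Im z) = normc b.
      by rewrite /b normc_cexp !cE /=; congr expR; ring.
    by rewrite ler_norml lenB andbT lerNl opprB normcBC lenB.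
  wlog y0 : z {hz h1 h2} / 0 <= Im z.
    move=> W; case: (leP 0 (Im z)) => [|/ltW y0]; first exact: W.
    have := W (- z); rewrite cImN mulrN opprK normrN distrC; apply.
    by rewrite oppr_ge0.
  have a := expR_ge1Dx (pi * Im z); have b0 : 0 <= pi * Im z by rewrite mulr_ge0 // pi_ge0.
  have b : expR (- (pi * Im z)) <= 1 by rewrite expR_le1 oppr_le0.
  rewrite distrC (ger0_norm y0) ger0_norm; last lra.
  have : 2 * Im z <= pi * Im z by rewrite ler_wpM2r.
  lra.
have m1 : Num.min c 1 * `|Re z| <= c * `|Re z| by rewrite ler_wpM2r // ge_min lexx.
have m2 : Num.min c 1 * `|Im z| <= 1 * `|Im z| by rewrite ler_wpM2r // ge_min lexx orbT.
have m3 : Num.min c 1 * normc z <= Num.min c 1 * (`|Re z| + `|Im z|).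
  by rewrite ler_wpM2l // le_min ltW //=.
lra.
Qed.

Lemma normc_pii : normc (pic * 'i%C) = pi :> R.
Proof. by rewrite normcM normc_real normc_i mulr1 ger0_norm ?pi_ge0. Qed.

Lemma hs_cubic (B : R) : 0 <= B -> exists2 K : R, 0 < K & forall z, normc z <= B ->
  normc (hs z - 2 * pic * 'i%C * z) <= K * normc z ^+ 3.
Proof.
move=> B0; have p0 := pi_gt0 R.
have [|K K0 hK] := @cexp_odd_bound R (pi * B); first by rewrite mulr_ge0 // ltW.
exists (K * pi ^+ 3); first by rewrite mulr_gt0 ?exprn_gt0.
move=> z hz; have := hK (pic * 'i%C * z); rewrite normcM normc_pii => h.
have -> : 2 * pic * 'i%C * z = 2 * (pic * 'i%C * z) by ring.
have -> : K * pi ^+ 3 * normc z ^+ 3 = K * (pi * normc z) ^+ 3 by ring.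
by apply: h; rewrite ler_pM2l.
Qed.

(** This is pi / sin(pi z), normalised to have principal part 1/z at 0. *)
Definition csc z : C := 2 * pic * 'i%C / hs z.

Lemma csc_bounds : exists2 K : R, 0 < K & forall z, z != 0 -> `|Re z| <= 3 / 4 ->
  `|Im z| <= 1 -> normc (csc z - z^-1) <= K * normc z /\ normc (csc z) <= K / normc z.
Proof.
have [c c0 hc] := hs_lower; have [//|K K0 hK] := @hs_cubic 2.
have p0 := pi_gt0 R.
exists (K / c + 2 * pi / c); first by rewrite addr_gt0 // divr_gt0 // mulr_gt0.
move=> z z0 hx hy; have n0 : 0 < normc z by rewrite normc_gt0.
have nz : normc z <= 2 by have := normc_le_ReIm z; lra.
have hl := hc _ hx; have hu := hK _ nz.
have h0 : 0 < normc (hs z) by apply: lt_le_trans hl; rewrite mulr_gt0.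
have hz0 : hs z != 0 by rewrite -normc_gt0.
have iV : (normc (hs z))^-1 <= (c * normc z)^-1 by rewrite lef_pV2 ?posrE // mulr_gt0.
split.
  have -> : csc z - z^-1 = - (hs z - 2 * pic * 'i%C * z) / z / hs z.
    by rewrite /csc; field; rewrite z0 hz0.
  rewrite !normcM !normcV normcN.
  apply: le_trans (_ : K * normc z ^+ 3 / normc z / (c * normc z) <= _).
    by rewrite ler_pM ?divr_ge0 ?invr_ge0 ?normc_ge0 // ler_wpM2r // invr_ge0 normc_ge0.
  have -> : K * normc z ^+ 3 / normc z / (c * normc z) = K / c * normc z.
    by field; rewrite !gt_eqF.
  rewrite ler_wpM2r ?normc_ge0 // lerDl divr_ge0 ?mulr_ge0 ?pi_ge0 // ltW //.
rewrite /csc normcM normcV -mulrA normcM normc_nat normc_pii.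
apply: le_trans (_ : 2 * pi / (c * normc z) <= _).
  by rewrite ler_wpM2l // mulr_ge0 // ltW.
by rewrite invfM mulrA ler_wpM2r ?invr_ge0 ?normc_ge0 // lerDr divr_ge0 // ltW.
Qed.

End Cotangent.

(** * Partial fraction expansions by iterated duplication *)

Section RowSums.
Variable R : realType.
Local Notation C := R[i].
Local Notation pic := ((pi : R)%:C).
Implicit Types (z w : C).

Lemma nint_shift z (n : int) : nint z -> nint (z - n%:~R).
Proof.
by move=> h k; rewrite subr_eq -intrD; exact: h.
Qed.

Lemma nint_half z (k : int) : nint z -> nint ((z - k%:~R) / 2).
Proof.
move=> h n; apply/eqP => /(congr1 (fun x => x * 2)); rewrite divfK ?pnatr_eq0 //.
move=> /eqP; rewrite subr_eq; have -> : n%:~R * 2 + k%:~R = (n * 2 + k)%:~R :> C.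
  by rewrite intrD intrM.
by apply/negP; exact: h.
Qed.

Lemma nint_neq0 z : nint z -> z != 0. Proof. by move=> /(_ 0). Qed.

(* 1 / (x^2 - 1) = (1 / (x - 1) + 1 / (- x - 1)) / 2 with x = qe (z / 2). *)
Lemma cotL_half z : nint z -> cotL z = (cotL (z / 2) + cotL ((z - 1) / 2)) / 2.
Proof.
move=> hz; have h1 := nint_qe (nint_half 1 hz); have h0 := nint_qe (nint_half 0 hz).
rewrite subr0 in h0.
have E1 : qe ((z - 1) / 2) = - qe (z / 2).
  have -> : (z - 1) / 2 = z / 2 + 2^-1 - 1%:~R by field.
  by rewrite qeBint qeD qe_half mulrN1.
have E2 : qe z = qe (z / 2) ^+ 2 by rewrite -qeX; congr qe; field.
have h2 := nint_qe hz; rewrite /cotL E2 E1 in h1 h2 *.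
by field; rewrite h0 h2 h1.
Qed.

Lemma hs_qe z : hs z ^+ 2 = (qe z - 1) ^+ 2 / qe z.
Proof.
have h := cexp_neq0 (pic * 'i%C * z).
have -> : qe z = cexp (pic * 'i%C * z) ^+ 2 by rewrite -cexpX /qe; congr cexp; ring.
by rewrite /hs cexpN; field; rewrite h.
Qed.

Lemma csc2E z : csc z ^+ 2 = (2 * pic * 'i%C) ^+ 2 * (qe z / (qe z - 1) ^+ 2).
Proof.
rewrite /csc exprMn; congr (_ * _).
by rewrite -invf_div -hs_qe -exprVn.
Qed.

(** The identity 1 / sin^2 = (1 / sin^2 + 1 / cos^2) / 4 with the right side at half the argument;
    the shift by 1/2 turns the sine into a cosine up to sign. *)
Lemma csc2_half z : nint z ->
  csc z ^+ 2 = (csc (z / 2) ^+ 2 + csc ((z - 1) / 2) ^+ 2) / 4.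
Proof.
move=> hz; have h1 := nint_qe (nint_half 1 hz); have h0 := nint_qe (nint_half 0 hz).
rewrite subr0 in h0.
have E1 : qe ((z - 1) / 2) = - qe (z / 2).
  have -> : (z - 1) / 2 = z / 2 + 2^-1 - 1%:~R by field.
  by rewrite qeBint qeD qe_half mulrN1.
have E2 : qe z = qe (z / 2) ^+ 2 by rewrite -qeX; congr qe; field.
have h2 := nint_qe hz; have h3 := qe_neq0 (z / 2).
rewrite E2 in h2; rewrite E1 in h1.
rewrite (csc2E z) (csc2E (z / 2)) (csc2E ((z - 1) / 2)) E2 E1.
move: (qe (z / 2)) (2 * pic * 'i%C) h0 h1 h2 h3 => x c h0 h1 h2 h3.
by field; rewrite h0 h2 h1.
Qed.


Lemma nint_div2X z (k : nat) j : nint z -> nint ((z - k%:R) / 2 ^+ j).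
Proof.
move=> hz; elim: j => [|j IH]; first by rewrite expr0 divr1; exact: (nint_shift k).
by have := nint_half 0 IH; rewrite subr0 exprSr invfM mulrA.
Qed.

Lemma half_iter (f : C -> C) (c : C) :
  (forall z, nint z -> f z = (f (z / 2) + f ((z - 1) / 2)) * c) ->
  forall j z, nint z -> f z = (\sum_(k < 2 ^ j) f ((z - k%:R) / 2 ^+ j)) * c ^+ j.
Proof.
move=> hf; elim=> [|j IH] z hz.
  by rewrite expn0 big_ord_recr big_ord0 /= add0r !expr0 mulr1 subr0 divr1.
rewrite IH // [c ^+ j.+1]exprS mulrA; congr (_ * _).
rewrite expnS mul2n -addnn big_split_ord /= -big_split /= big_distrl /=.
apply: eq_bigr => k _; rewrite hf; last exact: nint_div2X.
have h2 : (2 : C) ^+ j != 0 by rewrite expf_neq0 // pnatr_eq0.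
rewrite exprS; congr ((f _ + f _) * c); first by field; rewrite h2.
by rewrite natrD natrX; field; rewrite h2.
Qed.

(** Periodicity recentres the window of residues at 0, so that the rescaled arguments stay where
    [csc] is close to 1/z. *)
Lemma half_iter_sym (f : C -> C) (c : C) :
  (forall z (n : int), f (z + n%:~R) = f z) ->
  (forall z, nint z -> f z = (f (z / 2) + f ((z - 1) / 2)) * c) ->
  forall j z, nint z -> let N := (2 ^ j)%N in
  f z = (\sum_(k < N + N) f ((z - (k%:Z - N%:Z)%:~R) / (N + N)%:R)) * c ^+ j.+1.
Proof.
move=> fp hf j z hz N; rewrite -(fp z N).
have hz' : nint (z + N%:Z%:~R).
  by move=> n; have := nint_shift (- N%:Z) hz n; rewrite rmorphN opprK.
rewrite (half_iter hf j.+1 hz').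
have E : (2 ^ j.+1 = N + N)%N by rewrite expnS mul2n addnn.
rewrite E; congr (_ * _); apply: eq_bigr => k _; congr f.
rewrite -natrX E; congr (_ / _); rewrite rmorphB /= -!pmulrn; ring.
Qed.

(** One family serves both expansions: z = w gives the squares, and (w - z) times a term is 1/(z -
    n) - 1/(w - n). *)
Definition row_term z w (n : int) : C := ((z - n%:~R) * (w - n%:~R))^-1.

Lemma row_term_bound z w : nint z -> nint w -> exists2 K : R, 0 < K &
  forall n : int, normc (row_term z w n) <= K * wt R `|n|%N.
Proof.
move=> hz hw; have [c c0 hc] := int_lower hz; have [d d0 hd] := int_lower hw.
exists (c * d)^-1; first by rewrite invr_gt0 mulr_gt0.
move=> n; rewrite /row_term normcV normcM.
apply: le_trans (_ : (c * d)^-1 * ((absz n).+1%:R ^+ 2)^-1 <= _); last first.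
  by apply: ler_wpM2l; [rewrite invr_ge0 mulr_ge0 // ltW|exact: wt_sqr].
have n0 : 0 < (absz n).+1%:R :> R by [].
rewrite -invfM lef_pV2 ?posrE; first last.
- by rewrite !mulr_gt0 ?exprn_gt0.
- by rewrite mulr_gt0 // (lt_le_trans _ (hc n), lt_le_trans _ (hd n)) // mulr_gt0.
have -> : c * d * (absz n).+1%:R ^+ 2 = (c * (absz n).+1%:R) * (d * (absz n).+1%:R) by ring.
by rewrite ler_pM // mulr_ge0 // ltW.
Qed.

Lemma row_has_sum z w : nint z -> nint w -> exists T, has_sum (row_term z w) T.
Proof.
move=> hz hw; have [K K0 hK] := row_term_bound hz hw.
have b := bsum_scale (ltW K0) (bsum_int (@bsum_wt R)).
by have [T hT] := has_sum_ex b hK; exists T.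
Qed.

Definition csc_sum z w (N : nat) : C :=
  (\sum_(k < N + N) csc ((z - (k%:Z - N%:Z)%:~R) / (N + N)%:R) *
      csc ((w - (k%:Z - N%:Z)%:~R) / (N + N)%:R)) / (N + N)%:R ^+ 2.

(** In the error of a product of two cosecants the bound for one factor grows like |u| and that for
    the other like 1/|v|; this keeps the quotient bounded along the row. *)
Lemma ratio_bound z w : nint w -> exists2 M : R, 0 < M & forall n : int,
  normc (z - n%:~R) / normc (w - n%:~R) <= M.
Proof.
move=> hw; have [c c0 hc] := int_lower hw.
exists ((normc z + 1) / c); first by rewrite divr_gt0 // ltr_wpDl ?normc_ge0.
move=> n; have h := hc n; have n0 : 0 < (absz n).+1%:R :> R by [].
rewrite ler_pdivrMr; last by apply: lt_le_trans h; rewrite mulr_gt0.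
apply: le_trans (_ : (normc z + 1) / c * (c * (absz n).+1%:R) <= _); last first.
  by rewrite ler_wpM2l // divr_ge0 ?addr_ge0 ?normc_ge0 // ltW.
have -> : (normc z + 1) / c * (c * (absz n).+1%:R) = (normc z + 1) * (absz n).+1%:R.
  by field; rewrite gt_eqF.
apply: le_trans (normcB _ _) _; rewrite normc_int.
have E : `|n%:~R| = (absz n)%:R :> R by rewrite natr_absz intr_norm.
rewrite E -natr1; have a0 : 0 <= (absz n)%:R :> R by [].
have z0 := normc_ge0 z; have := mulr_ge0 z0 a0; lra.
Qed.

(* Each of the N + N summands changes by a bounded amount when csc u is
   replaced by 1 / u, while the prefactor is (N + N)^-2. *)
Lemma csc_sum_row z w : nint z -> nint w -> exists2 K : R, 0 < K &
  exists N0 : nat, forall N : nat, (N0 < N)%N ->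
  normc (csc_sum z w N - \sum_(k < N + N) row_term z w (k%:Z - N%:Z)) <= K / N%:R.
Proof.
move=> hz hw; have [K K0 hK] := csc_bounds R.
have [M M0 hM] := ratio_bound z hw; have [M' M'0 hM'] := ratio_bound w hz.
exists (K ^+ 2 * M + K * M'); first by rewrite addr_gt0 ?mulr_gt0 ?exprn_gt0.
have z0 := normc_ge0 z; have w0 := normc_ge0 w.
(* For such N one has |z| + |w| < N/2, which keeps the real parts of the rescaled arguments within
   (N + N/2) / (2 N) = 3/4. *)
exists (Num.truncn (2 * (normc z + normc w))) => N hN.
have N0 : 0 < N%:R :> R by rewrite ltr0n; case: N hN.
have Nb : 2 * (normc z + normc w) < N%:R.
  apply: lt_le_trans (_ : (Num.truncn (2 * (normc z + normc w))).+1%:R <= _).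
    by apply: truncnS_gt.
  by rewrite ler_nat.
rewrite /csc_sum; set E : C := (N + N)%:R; pose Er : R := (N + N)%:R.
have ErN : (N + N)%:R = Er by [].
have ErE : Er = N%:R + N%:R by rewrite /Er natrD.
have Er0 : 0 < Er by rewrite ErE; lra.
have nE : normc E = Er by rewrite normc_nat.
have E0 : E != 0 by rewrite -normc_gt0 nE.
have EV : E^-1 = (Er^-1)%:C.
  by rewrite (fmorphV (real_complex R)) (rmorph_nat (real_complex R)).
clearbody E Er.
have bnd (x : C) (k : 'I_(N + N)) : normc x <= normc z + normc w ->
    nint x -> let u := (x - (k%:Z - N%:Z)%:~R) / E in
  [/\ u != 0, `|Re u| <= 3 / 4 & `|Im u| <= 1].
  move=> hx nx u.
  have u0 : u != 0 by rewrite mulf_neq0 ?invr_eq0 // (nint_neq0 (nint_shift _ nx)).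
  have hR := Re_le_normc x; have hI := Im_le_normc x.
  have kN : `|(k%:Z - N%:Z)%:~R| <= N%:R :> R.
    rewrite rmorphB /= -!pmulrn ler_norml; have := ltn_ord k.
    rewrite -(ltr_nat R) natrD => h; have : 0 <= k%:R :> R by []; lra.
  split=> //.
    rewrite /u EV cReM /= mulr0 subr0 cReD cReN Reint normrM normfV (ger0_norm (ltW Er0)).
    rewrite ler_pdivrMr // ErE.
    by apply: le_trans (ler_normB _ _) _; lra.
  rewrite /u EV cImM /= mulr0 add0r cImD cImN Imint subr0 normrM normfV (ger0_norm (ltW Er0)).
  by rewrite ler_pdivrMr // ErE; lra.
rewrite big_distrl /= -sumrB.
apply: le_trans (normc_sum _ _ _) _.
apply: le_trans (_ : \sum_(k < N + N) (K ^+ 2 * M + K * M') / Er ^+ 2 <= _).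
  apply: ler_sum => k _; set n := (k%:Z - N%:Z).
  have zzw : normc z <= normc z + normc w by lra.
  have wzw : normc w <= normc z + normc w by lra.
  have [u0 uR uI] := bnd z k zzw hz; have [v0 vR vI] := bnd w k wzw hw.
  set u := _ / E in u0 uR uI *; set v := _ / E in v0 vR vI *.
  have [a1 a2] := hK _ u0 uR uI; have [b1 b2] := hK _ v0 vR vI.
  have -> : row_term z w n = u^-1 * v^-1 / E ^+ 2.
    rewrite /row_term /u /v -/n; have zn := nint_neq0 (nint_shift n hz).
    by have wn := nint_neq0 (nint_shift n hw); field; rewrite E0 zn wn.
  have -> : csc u * csc v / E ^+ 2 - u^-1 * v^-1 / E ^+ 2 =
    ((csc u - u^-1) * csc v + u^-1 * (csc v - v^-1)) / E ^+ 2 by ring.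
  rewrite normcM normcV normcX nE; apply: ler_wpM2r.
    by rewrite invr_ge0 exprn_ge0 // ltW.
  apply: le_trans (normcD _ _) _.
  rewrite (normcM (csc u - u^-1)) (normcM u^-1) (normcV u).
  have un : 0 < normc u by rewrite normc_gt0.
  have vn : 0 < normc v by rewrite normc_gt0.
  have r1 : normc u / normc v <= M.
    have := hM n; rewrite /u /v !normcM !normcV nE -/n.
    have wn : 0 < normc (w - n%:~R) by rewrite normc_gt0 (nint_neq0 (nint_shift n hw)).
    suff -> : normc (z - n%:~R) / Er / (normc (w - n%:~R) / Er) =
      normc (z - n%:~R) / normc (w - n%:~R) by [].
    by field; rewrite !gt_eqF.
  have r2 : normc v / normc u <= M'.
    have := hM' n; rewrite /u /v !normcM !normcV nE -/n.
    have wn : 0 < normc (z - n%:~R) by rewrite normc_gt0 (nint_neq0 (nint_shift n hz)).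
    suff -> : normc (w - n%:~R) / Er / (normc (z - n%:~R) / Er) =
      normc (w - n%:~R) / normc (z - n%:~R) by [].
    by field; rewrite !gt_eqF.
  apply: lerD.
    apply: le_trans (ler_pM (normc_ge0 _) (normc_ge0 _) a1 b2) _.
    have -> : K * normc u * (K / normc v) = K ^+ 2 * (normc u / normc v) by ring.
    by rewrite ler_wpM2l // exprn_ge0 // ltW.
  apply: le_trans (_ : (normc u)^-1 * (K * normc v) <= _).
    by rewrite ler_wpM2l // invr_ge0 ltW.
  have -> : (normc u)^-1 * (K * normc v) = K * (normc v / normc u) by ring.
  by rewrite ler_wpM2l // ltW.
rewrite sumr_const card_ord -[leLHS]mulr_natr.
have -> : (K ^+ 2 * M + K * M') / Er ^+ 2 * (N + N)%:R = (K ^+ 2 * M + K * M') / Er.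
  by rewrite ErN; field; rewrite gt_eqF.
apply: ler_wpM2l; first by rewrite addr_ge0 ?mulr_ge0 ?exprn_ge0 // ltW.
rewrite lef_pV2 ?posrE //.
by rewrite ErE; lra.
Qed.

Lemma csc_sum_lim z w T : nint z -> nint w -> has_sum (row_term z w) T ->
  forall e : R, 0 < e -> exists N0 : nat, forall N : nat, (N0 < N)%N ->
    normc (csc_sum z w N - T) < e.
Proof.
move=> hz hw hT e e0; have e2 : 0 < e / 2 by rewrite divr_gt0.
have [N1 h1] := has_sum_sym hT e2.
have [K K0 [N2 h2]] := csc_sum_row hz hw.
pose N3 := Num.truncn (2 * K / e); exists (N1 + N2 + N3)%N => N hN.
rewrite (le_lt_trans (normc_triangle (\sum_(k < N + N) row_term z w (k%:Z - N%:Z)) _ _)) //.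
rewrite (splitr e) ler_ltD ?h1 //; last by lia.
have hN2 : (N2 < N)%N by lia.
apply: le_trans (h2 _ hN2) _.
have hN3 : 2 * K / e < N%:R.
  apply: lt_le_trans (_ : N3.+1%:R <= _); first by apply: truncnS_gt.
  by rewrite ler_nat; lia.
have N0 : 0 < N%:R :> R by apply: le_lt_trans hN3; rewrite divr_ge0 ?mulr_ge0 ?ltW.
rewrite ler_pdivrMr // mulrAC ler_pdivlMr // mulrC.
by move: hN3; rewrite ltr_pdivrMr // => /ltW; rewrite [e * _]mulrC.
Qed.

Lemma pow2_gt (N0 : nat) : (N0 < 2 ^ N0)%N. Proof. exact: ltn_expl. Qed.

Lemma csc_per z (n : int) : csc (z + n%:~R) ^+ 2 = csc z ^+ 2.
Proof. by rewrite csc2E [RHS]csc2E qeDint. Qed.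

(** For N = 2^j the finite sum [csc_sum z z N] equals [csc z ^+ 2] exactly, and it converges to the
    row sum. This is the expansion of pi^2 / sin^2(pi z). *)
Lemma row_sum_sqr z : nint z -> has_sum (row_term z z) (csc z ^+ 2).
Proof.
move=> hz; have [T hT] := row_has_sum hz hz; suff -> : csc z ^+ 2 = T by [].
apply/eqP; rewrite -subr_eq0; apply/eqP/small_eqC => e e0.
have [N0 h] := csc_sum_lim hz hz hT e0; have := h _ (pow2_gt N0).
suff -> : csc z ^+ 2 = csc_sum z z (2 ^ N0) by [].
have /= -> := half_iter_sym csc_per csc2_half N0 hz.
rewrite /csc_sum; congr (_ * _); rewrite addnn -mul2n -expnS natrX exprVn -exprM mulnC exprM.
by congr ((_ ^+ _)^-1); ring.
Qed.

(** The cotangent expansion, stated for differences so that it converges unconditionally. By the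
    addition formula a difference of cotangents is a product of cosecants times the sine of the
    difference of the arguments. *)
Lemma row_sum_diff z w : nint z -> nint w ->
  has_sum (fun n : int => (z - n%:~R)^-1 - (w - n%:~R)^-1)
    (2 * pic * 'i%C * (cotL z - cotL w)).
Proof.
move=> hz hw; have [T hT] := row_has_sum hz hw.
have h := has_sumZ (w - z) hT.
suff <- : (w - z) * T = 2 * pic * 'i%C * (cotL z - cotL w).
  apply: has_sum_ext h => n; rewrite /row_term.
  have zn := nint_neq0 (nint_shift n hz); have wn := nint_neq0 (nint_shift n hw).
  by field; rewrite zn wn.
set c := 2 * pic * 'i%C; have c0 : c != 0.
  by rewrite -normc_gt0 /c -mulrA normcM normc_nat normc_pii mulr_gt0 // pi_gt0.
set d := w - z.
(* After rescaling by 2 N the sine of the difference becomes this factor, which tends to [d] because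
   [hs] has derivative 2 pi i at 0. *)
pose k N : C := hs (d / (N + N)%:R) * (N + N)%:R / c.
have key j : c * (cotL z - cotL w) = k (2 ^ j)%N * csc_sum z w (2 ^ j).
  have per (x : C) (n : int) : cotL (x + n%:~R) = cotL x by rewrite /cotL qeDint.
  have /= -> := half_iter_sym per cotL_half j hz; have /= -> := half_iter_sym per cotL_half j hw.
  set N := (2 ^ j)%N; rewrite -mulrBl -sumrB /csc_sum.
  have E0 : (N + N)%:R != 0 :> C by rewrite pnatr_eq0 addn_eq0 expn_eq0.
  have EE : (2^-1 : C) ^+ j.+1 = (N + N)%:R^-1.
    by rewrite exprVn -natrX expnS mul2n addnn.
  rewrite EE !mulr_suml !mulr_sumr; apply: eq_bigr => i _.
  have nu (x : C) : nint x -> nint ((x - (i%:Z - N%:Z)%:~R) / (N + N)%:R).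
    move=> hx; have hx' := nint_shift (- N%:Z) hx.
    have := nint_div2X i j.+1 hx'; rewrite -natrX expnS mul2n -addnn.
    by congr (nint (_ / _)); rewrite !rmorphB rmorphN /= -!pmulrn; ring.
  rewrite cotL_diff; [|exact: nu|exact: nu].
  have s1 := nint_hs (nu _ hz); have s2 := nint_hs (nu _ hw).
  rewrite /csc -/c /k -mulrBl opprB addrA subrK -/d.
  move: ((N + N)%:R : C) E0 s1 s2 => E E0 s1 s2.
  by field; rewrite E0 s1 s2 c0.
have [K K0 hK] := @hs_cubic R 1 ler01; rewrite -/c in hK.
clearbody c.
apply/eqP; rewrite -subr_eq0; apply/eqP/small_eqC => e e0.
have d0 := normc_ge0 d; have T0 := normc_ge0 T.
have [N1 h1] := csc_sum_lim hz hw hT (ltr01 : 0 < 1 :> R).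
have e3 : 0 < e / 2 / (normc d + 1) by rewrite !divr_gt0 // ltr_wpDl.
have [N2 h2] := csc_sum_lim hz hw hT e3.
pose c1 := K * normc d ^+ 3 / normc c * (normc T + 1).
have c10 : 0 <= c1.
  by rewrite /c1 !mulr_ge0 ?invr_ge0 ?normc_ge0 ?exprn_ge0 ?addr_ge0 // ltW.
pose N3 := Num.truncn (2 * (c1 / e) + normc d).
pose j := (N1 + N2 + N3)%N; rewrite (key j); set N := (2 ^ j)%N.
have jN : (j < N)%N := pow2_gt j.
have a1 := h1 N (leq_ltn_trans (leq_trans (leq_addr _ _) (leq_addr _ _)) jN).
have a2 := h2 N (leq_ltn_trans (leq_trans (leq_addl _ _) (leq_addr _ _)) jN).
have NB : 2 * (c1 / e) + normc d < N%:R.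
  apply: lt_le_trans (_ : N3.+1%:R <= _); first by apply: truncnS_gt.
  by rewrite ler_nat (leq_ltn_trans _ jN) // leq_addl.
have N0 : 1 <= N%:R :> R by rewrite ler1n expn_gt0.
set Q := csc_sum z w N in a1 a2 *; clearbody Q.
have -> : d * T - k N * Q = - ((k N - d) * Q + d * (Q - T)) by ring.
rewrite normcN; apply: le_lt_trans (normcD _ _) _; rewrite !normcM (splitr e) ltr_leD //.
  pose E : R := (N + N)%:R; have EN : N%:R <= E by rewrite ler_nat leq_addr.
  have E0 : 0 < E by lra.
  have nE : normc ((N + N)%:R : C) = E by rewrite normc_nat.
  have EC : (N + N)%:R != 0 :> C by rewrite -normc_gt0 nE.
  clearbody E.
  have dE : normc (d / (N + N)%:R) <= 1.
    by rewrite normcM normcV nE ler_pdivrMr // mul1r; have := divr_ge0 c10 (ltW e0); lra.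
  have h3 := hK _ dE.
  have kd : normc (k N - d) <= K * normc d ^+ 3 / normc c / N%:R.
    have -> : k N - d = (hs (d / (N + N)%:R) - c * (d / (N + N)%:R)) * (N + N)%:R / c.
      by rewrite /k; move: ((N + N)%:R : C) EC => E' EC'; field; rewrite c0 EC'.
    rewrite !normcM !normcV nE.
    apply: le_trans (_ : K * normc (d / (N + N)%:R) ^+ 3 * E / normc c <= _).
      by rewrite !ler_wpM2r // ?invr_ge0 ?normc_ge0 // ltW.
    rewrite normcM normcV nE; have nc0 : normc c != 0 by rewrite normc_eq0.
    have -> : K * (normc d / E) ^+ 3 * E / normc c = K * normc d ^+ 3 / normc c * (E ^+ 2)^-1.
      by field; rewrite nc0 gt_eqF.
    apply: ler_wpM2l.
      by rewrite !mulr_ge0 ?invr_ge0 ?normc_ge0 ?exprn_ge0 // ltW.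
    rewrite lef_pV2 ?posrE ?exprn_gt0 //; last by lra.
    by rewrite expr2; have := ler_wpM2l (ltW E0) (le_trans N0 EN); lra.
  have Q1 : normc Q <= normc T + 1 by have := normcD (Q - T) T; rewrite subrK; lra.
  apply: le_lt_trans (ler_pM (normc_ge0 _) (normc_ge0 _) kd Q1) _.
  have -> : K * normc d ^+ 3 / normc c / N%:R * (normc T + 1) = c1 / N%:R.
    by rewrite /c1; ring.
  rewrite ltr_pdivrMr; last by lra.
  have h4 : 2 * (c1 / e) < N%:R by lra.
  have : 2 * (c1 / e) * (e / 2) < N%:R * (e / 2) by rewrite ltr_pM2r // divr_gt0.
  have -> : 2 * (c1 / e) * (e / 2) = c1 by field; rewrite gt_eqF.
  lra.
apply: le_trans (ler_wpM2l d0 (ltW a2)) _.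
have EX : e / 2 / (normc d + 1) * (normc d + 1) = e / 2.
  by rewrite divfK // gt_eqF // ltr_wpDl.
move: e3 EX; set X := e / 2 / (normc d + 1) => e3 EX; lra.
Qed.

End RowSums.

(** * Quasi-periods of the Weierstrass zeta-function *)

Section QuasiPeriods.
Variable R : realType.
Local Notation C := R[i].
Local Notation pic := ((pi : R)%:C).
Local Notation c2pi := (2 * pic * 'i%C : C).
Implicit Types (z w u t : C).

Lemma bsum_geo (r : R) : 0 <= r < 1 -> bsum (fun n => r ^+ n) (1 - r)^-1.
Proof.
move=> /andP[r0 r1]; apply: bsum_nat => [n|N]; first exact: exprn_ge0.
have h : (\sum_(k < N) r ^+ k) * (1 - r) = 1 - r ^+ N.
  elim: N => [|N IH]; first by rewrite big_ord0 mul0r expr0 subrr.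
  by rewrite big_ord_recr /= mulrDl IH exprSr; ring.
rewrite -[leRHS]mul1r ler_pdivlMr ?subr_gt0 // h gerBl exprn_ge0 //.
Qed.

Lemma bsum_geo1 (r : R) : 0 <= r < 1 -> bsum (fun n => n.+1%:R * r ^+ n) ((1 - r) ^+ 2)^-1.
Proof.
move=> /andP[r0 r1]; apply: bsum_nat => [n|N]; first by rewrite mulr_ge0 ?exprn_ge0.
have h : (\sum_(k < N) k.+1%:R * r ^+ k) * (1 - r) ^+ 2 =
    1 - N.+1%:R * r ^+ N + N%:R * r ^+ N.+1.
  elim: N => [|N IH]; first by rewrite big_ord0 !mul0r expr0 mulr1 subrr add0r.
  by rewrite big_ord_recr /= mulrDl IH !exprSr -!natr1; ring.
rewrite -[leRHS]mul1r ler_pdivlMr ?exprn_gt0 ?subr_gt0 // h.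
have p0 : 0 <= r ^+ N by exact: exprn_ge0.
have : N%:R * r ^+ N.+1 <= N%:R * r ^+ N by rewrite ler_wpM2l // exprSr ler_piMr // ltW.
rewrite -natr1; lra.
Qed.

(** The value comes from the shift: dropping the first term multiplies the sum by x. *)
Lemma has_sum_geo (x : C) : normc x < 1 -> has_sum (fun n => x ^+ n) (1 - x)^-1.
Proof.
move=> x1; have r01 : 0 <= normc x < 1 by rewrite normc_ge0.
have [|s hs] := has_sum_ex (f := fun n => x ^+ n) (bsum_geo r01).
  by move=> n; rewrite normcX.
have h := has_sum_shift hs.
have h' : has_sum (fun n => x ^+ n.+1) (x * s).
  by apply: has_sum_ext (has_sumZ x hs) => n; rewrite exprS.
have E := has_sum_unique h h'; rewrite expr0 in E.
have nx : 1 - x != 0.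
  by apply/eqP => /eqP; rewrite subr_eq0 => /eqP xe; rewrite -xe normc1 ltxx in x1.
suff <- : s = (1 - x)^-1 by [].
apply: (mulIf nx); rewrite mulVf //.
have -> : s * (1 - x) = s - x * s by ring.
by rewrite -E subKr.
Qed.

Lemma has_sum_geo1 (x : C) : normc x < 1 ->
  has_sum (fun n => n.+1%:R * x ^+ n.+1) (x / (1 - x) ^+ 2).
Proof.
move=> x1; have r01 : 0 <= normc x < 1 by rewrite normc_ge0.
have [|s0 hs0] := has_sum_ex (f := fun n => n.+1%:R * x ^+ n) (bsum_geo1 r01).
  by move=> n; rewrite normcM normcX normc_nat.
have nx : 1 - x != 0.
  by apply/eqP => /eqP; rewrite subr_eq0 => /eqP xe; rewrite -xe normc1 ltxx in x1.
have h := has_sum_shift hs0.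
have g := has_sum_geo x1.
have h' : has_sum (fun n => n.+2%:R * x ^+ n.+1) (x * s0 + x * (1 - x)^-1).
  apply: has_sum_ext (has_sumD (has_sumZ x hs0) (has_sumZ x g)) => n.
  by rewrite exprS -[n.+2%:R]natr1; ring.
have E := has_sum_unique h h'; rewrite expr0 mulr1 in E.
suff <- : x * s0 = x / (1 - x) ^+ 2.
  by apply: has_sum_ext (has_sumZ x hs0) => n; rewrite exprS mulrCA.
have E2 : s0 * (1 - x) = 1 + x / (1 - x).
  have E' : s0 = 1 + (x * s0 + x / (1 - x)) by rewrite -E addrC subrK.
  have -> : s0 * (1 - x) = s0 - x * s0 by ring.
  by rewrite {1}E'; ring.
have -> : s0 = (1 + x / (1 - x)) / (1 - x) by rewrite -E2 mulfK.
by field.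
Qed.

(* The sum of k x^(m k) over m, k >= 1; then E2 (qe t) is the Eisenstein series
   of weight 2 at t, as a power series in q. *)
Definition Phi (x : C) : C :=
  sum (fun u : nat * nat => u.2.+1%:R * x ^+ (u.1.+1 * u.2.+1)).

Lemma Phi_has_sum (x : C) : normc x < 1 ->
  has_sum (fun u : nat * nat => u.2.+1%:R * x ^+ (u.1.+1 * u.2.+1)) (Phi x).
Proof.
move=> x1; have r01 : 0 <= normc x < 1 by rewrite normc_ge0.
have [|s hs] := has_sum_ex (f := fun u : nat * nat => u.2.+1%:R * x ^+ (u.1.+1 * u.2.+1))
  (bsum_prod (bsum_geo r01) (bsum_geo1 r01)).
  move=> [m k] /=; rewrite normcM normcX normc_nat mulrCA ler_wpM2l //.
  by rewrite -exprD ler_wiXn2l ?normc_ge0 ?ltW //; nia.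
by rewrite /Phi (has_sum_sum hs).
Qed.

(** Summing over k first gives the Lambert form of the series, whose terms at x = q are those of
    pi^2 / sin^2 at the points m t. *)
Lemma Phi_rows (x : C) : normc x < 1 ->
  has_sum (fun m : nat => x ^+ m.+1 / (1 - x ^+ m.+1) ^+ 2) (Phi x).
Proof.
move=> x1; apply: has_sum_rows (Phi_has_sum x1) _ => m /=.
have h : normc (x ^+ m.+1) < 1.
  by rewrite normcX exprn_ilt1 ?normc_ge0.
apply: has_sum_ext (has_sum_geo1 h) => k.
by rewrite exprM.
Qed.

Definition E2 (x : C) : C := 1 - 24 * Phi x.
Definition G2 t : C := pic ^+ 2 / 3 * E2 (qe t).

Definition omega t (v : int * int) : C := v.1%:~R * t + v.2%:~R.

Section Lattice.
Variable t : C.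
Hypothesis t0 : 0 < Im t.

Lemma Im_omega v : Im (omega t v) = v.1%:~R * Im t.
Proof. by rewrite /omega cImD Imint cImM Reint Imint mul0r !addr0. Qed.

Lemma omega_inj : injective (omega t).
Proof.
move=> [m n] [m' n'] E; have := congr1 (@complex.Im R) E.
rewrite !Im_omega /= => /(mulIf (lt0r_neq0 t0))/eqP; rewrite eqr_int => /eqP mm.
move: E; rewrite /omega /= mm => /addrI/(congr1 (@complex.Re R)); rewrite !Reint.
by move=> /eqP; rewrite eqr_int => /eqP ->.
Qed.

Lemma omega0 : omega t (0, 0) = 0.
Proof. by rewrite /omega /= mul0r addr0. Qed.

Definition hgt (v : int * int) : R := (absz v.1 + absz v.2)%:R.

Lemma hgt_le : exists2 K : R, 0 < K & forall v, 0 <= hgt v <= K * normc (omega t v).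
Proof.
have tn := normc_ge0 t; have iy : 0 < (Im t)^-1 by rewrite invr_gt0.
exists (1 + (1 + normc t) / Im t).
  by rewrite addr_gt0 // divr_gt0 // ltr_pwDl.
move=> [m n]; rewrite /hgt ler0n /= natrD !natr_absz !intr_norm.
have h1 : `|m%:~R| * Im t <= normc (omega t (m, n)).
  apply: le_trans (Im_le_normc _); rewrite Im_omega normrM ler_wpM2l //.
  by rewrite ger0_norm // ltW.
have h2 : `|n%:~R| <= normc (omega t (m, n)) + `|m%:~R| * normc t.
  have -> : `|n%:~R| = normc (omega t (m, n) - m%:~R * t).
    by rewrite /omega /= addrC addrA addNr add0r normc_int.
  by apply: le_trans (normcB _ _) _; rewrite normcM normc_int.
have h3 : `|m%:~R| <= normc (omega t (m, n)) / Im t by rewrite ler_pdivlMr.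
have h4 := ler_wpM2r tn h3.
have -> : (1 + (1 + normc t) / Im t) * normc (omega t (m, n)) =
  normc (omega t (m, n)) + (normc (omega t (m, n)) / Im t +
  normc (omega t (m, n)) / Im t * normc t) by ring.
lra.
Qed.

Lemma hgt_fin (B : R) : exists s : seq (int * int), forall v, hgt v <= B -> v \in s.
Proof.
exists [seq (m, n) | m <- int_box (Num.truncn `|B|), n <- int_box (Num.truncn `|B|)].
move=> [m n] h; apply/allpairsP; exists (m, n) => /=.
have hB : (absz m + absz n <= Num.truncn `|B|)%N.
  rewrite -ltnS -(ltr_nat R); apply: le_lt_trans (truncnS_gt _).
  exact: le_trans h (ler_norm _).
by split=> //; apply: mem_int_box; lia.
Qed.

Lemma lattice_lower u : (forall v, omega t v != u) ->
  exists2 c : R, 0 < c & forall v, c * (1 + hgt v) <= normc (omega t v - u).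
Proof.
move=> hu; have [K K0 hK] := hgt_le.
exact: (affine_lower K0 hK hgt_fin hu).
Qed.

Lemma omega_lower : exists2 c : R, 0 < c &
  forall v, v != (0, 0) -> c * (1 + hgt v) <= normc (omega t v).
Proof.
have [K K0 hK] := hgt_le; exists (2 * K)^-1; first by rewrite invr_gt0 mulr_gt0.
move=> v v0; have /andP[_ h] := hK v.
have h1 : 1 <= hgt v.
  rewrite ler1n; case: v v0 {h} => m n; rewrite lt0n addn_eq0 !absz_eq0 /=.
  by apply: contra => /andP[/eqP -> /eqP ->].
rewrite mulrC ler_pdivrMr ?mulr_gt0 //; lra.
Qed.

Definition zterm u (v : int * int) : C :=
  if v == (0, 0) then 0 else (u - omega t v)^-1 + (omega t v)^-1 + u / omega t v ^+ 2.

Definition offlat u := forall v, omega t v != u.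

Lemma bsum_wt2 : exists M : R, bsum (fun v : int * int => wt R (absz v.1) * wt R (absz v.2)) M.
Proof.
have b := bsum_int (@bsum_wt R).
by exists ((3 + 3) * (3 + 3)); exact: (bsum_prod b b).
Qed.

(** The three summands combine to u^2 / (omega^2 (u - omega)), which is of order |omega|^-3 and
    hence dominated by the product weights. *)
Lemma zterm_has_sum u : offlat u -> exists Z, has_sum (zterm u) Z.
Proof.
move=> hu; have [c c0 hc] := lattice_lower hu; have [d d0 hd] := omega_lower.
have [M hM] := bsum_wt2; pose K := normc u ^+ 2 / (c * d ^+ 2).
have K0 : 0 <= K by rewrite divr_ge0 ?exprn_ge0 ?normc_ge0 ?mulr_ge0 ?exprn_ge0 ?ltW.
apply: (has_sum_ex (bsum_scale K0 hM)) => v.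
rewrite /zterm; case: eqVneq => [_|v0].
  have wt0 n : 0 <= wt R n by apply: ltW; exact: wt_gt0.
  by rewrite normc0; apply: mulr_ge0 => //; exact: mulr_ge0.
have h1 : 0 < 1 + hgt v by rewrite ltr_wpDr // ler0n.
have w0 : omega t v != 0.
  by rewrite -normc_gt0; apply: lt_le_trans (hd _ v0); rewrite mulr_gt0.
have uw : u - omega t v != 0 by rewrite subr_eq0 eq_sym.
have -> : (u - omega t v)^-1 + (omega t v)^-1 + u / omega t v ^+ 2 =
    u ^+ 2 / (omega t v ^+ 2 * (u - omega t v)) by field; rewrite w0 uw.
rewrite (normcM (u ^+ 2)) normcX normcV (normcM (omega t v ^+ 2)) normcX.
apply: le_trans (_ : normc u ^+ 2 / ((d * (1 + hgt v)) ^+ 2 * (c * (1 + hgt v))) <= _).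
  apply: ler_wpM2l; first by rewrite exprn_ge0 ?normc_ge0.
  rewrite lef_pV2 ?posrE; first last.
  - by rewrite mulr_gt0 ?exprn_gt0 ?mulr_gt0.
  - by rewrite mulr_gt0 ?exprn_gt0 ?normc_gt0.
  have dh : 0 <= d * (1 + hgt v) by rewrite mulr_ge0 // ltW.
  have ch : 0 <= c * (1 + hgt v) by rewrite mulr_ge0 // ltW.
  apply: ler_pM => //; first exact: exprn_ge0.
    by rewrite ler_pXn2r ?nnegrE ?normc_ge0 // hd.
  by rewrite normcBC.
have -> : normc u ^+ 2 / ((d * (1 + hgt v)) ^+ 2 * (c * (1 + hgt v))) =
  K * ((1 + hgt v) ^+ 3)^-1.
  by rewrite /K; field; rewrite !gt_eqF.
apply: ler_wpM2l => //; rewrite /hgt addrC natr1; exact: wt_cube.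
Qed.

Lemma lattice_omega g : lattice t 1 g <-> exists v, g = omega t v.
Proof.
split=> [[m [n ->]]|[[m n] ->]]; first by exists (m, n); rewrite /omega mulr1.
by exists m, n; rewrite /omega mulr1.
Qed.

Lemma offlatP u : offlat u <-> ~ lattice t 1 u.
Proof.
rewrite lattice_omega; split=> [h [v E]|h v].
  by have := h v; rewrite E eqxx.
by apply/eqP => E; apply: h; exists v.
Qed.

Lemma wzetaE u Z : has_sum (zterm u) Z -> wzeta t 1 u = u^-1 + Z.
Proof.
move=> hZ; rewrite /wzeta; congr (_ + _); apply: has_sum_sum.
set A := lattice t 1 `\ 0.
have hA (g : A) : exists v, val g = omega t v.
  have := valP g; rewrite inE => -[/lattice_omega]; by [].
(* [wzeta] sums over the subtype of nonzero periods, the estimates over pairs of integers.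
   Injectivity of [omega t] makes [h] and [h'] partial inverses; only the pair (0, 0), whose term is
   zero, is missed. *)
pose h (g : A) := projT1 (cid (hA g)).
have hP g : val g = omega t (h g) by exact: (projT2 (cid (hA g))).
pose h' (v : int * int) : option A := insub (omega t v).
have Av v : v != (0, 0) -> omega t v \in A.
  move=> v0; rewrite inE; split; first by apply/lattice_omega; exists v.
  by move=> /= E; move/eqP: v0; apply; apply: omega_inj; rewrite E omega0.
have hK : pcancel h h' by move=> g; rewrite /h' -hP valK.
have h1 v : h' v = None -> zterm u v = 0.
  rewrite /h' /zterm; case: eqVneq => [//|v0].
  by case: insubP => // /negP; rewrite Av.
have h2 v g : h' v = Some g -> h g = v.
  rewrite /h'; case: insubP => // g' _ E [<-]; apply: omega_inj.
  by rewrite -hP.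
apply: has_sum_ext (has_sum_pull hK h1 h2 hZ) => g /=.
rewrite /zterm -hP; case: eqP => // E; exfalso.
have := valP g; rewrite inE => -[_ /=]; apply.
by rewrite hP E omega0.
Qed.

End Lattice.
End QuasiPeriods.

(** * Values of the quasi-periods and equivariance of p *)

Section EtaValues.
Variable R : realType.
Local Notation C := R[i].
Local Notation pic := ((pi : R)%:C).
Local Notation c2pi := (2 * pic * 'i%C : C).
Implicit Types (z w u t : C).

Lemma cJM z w : (conjc (z * w)) = conjc z * conjc w. Proof. exact: (rmorphM (@conjc R)). Qed.
Lemma cJD z w : (conjc (z + w)) = conjc z + conjc w. Proof. exact: (rmorphD (@conjc R)). Qed.
Lemma cJN z : (conjc (- z)) = - conjc z. Proof. exact: (rmorphN (@conjc R)). Qed.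
Lemma cJ1 : (conjc (1 : C)) = 1. Proof. exact: (rmorph1 (@conjc R)). Qed.
Lemma cJnat n : (conjc (n%:R : C)) = n%:R. Proof. exact: (rmorph_nat (@conjc R)). Qed.
Lemma cJX z n : (conjc (z ^+ n)) = conjc z ^+ n. Proof. exact: (rmorphXn (@conjc R)). Qed.
Lemma cJV z : conjc (z^-1) = (conjc z)^-1. Proof. exact: conjc_inv. Qed.
Definition cJE := (cJX, cJM, cJD, cJN, cJ1, cJnat, cJV, @conjc_real R).

Lemma c2piX2 : c2pi ^+ 2 = - (4 * pic ^+ 2).
Proof. by rewrite 2!exprMn sqr_i; ring. Qed.

Lemma nint_half1 : nint (2^-1 : C).
Proof.
move=> n; apply/eqP => h.
have : (2 * n)%:~R == 1%:~R :> C.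
  by rewrite intrM -h (_ : 2%:~R = 2 :> C) // divff ?pnatr_eq0.
rewrite eqr_int; lia.
Qed.

(** The row through the origin. Splitting the sum S by parity, the even terms give S/4 and the odd
    ones pi^2/4 by [row_sum_sqr] at 1/2; so 3 S = pi^2. *)
Lemma basel : has_sum (fun n : int => if n == 0 then 0 else (n%:~R ^+ 2)^-1 : C)
  (pic ^+ 2 / 3).
Proof.
pose f (n : int) : C := if n == 0 then 0 else (n%:~R ^+ 2)^-1.
have b := bsum_int (@bsum_wt R).
(* The factor 4 absorbs the shift in [wt], since 2 |n| >= |n| + 1 for n != 0. *)
have [|S hS] := has_sum_ex (f := f) (bsum_scale (ler0n R 4) b).
  move=> n; rewrite /f; case: eqVneq => [->|n0].
    by rewrite normc0; apply: mulr_ge0 => //; apply: ltW; exact: wt_gt0.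
  rewrite normcV normcX normc_int; apply: le_trans (_ : 4 * ((absz n).+1%:R ^+ 2)^-1 <= _).
    have E : `|n%:~R| = (absz n)%:R :> R by rewrite natr_absz intr_norm.
    have a1 : 1 <= (absz n)%:R :> R by rewrite ler1n lt0n absz_eq0.
    have -> : 4 * ((absz n).+1%:R ^+ 2)^-1 = (((absz n).+1%:R / 2) ^+ 2)^-1 :> R.
      by field.
    have p1 : 0 < (absz n)%:R :> R by lra.
    have p2 : 0 < (absz n).+1%:R / 2 :> R by rewrite divr_gt0.
    rewrite E lef_pV2 ?posrE ?exprn_gt0 // ler_pXn2r ?nnegrE ?(ltW p1) ?(ltW p2) // -[(absz n).+1%:R]natr1; lra.
  by apply: ler_wpM2l; [|exact: wt_sqr].
suff <- : S = pic ^+ 2 / 3 by [].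
have hodd := row_sum_sqr nint_half1.
have c2 : csc (2^-1 : C) ^+ 2 = pic ^+ 2.
  by rewrite csc2E qe_half c2piX2 (_ : - 1 - 1 = - 2 :> C); [field|ring].
rewrite c2 in hodd.
pose fe (n : int) : C := if (n == 2 * (n %/ 2)%Z) then f n else 0.
pose fo (n : int) : C := if (n == 2 * (n %/ 2)%Z) then 0 else f n.
have he : has_sum fe (S / 4).
  apply: (has_sum_push (h := fun n : int => 2 * n)
    (h' := fun n : int => if n == 2 * (n %/ 2)%Z then Some (n %/ 2)%Z else None)).
  - by move=> n; rewrite mulrC mulzK // mulrC eqxx.
  - by move=> n; rewrite /fe; case: ifP.
  - by move=> n m; case: eqP => // + [<-].
  rewrite [S / 4]mulrC; apply: has_sum_ext (has_sumZ 4^-1 hS) => n /=.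
  rewrite /fe /f [2 * n]mulrC mulzK // [n * 2]mulrC eqxx mulf_eq0 /=.
  case: eqVneq => [_|n0]; first by rewrite mulr0.
  rewrite intrM exprMn -[LHS]invfM; congr ((_ * _)^-1).
  by rewrite (_ : 2%:~R = 2 :> C) // -natrX.
have ho : has_sum fo (pic ^+ 2 / 4).
  pose ho (n : int) : int := 2 * n - 1.
  pose ho' (n : int) : option int := if n == 2 * (n %/ 2)%Z then None else Some ((n %/ 2)%Z + 1).
  apply: (has_sum_push (h := ho) (h' := ho')); rewrite /ho /ho'.
  - move=> n; have -> : ((2 * n - 1)%R %/ 2)%Z = n - 1 by lia.
    by case: eqP => [|_]; [lia|rewrite subrK].
  - by move=> n; rewrite /fo; case: ifP.
  - by move=> n m; case: eqP => // h [<-]; lia.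
  rewrite [pic ^+ 2 / 4]mulrC; apply: has_sum_ext (has_sumZ 4^-1 hodd) => n /=.
  rewrite /fo /f ifF; last by apply/eqP; lia.
  rewrite ifF; last by apply/eqP; lia.
  have -> : (2 * n - 1)%:~R = 2 * n%:~R - 1 :> C by rewrite rmorphB /= intrM.
  by rewrite /row_term -invfM; congr (_^-1); field.
have := has_sumD he ho; have Ef : (fun i => fe i + fo i) =1 f.
  by move=> n; rewrite /fe /fo; case: ifP; rewrite ?addr0 ?add0r.
move=> /(has_sum_ext Ef)/(has_sum_unique hS) E.
have : 3 * S = pic ^+ 2.
  have -> : 3 * S = 4 * S - S by ring.
  by rewrite {1}E; field.
by move=> <-; field.
Qed.

(** The sum of omega^-2 over the m-th row of the lattice, without the origin. *)
Definition rsum t (m : int) : C := if m == 0 then pic ^+ 2 / 3 else csc (m%:~R * t) ^+ 2.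

Lemma nint_Im z : Im z != 0 -> nint z.
Proof. by move=> h n; apply: contraNneq h => ->; rewrite Imint. Qed.

Lemma rsumN t m : rsum t (- m) = rsum t m.
Proof.
rewrite /rsum oppr_eq0; case: eqP => // _.
rewrite rmorphN mulNr !csc2E qeN; congr (_ * _).
have q0 := qe_neq0 (m%:~R * t); case: (eqVneq (qe (m%:~R * t)) 1) => [->|q1].
  by rewrite invr1.
have q1' : qe (m%:~R * t) - 1 != 0 by rewrite subr_eq0.
move: (qe _) q0 q1' => x x0 x1; have x1' : 1 - x != 0 by rewrite -opprB oppr_eq0.
by field; rewrite x0 x1 mulN1r x1'.
Qed.

Lemma normc_qe_lt1 t : 0 < Im t -> normc (qe t) < 1.
Proof.
by move=> t0; rewrite normc_qe expR_lt1 oppr_lt0 !mulr_gt0 ?pi_gt0.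
Qed.

(** [G2] is the sum of omega^-2 in Eisenstein's order, rows first; as a family over the whole
    lattice omega^-2 is not summable. The rows m and -m agree, which gives the factor 2. *)
Lemma rsum_has_sum t : 0 < Im t -> has_sum (rsum t) (G2 t).
Proof.
move=> t0; have q1 := normc_qe_lt1 t0.
have h := has_sumZ (c2pi ^+ 2) (Phi_rows q1).
have h' : has_sum (fun n : nat => rsum t n.+1%:Z) (c2pi ^+ 2 * Phi (qe t)).
  apply: has_sum_ext h => n; rewrite /rsum /= csc2E -pmulrn qeX.
  by rewrite -[1 - _]opprB sqrrN.
have := has_sum_pairs (rsumN t) h'; have -> : rsum t 0 = pic ^+ 2 / 3 by rewrite /rsum eqxx.
rewrite c2piX2.
suff -> : pic ^+ 2 / 3 + 2 * (- (4 * pic ^+ 2) * Phi (qe t)) = G2 t by [].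
by rewrite /G2 /E2; field.
Qed.

Definition qterm t (v : int * int) : C := if v == (0, 0) then 0 else (omega t v ^+ 2)^-1.

Lemma qterm_row t m : 0 < Im t -> has_sum (fun n => qterm t (m, n)) (rsum t m).
Proof.
move=> t0; rewrite /rsum; case: eqVneq => [->|m0].
  apply: has_sum_ext basel => n; by rewrite /qterm /omega xpair_eqE eqxx /= mul0r add0r.
have hz : nint (m%:~R * t).
  apply: nint_Im; rewrite cImM Reint Imint mul0r addr0.
  by apply: mulf_neq0; [rewrite intr_eq0|exact: lt0r_neq0].
have h := row_sum_sqr hz.
have := has_sum_bij (h := fun n : int => - n) (h' := fun n : int => - n) opprK opprK h.
apply: has_sum_ext => n; rewrite /= /qterm /row_term xpair_eqE (negbTE m0) /=.
by rewrite /omega /= rmorphN opprK expr2.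
Qed.

Definition dterm t w u (v : int * int) : C :=
  (u + w - omega t v)^-1 - (u - omega t v)^-1 + w * qterm t v.

Lemma dterm_has_sum t w u : 0 < Im t -> offlat t u -> offlat t (u + w) ->
  has_sum (dterm t w u) (wzeta t 1 (u + w) - wzeta t 1 u).
Proof.
move=> t0 hu hv; have [Z hZ] := zterm_has_sum t0 hu; have [W hW] := zterm_has_sum t0 hv.
rewrite (wzetaE t0 hZ) (wzetaE t0 hW).
(* The origin, where [zterm] is zero, now receives the two reciprocals that stand outside the sum in
   [wzeta]. *)
have := has_sumD (has_sumB hW hZ) (has_sum1 (0 : int, 0 : int) ((u + w)^-1 - u^-1)).
have -> : W - Z + ((u + w)^-1 - u^-1) = (u + w)^-1 + W - (u^-1 + Z) by ring.
apply: has_sum_ext => v; rewrite /zterm /dterm /qterm.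
case: eqVneq => [->|v0]; first by rewrite omega0 !subr0; ring.
by rewrite addr0; ring.
Qed.

(** The difference of two zeta values is an unconditional sum over the lattice, hence may be summed
    by rows. Within a row the differences of reciprocals and the terms omega^-2 are summable
    separately. *)
Lemma rows_dterm t w u : 0 < Im t -> offlat t u -> offlat t (u + w) ->
  has_sum (fun m : int => c2pi * (cotL (u + w - m%:~R * t) - cotL (u - m%:~R * t)) +
      w * rsum t m) (wzeta t 1 (u + w) - wzeta t 1 u).
Proof.
move=> t0 hu hv; apply: has_sum_rows (dterm_has_sum t0 hu hv) _ => m.
have nt (x : C) : offlat t x -> nint (x - m%:~R * t).
  move=> hx n; rewrite subr_eq addrC eq_sym; exact: (hx (m, n)).
have := has_sumD (row_sum_diff (nt _ hv) (nt _ hu)) (has_sumZ w (qterm_row m t0)).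
apply: has_sum_ext => n; rewrite /dterm /omega /=.
by congr (_^-1 - _^-1 + _); ring.
Qed.

Lemma offlatD t u v : offlat t u -> offlat t (u + omega t v).
Proof.
move=> hu [m n]; case: v => m' n'; have := hu (m - m', n - n').
apply: contra => /eqP; rewrite /omega /= => E; apply/eqP.
by rewrite !rmorphB /= mulrBl -[u](addrK (m'%:~R * t + n'%:~R)) -E; ring.
Qed.

Lemma offlat1 t u : offlat t u -> offlat t (u + 1).
Proof. by move=> /(@offlatD t u (0, 1)); rewrite /omega /= mul0r add0r. Qed.
Lemma offlatt t u : offlat t u -> offlat t (u + t).
Proof. by move=> /(@offlatD t u (1, 0)); rewrite /omega /= mul1r addr0. Qed.

(** A shift by 1 preserves each row, so the cotangent terms cancel. *)
Lemma zeta_quasi1 t u : 0 < Im t -> offlat t u ->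
  wzeta t 1 (u + 1) = wzeta t 1 u + G2 t.
Proof.
move=> t0 hu; have h := rows_dterm t0 hu (offlat1 hu).
rewrite -[LHS](subrK (wzeta t 1 u)) addrC; congr (_ + _).
apply: has_sum_unique h _; apply: has_sum_ext (rsum_has_sum t0) => m.
rewrite mul1r (_ : u + 1 - m%:~R * t = u - m%:~R * t + 1%:~R); last by rewrite addrAC.
by rewrite /cotL qeDint subrr mulr0 add0r.
Qed.

(** [cotL] tends to -1 far up and, by the next lemma, to 0 far down; this gap is the origin of the
    constant 2 pi i in eta_1. *)
Lemma cotL_up z : normc (qe z) <= 2^-1 -> normc (cotL z + 1) <= 2 * normc (qe z).
Proof.
move=> h; have q0 := normc_ge0 (qe z).
have h1 : 2^-1 <= normc (qe z - 1).
  by rewrite normcBC; have := lenB 1 (qe z); rewrite normc1; lra.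
have q1 : qe z - 1 != 0 by rewrite -normc_gt0; lra.
have -> : cotL z + 1 = qe z / (qe z - 1) by rewrite /cotL; field.
rewrite normcM normcV mulrC ler_wpM2r //.
by rewrite -[2]invrK lef_pV2 ?posrE ?invr_gt0 //; lra.
Qed.

Lemma cotL_down z : normc (qe (- z)) <= 2^-1 -> normc (cotL z) <= 2 * normc (qe (- z)).
Proof.
move=> h; have q0 := normc_ge0 (qe (- z)).
have h1 : 2^-1 <= normc (1 - qe (- z)).
  by have := lenB 1 (qe (- z)); rewrite normc1; lra.
have q1 : 1 - qe (- z) != 0 by rewrite -normc_gt0; lra.
have -> : cotL z = qe (- z) / (1 - qe (- z)).
  rewrite /cotL; move: q1; rewrite qeN; have := qe_neq0 z.
  move: (qe z) => x x0 x1; have x2 : x - 1 != 0.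
    by apply: contraNneq x1 => /eqP; rewrite subr_eq0 => /eqP ->; rewrite invr1 subrr.
  by field; rewrite x2 x0.
rewrite normcM normcV mulrC ler_wpM2r //.
by rewrite -[2]invrK lef_pV2 ?posrE ?invr_gt0 //; lra.
Qed.

Lemma qe_decay (c y e : R) : 0 < y -> 0 < e -> exists N0 : nat, forall N : nat,
  (N0 <= N)%N -> forall z, c + N%:R * y <= Im z -> normc (qe z) <= e.
Proof.
move=> y0 e0; exists (Num.truncn ((`|c| + e^-1) / y)).+1 => N hN z hz.
have hN' : (`|c| + e^-1) / y <= N%:R.
  apply: le_trans (ltW (truncnS_gt _)) _; by rewrite ler_nat.
have h : e^-1 <= Im z.
  apply: le_trans hz; move: hN'; rewrite ler_pdivrMr //; have := ler_norm (- c).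
  rewrite normrN; lra.
have z0 : 0 < Im z by apply: lt_le_trans h; rewrite invr_gt0.
rewrite normc_qe expRN -[e]invrK lef_pV2 ?posrE ?expR_gt0 ?invr_gt0 //.
have := expR_ge1Dx (2 * pi * Im z); have p2 := pi_ge2 R.
have : 2 * Im z <= pi * Im z by rewrite ler_wpM2r // ltW.
lra.
Qed.

Lemma sum_telescope (a : int -> C) (N : nat) (s : int) :
  \sum_(k < N) (a (k%:Z + s - 1) - a (k%:Z + s)) = a (s - 1) - a (N%:Z + s - 1).
Proof.
elim: N => [|N IH]; first by rewrite big_ord0 add0r subrr.
rewrite big_ord_recr /= IH; have -> : N.+1%:Z + s - 1 = N%:Z + s by lia.
by ring.
Qed.

(** A shift by t moves each row to the next, so the cotangent terms telescope to the difference of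
    the limits of [cotL] at the two ends, namely -1. Together with the value of eta_2 this is
    Legendre's relation. *)
Lemma zeta_quasit t u : 0 < Im t -> offlat t u ->
  wzeta t 1 (u + t) = wzeta t 1 u + (t * G2 t - c2pi).
Proof.
move=> t0 hu; have h := rows_dterm t0 hu (offlatt hu).
set D := wzeta t 1 (u + t) - wzeta t 1 u in h *.
have h2 := has_sumB h (has_sumZ t (rsum_has_sum t0)).
pose a (m : int) := cotL (u - m%:~R * t).
have h3 : has_sum (fun m => c2pi * (a (m - 1) - a m)) (D - t * G2 t).
  apply: has_sum_ext h2 => m; rewrite addrK /a; congr (_ * (cotL _ - _)).
  by rewrite rmorphB /=; ring.
suff : D - t * G2 t = - c2pi.
  by move=> E; rewrite -[LHS](subrK (wzeta t 1 u)) -/D -[D](subrK (t * G2 t)) E; ring.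
apply/eqP; rewrite -subr_eq0; apply/eqP/small_eqC => e e0.
have c0 : 0 < normc c2pi by rewrite -mulrA normcM normc_nat normc_pii mulr_gt0 // pi_gt0.
(* The bound 1/2 is the hypothesis of the decay lemmas; they bound the two ends together by 4 d, and
   the factor 8 makes this at most e/2 after multiplication by |2 pi i|. *)
pose d := Num.min 2^-1 (e / normc c2pi / 8).
have d0 : 0 < d by rewrite lt_min invr_gt0 ltr0n !divr_gt0.
have d1 : d <= 2^-1 by rewrite ge_min lexx.
have d2 : d <= e / normc c2pi / 8 by rewrite ge_min lexx orbT.
have [N1 k1] := qe_decay (Im u) t0 d0.
have [N2 k2] := qe_decay (- Im u - Im t) t0 d0.
have e2 : 0 < e / 2 by rewrite divr_gt0.
have [N3 k3] := has_sum_sym h3 e2.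
pose N := (N1 + N2 + N3)%N.
have := k3 N (leq_addl _ _); rewrite -mulr_sumr.
under eq_bigr => k _ do rewrite -[k%:Z - N%:Z - 1]/(k%:Z + - N%:Z - 1).
rewrite sum_telescope => h4.
have h5 : normc (qe (u - (- N%:Z - 1)%:~R * t)) <= d.
  apply: (k1 N); first by rewrite /N -addnA leq_addr.
  rewrite cImD cImN cImM Reint Imint mul0r addr0.
  have -> : (- N%:Z - 1)%:~R = - N%:R - 1 :> R by rewrite rmorphB /= mulrNz -pmulrn.
  by have := ltW t0; lra.
have h6 : normc (qe (- (u - ((N + N)%N%:Z + - N%:Z - 1)%:~R * t))) <= d.
  apply: (k2 N); first by rewrite /N addnAC leq_addl.
  rewrite cImN cImD cImN cImM Reint Imint mul0r addr0.
  have -> : ((N + N)%N%:Z + - N%:Z - 1)%:~R = N%:R - 1 :> R.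
    by rewrite rmorphB rmorphD /= mulrNz -!pmulrn natrD addrK.
  by have := ltW t0; lra.
have h7 := cotL_up (le_trans h5 d1); have h8 := cotL_down (le_trans h6 d1).
rewrite -/(a _) in h7 h8.
set A := a _ in h7 h4; set B := a _ in h8 h4.
have -> : D - t * G2 t - - c2pi = (c2pi * ((A + 1) - B)) - (c2pi * (A - B) - (D - t * G2 t)).
  by ring.
apply: le_lt_trans (normcB _ _) _; rewrite (splitr e) ler_ltD //.
rewrite normcM; apply: le_trans (_ : normc c2pi * (4 * d) <= _).
  rewrite ler_wpM2l ?normc_ge0 //; apply: le_trans (normcB _ _) _; lra.
have : normc c2pi * d <= normc c2pi * (e / normc c2pi / 8) by rewrite ler_pM2l.
have -> : normc c2pi * (e / normc c2pi / 8) = e / 8 by field; rewrite gt_eqF.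
lra.
Qed.

Lemma offlat_half t : 0 < Im t -> offlat t (t / 2).
Proof.
move=> t0 [m n]; apply/eqP => /(congr1 (fun x => 2 * x)).
rewrite [2 * (t / 2)]mulrC divfK ?pnatr_eq0 // => /(congr1 (@complex.Im R)).
rewrite cImM Renat Imnat mul0r addr0 Im_omega mulrA => /eqP.
rewrite -subr_eq0 -{2}[Im t]mul1r -mulrBl mulf_eq0 (gt_eqF t0) orbF.
rewrite (_ : 2 * m%:~R - 1 = (2 * m - 1)%:~R) ?intr_eq0; last by rewrite rmorphB /= intrM.
by move=> /eqP /=; lia.
Qed.

(** [get] returns some constant with the defining property; evaluation at t/2, which is not a
    period, shows that it is [c]. *)
Lemma quasi_periodE t w (c : C) : 0 < Im t ->
  (forall u, offlat t u -> wzeta t 1 (u + w) = wzeta t 1 u + c) ->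
  quasi_period t 1 w = c.
Proof.
move=> t0 h; rewrite /quasi_period; set P := [set e | _].
have Pc : P c by move=> u /offlatP hu; exact: h.
have := getI Pc; move=> /(_ (t / 2)).
have hu := offlat_half t0; rewrite h // => /(_ ((offlatP _ _).1 hu)).
by move=> /addrI.
Qed.

(* eta_1 / eta_2 with eta_2 = G2 t and eta_1 = t G2 t - 2 pi i. *)
Lemma pE t : 0 < Im t ->
  p t = if G2 t == 0 then None else Some ((t * G2 t - c2pi) / G2 t).
Proof.
move=> t0; rewrite /p /eta_ratio.
have -> : quasi_period t 1 1 = G2 t.
  by apply: quasi_periodE => // u hu; exact: zeta_quasi1.
have -> : quasi_period t 1 t = t * G2 t - c2pi.
  by apply: quasi_periodE => // u hu; exact: zeta_quasit.
by [].
Qed.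

Lemma G2_D1 t : G2 (t + 1) = G2 t.
Proof. by rewrite /G2 qeD qe1 mulr1. Qed.

(* Reindexing the lattice of -1/t as t^-1 times that of t. *)
Lemma zeta_inv t u : 0 < Im t -> offlat t (t * u) ->
  wzeta (- t^-1) 1 u = t * wzeta t 1 (t * u).
Proof.
move=> t0 hu; have tn0 : t != 0 by apply: contraTneq t0 => ->; rewrite ltxx.
have t1 : 0 < Im (- t^-1).
  have tt : 0 < Re t ^+ 2 + Im t ^+ 2 by rewrite ltr_wpDl ?sqr_ge0 // exprn_gt0.
  rewrite cImN; case: (t) t0 tt => x y /= t0 tt; rewrite opprK.
  by rewrite divr_gt0.
have Eo v : omega (- t^-1) v = omega t (v.2, - v.1) / t.
  by rewrite /omega /= rmorphN; field.
have hu' : offlat (- t^-1) u.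
  move=> v; rewrite Eo; apply: contra (hu (v.2, - v.1)) => /eqP <-.
  by rewrite mulrC divfK.
have [Z hZ] := zterm_has_sum t0 hu.
pose h (v : int * int) := (v.2, - v.1); pose h' (v : int * int) := (- v.2, v.1).
have hK : cancel h h' by move=> [m n]; rewrite /h /h' /= opprK.
have h'K : cancel h' h by move=> [m n]; rewrite /h /h' /= opprK.
have hZ' : has_sum (zterm (- t^-1) u) (t * Z).
  apply: has_sum_ext (has_sumZ t (has_sum_bij hK h'K hZ)) => -[m n].
  have E : (h (m, n) == (0, 0)) = ((m, n) == (0, 0)).
    by rewrite /h !xpair_eqE /= oppr_eq0 andbC.
  rewrite /= /zterm Eo E; case: eqVneq => [_|mn0]; first by rewrite mulr0.
  have w0 : omega t (n, - m) != 0.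
    by rewrite -(omega0 t) (inj_eq (omega_inj t0)) -/(h (m, n)) E.
  rewrite /h /=.
  have w1 : t * u - omega t (n, - m) != 0 by rewrite subr_eq0 eq_sym; exact: hu.
  have w2 : u - omega t (n, - m) / t != 0.
    by apply: contra w1 => /eqP E1; rewrite -[omega _ _](divfK tn0) [_ / t * t]mulrC -mulrBr E1 mulr0.
  move: (omega t (n, - m)) w0 w1 w2 => x w0 w1 w2.
  by field; rewrite tn0 w0 [u * t]mulrC w1.
rewrite (wzetaE t1 hZ') (wzetaE t0 hZ) mulrDr; congr (_ + _).
by rewrite invfM mulrA divff // mul1r.
Qed.

Lemma Im_invN t : 0 < Im t -> 0 < Im (- t^-1).
Proof.
move=> t0; have tt : 0 < Re t ^+ 2 + Im t ^+ 2 by rewrite ltr_wpDl ?sqr_ge0 // exprn_gt0.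
by rewrite cImN; case: (t) t0 tt => x y /= t0 tt; rewrite opprK divr_gt0.
Qed.

(** Homogeneity of the zeta-function turns the period 1 of the lattice of -1/t into the period t. So
    eta_2 at -1/t is t times eta_1 at t. *)
Lemma G2_inv t : 0 < Im t -> G2 (- t^-1) = t * (t * G2 t - c2pi).
Proof.
move=> t0; have t1 := Im_invN t0.
have tn0 : t != 0 by apply: contraTneq t0 => ->; rewrite ltxx.
have hu : offlat t (t * 2^-1) by exact: offlat_half.
have hu1 : offlat t (t * (2^-1 + 1)) by rewrite mulrDr mulr1; exact: offlatt.
have hv : offlat (- t^-1) 2^-1.
  move=> v; apply: contra (hu (v.2, - v.1)) => /eqP <-; apply/eqP.
  by rewrite /omega /= rmorphN; field.
have E : t * (2^-1 + 1) = t * 2^-1 + t by rewrite mulrDr mulr1.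
have := zeta_quasi1 t1 hv; rewrite !zeta_inv // E zeta_quasit //.
by move=> H; apply: (addrI (t * wzeta t 1 (t * 2^-1))); rewrite -H mulrDr.
Qed.

Lemma Phi_J (x : C) : normc x < 1 -> Phi (conjc x) = conjc (Phi x).
Proof.
move=> x1; have x1' : normc (conjc x) < 1 by rewrite normcJ'.
apply: has_sum_unique (Phi_has_sum x1') _.
apply: has_sum_ext (has_sum_J (Phi_has_sum x1)) => v.
by rewrite !cJE.
Qed.

Lemma G2_NJ t : 0 < Im t -> G2 (- conjc t) = conjc (G2 t).
Proof.
move=> t0; rewrite /G2 qe_NJ /E2 Phi_J ?normc_qe_lt1 //.
by rewrite !cJE.
Qed.

Lemma refl0E (z : sphere R) : reflection (T0_circle R 0) z = sconj (sinv z).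
Proof.
case: z => [z|] /=; rewrite /T0_circle /= /sconj /=; last by rewrite oppr0.
case: eqP => [//|_] /=; rewrite subr0 add0r expr1n mul1r; congr Some.
by rewrite cJV.
Qed.

Lemma refl1E (z : sphere R) : reflection (T0_circle R 1) z = omap (fun t : C => 1 - conjc t) z.
Proof.
case: z => [z|] //=; rewrite /T0_circle /=; congr Some.
rewrite oppr0 divr1 mul1r; congr (_ - _).
by apply: eqReIm; rewrite !cE /=; field.
Qed.

Lemma refl2E (z : sphere R) : reflection (T0_circle R 2) z = omap (fun t : C => - conjc t) z.
Proof.
case: z => [z|] //=; rewrite /T0_circle /=; congr Some.
by rewrite oppr0 divr1 mul1r mulr0 sub0r.
Qed.

Lemma Im_NJ t : Im (- conjc t) = Im t. Proof. by rewrite cImN cImJ opprK. Qed.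

Lemma pJ_D1 t : 0 < Im t -> p (t + 1) = omap (fun w : C => w + 1) (p t).
Proof.
move=> t0; have t1 : 0 < Im (t + 1) by rewrite cImD cIm1 addr0.
rewrite !pE // G2_D1; case: eqVneq => //= g0; congr Some.
by field.
Qed.

Lemma p_NJ t : 0 < Im t -> p (- conjc t) = omap (fun w : C => - conjc w) (p t).
Proof.
move=> t0; have t1 : 0 < Im (- conjc t) by rewrite Im_NJ.
rewrite !pE // G2_NJ // conjc_eq0; case: eqVneq => //= g0; congr Some.
have g1 : (conjc (G2 t)) != 0 by rewrite conjc_eq0.
have iJ : (conjc ('i%C : C)) = - 'i%C by apply: eqReIm; rewrite /= ?oppr0.
by move: (G2 t) g0 g1 => g g0 g1; rewrite !cJE iJ; field.
Qed.

(** Up to signs and scaling the inversion exchanges the two quasi-periods. The cases where one of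
    them vanishes are p = infinity and p = 0, which [sinv] exchanges. *)
Lemma p_inv t : 0 < Im t -> p (- t^-1) = omap (fun w : C => - w) (sinv (p t)).
Proof.
move=> t0; have t1 := Im_invN t0; rewrite !pE // G2_inv //.
have tn0 : t != 0 by apply: contraTneq t0 => ->; rewrite ltxx.
have c0 : c2pi != 0.
  by rewrite -normc_gt0 -mulrA normcM normc_nat normc_pii mulr_gt0 // pi_gt0.
move: (c2pi) c0 (G2 t) => c c0 g.
rewrite mulf_eq0 (negbTE tn0) /=; case: (eqVneq g 0) => [->|g0] /=.
  rewrite mulr0 sub0r oppr_eq0 (negbTE c0); congr Some.
  by rewrite oppr0; field; rewrite c0 tn0.
case: eqVneq => [->|h] /=; first by rewrite mul0r eqxx.
rewrite mulf_eq0 invr_eq0 (negbTE g0) (negbTE h) /=; congr Some.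
by field; rewrite tn0 h g0.
Qed.

Lemma pbar_refl (k : 'I_3) t : 0 < Im t ->
  pbar (reflection (T0_circle R k) (Some t)) = reflection (T0_circle R k) (pbar (Some t)).
Proof.
move=> t0; have tn0 : t != 0 by apply: contraTneq t0 => ->; rewrite ltxx.
have n0 : 0 < Im (- conjc t) by rewrite Im_NJ.
case: k => [[|[|[|//]]] hk].
- rewrite (_ : Ordinal hk = 0); last exact: val_inj.
  rewrite !refl0E /= (negbTE tn0) /sconj /= cJV.
  have -> : (conjc t)^-1 = - (- conjc t)^-1 by rewrite invrN opprK.
  rewrite p_inv // p_NJ //; case: (p t) => [w|] //=; last by rewrite !oppr0.
  rewrite oppr_eq0 !conjc_eq0; case: eqP => //= w0; congr Some.
  by rewrite invrN opprK cJV conjcK.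
- rewrite (_ : Ordinal hk = 1); last exact: val_inj.
  rewrite !refl1E /= addrC pJ_D1 // p_NJ //; case: (p t) => [w|] //=; congr Some.
  by rewrite !cJE conjcK; ring.
- rewrite (_ : Ordinal hk = 2); last exact: val_inj.
  rewrite !refl2E /= p_NJ //; case: (p t) => [w|] //=; congr Some.
  by rewrite !cJE.
Qed.

End EtaValues.

(** * Estimates for the derivative of p *)

Section StrictDerivative.
Variable R : realType.
Local Notation C := R[i].
Implicit Types (f g : C -> C) (z d h : C).

(** A complex derivative with quadratic remainder. The series estimates provide this form directly,
    and the rules of calculus and uniqueness are elementary for it. *)
Definition sder f z d := exists K e : R, [/\ 0 <= K, 0 < e &
  forall h, normc h <= e -> normc (f (z + h) - f z - d * h) <= K * normc h ^+ 2].

Lemma sder_uniq f z d d' : sder f z d -> sder f z d' -> d = d'.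
Proof.
move=> [K [e [K0 e0 hK]]] [K' [e' [K'0 e'0 hK']]].
apply/eqP; rewrite -subr_eq0; apply/eqP/small_eqC => x x0.
pose y := Num.min (Num.min e e') (x / (K + K' + 1)).
have s0 : 0 < K + K' + 1 by lra.
have y0 : 0 < y by rewrite !lt_min e0 e'0 divr_gt0.
have ye : y <= e by rewrite !ge_min lexx.
have ye' : y <= e' by rewrite !ge_min lexx orbT.
have yx : y * (K + K' + 1) <= x by rewrite -ler_pdivlMr // !ge_min lexx orbT.
have ny : normc (y%:C : C) = y by rewrite normc_real ger0_norm // ltW.
have := hK y%:C; have := hK' y%:C; rewrite ny => /(_ ye') h1 /(_ ye) h2.
have h3 : normc ((d - d') * y%:C) <= (K + K') * y ^+ 2.
  have -> : (d - d') * y%:C = (f (z + y%:C) - f z - d' * y%:C) - (f (z + y%:C) - f z - d * y%:C).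
    by ring.
  by apply: le_trans (normcB _ _) _; lra.
have h4 : normc (d - d') <= (K + K') * y.
  by rewrite -(ler_pM2r y0) -mulrA -expr2 -{1}ny -normcM.
lra.
Qed.

Lemma sder_ext f g z d : (exists2 e : R, 0 < e & forall h, normc h <= e -> f (z + h) = g (z + h)) ->
  sder f z d -> sder g z d.
Proof.
move=> [e e0 he] [K [e' [K0 e'0 hK]]]; exists K, (Num.min e e'); split=> //.
  by rewrite lt_min e0.
have hz : f z = g z by have := he 0; rewrite normc0 addr0; apply; exact: ltW.
by move=> h; rewrite le_min => /andP[h1 h2]; rewrite -he // -hz hK.
Qed.

Lemma sder_lip f z d : sder f z d -> exists K e : R, [/\ 0 < K, 0 < e &
  forall h, normc h <= e -> normc (f (z + h) - f z) <= K * normc h].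
Proof.
move=> [K [e [K0 e0 hK]]]; exists (normc d + K * e + 1), e; split=> //.
  by rewrite ltr_wpDl // addr_ge0 ?normc_ge0 ?mulr_ge0 // ltW.
move=> h he; have h0 := normc_ge0 h; have := hK h he; rewrite expr2 => h1.
have h2 := normcD (f (z + h) - f z - d * h) (d * h); rewrite subrK normcM in h2.
have h3 : K * (normc h * normc h) <= K * (e * normc h).
  by rewrite ler_wpM2l // ler_wpM2r.
lra.
Qed.

Lemma sder_cst c z : sder (fun _ => c) z 0.
Proof.
exists 0, 1; split=> // h _; by rewrite subrr mul0r subr0 normc0 mul0r.
Qed.

Lemma sder_id z : sder id z 1.
Proof.
exists 0, 1; split=> // h _ /=; have -> : z + h - z - 1 * h = 0 by ring.
by rewrite normc0 mul0r.
Qed.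

Lemma sderD f g z d d' : sder f z d -> sder g z d' ->
  sder (fun x => f x + g x) z (d + d').
Proof.
move=> [K [e [K0 e0 hK]]] [K' [e' [K'0 e'0 hK']]].
exists (K + K'), (Num.min e e'); split; [exact: addr_ge0|by rewrite lt_min e0|].
move=> h; rewrite le_min => /andP[h1 h2].
have -> : f (z + h) + g (z + h) - (f z + g z) - (d + d') * h =
  (f (z + h) - f z - d * h) + (g (z + h) - g z - d' * h) by ring.
by apply: le_trans (normcD _ _) _; rewrite mulrDl lerD ?hK ?hK'.
Qed.

Lemma sderZ c f z d : sder f z d -> sder (fun x => c * f x) z (c * d).
Proof.
move=> [K [e [K0 e0 hK]]]; exists (normc c * K), e.
split=> [|//|h he]; first by rewrite mulr_ge0 ?normc_ge0.
have -> : c * f (z + h) - c * f z - c * d * h = c * (f (z + h) - f z - d * h) by ring.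
by rewrite normcM -mulrA ler_wpM2l ?normc_ge0 // hK.
Qed.

Lemma sder_comp f g z d d' : sder g z d' -> sder f (g z) d ->
  sder (f \o g) z (d * d').
Proof.
move=> hg [K [e [K0 e0 hK]]]; have [L [e1 [L0 e10 hL]]] := sder_lip hg.
case: hg => [K' [e' [K'0 e'0 hK']]].
exists (K * L ^+ 2 + normc d * K'), (Num.min (Num.min e1 e') (e / L)).
split; first by rewrite addr_ge0 ?mulr_ge0 ?normc_ge0 ?(ltW L0).
  by rewrite !lt_min e10 e'0 divr_gt0.
move=> h; rewrite !le_min => /andP[/andP[h1 h2] h3].
have h4 := hL _ h1; set k := g (z + h) - g z in h4.
have gk : g (z + h) = g z + k by rewrite /k; ring.
have ke : normc k <= e.
  by apply: le_trans h4 _; rewrite mulrC -ler_pdivlMr.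
rewrite /= gk.
have -> : f (g z + k) - f (g z) - d * d' * h =
  (f (g z + k) - f (g z) - d * k) + d * (g (z + h) - g z - d' * h) by rewrite -/k; ring.
apply: le_trans (normcD _ _) _; rewrite normcM mulrDl lerD //.
  apply: le_trans (hK _ ke) _; rewrite -mulrA -exprMn ler_wpM2l //.
  by rewrite ler_pXn2r ?nnegrE ?normc_ge0 ?mulr_ge0 ?normc_ge0 // ltW.
by rewrite -mulrA ler_wpM2l ?normc_ge0 // hK'.
Qed.

Lemma sder_inv z : z != 0 -> sder (fun x => x^-1) z (- (z ^+ 2)^-1).
Proof.
move=> z0; have n0 : 0 < normc z by rewrite normc_gt0.
exists (2 / normc z ^+ 3), (normc z / 2).
split=> [||h hz]; rewrite ?divr_gt0 ?divr_ge0 ?exprn_ge0 ?normc_ge0 //.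
have h1 : normc z / 2 <= normc (z + h) by have := lenD z h; lra.
have zh : z + h != 0 by rewrite -normc_gt0; apply: lt_le_trans h1; rewrite divr_gt0.
have -> : (z + h)^-1 - z^-1 - - (z ^+ 2)^-1 * h = h ^+ 2 / (z ^+ 2 * (z + h)).
  by field; rewrite zh z0.
rewrite (normcM (h ^+ 2)) normcX normcV (normcM (z ^+ 2)) normcX mulrC.
apply: ler_wpM2r; first by rewrite exprn_ge0 ?normc_ge0.
have -> : 2 / normc z ^+ 3 = (normc z ^+ 2 * (normc z / 2))^-1 by field; rewrite gt_eqF.
rewrite lef_pV2 ?posrE ?mulr_gt0 ?exprn_gt0 ?divr_gt0 ?normc_gt0 //.
by rewrite ler_wpM2l // exprn_ge0 ?normc_ge0.
Qed.

Lemma cexp_quad : exists2 K : R, 0 < K & forall h : C, normc h <= 1 ->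
  normc (cexp h - 1 - h) <= K * normc h ^+ 2.
Proof.
have E1 : 1 <= expR 1 :> R by have := expR_ge1Dx (1 : R); lra.
exists (4 * expR 1); first by rewrite mulr_gt0 // expR_gt0.
move=> [x y] hz; have hx := le_trans (Re_le_normc _) hz.
have hy := le_trans (Im_le_normc _) hz; rewrite /= in hx hy.
set n := normc _ in hz *; have n0 : 0 <= n by exact: normc_ge0.
have xn : `|x| <= n by exact: (Re_le_normc (x +i* y)).
have yn : `|y| <= n by exact: (Im_le_normc (x +i* y)).
apply: le_trans (normc_le_ReIm _) _; rewrite /cexp !cE /= ?oppr0 ?subr0.
have h1 := expR_sub1x hx; have h2 := expR_sub1 hx; have h3 := sin_subx y.
have h4 := norm_sin_le y; have /andP[h5 h6] := cos_sub1 y.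
have ex : expR x <= expR 1 by rewrite ler_expR; have := ler_norm x; lra.
have x2 : `|x| ^+ 2 <= n ^+ 2 by rewrite ler_pXn2r ?nnegrE.
have y2 : y ^+ 2 <= n ^+ 2 by rewrite -[y ^+ 2]real_normK ?num_real // ler_pXn2r ?nnegrE.
have y3 : `|y| ^+ 3 <= n ^+ 2.
  rewrite exprSr -[leRHS]mulr1 ler_pM ?exprn_ge0 //.
  by rewrite ler_pXn2r ?nnegrE.
set A := _ - _ - _ - x; set D := _ + _ - y.
have -> : A = (expR x - 1 - x) - expR x * (1 - cos y) by rewrite /A; ring.
have -> : D = (expR x - 1) * sin y + (sin y - y) by rewrite /D; ring.
have a1 : `|expR x * (1 - cos y)| <= expR 1 * n ^+ 2.
  rewrite normrM (ger0_norm h5) ger0_norm ?expR_ge0 // ler_pM ?expR_ge0 //; lra.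
have a2 : `|(expR x - 1) * sin y| <= expR 1 * n ^+ 2.
  rewrite normrM expr2 mulrA ler_pM //; last exact: le_trans yn.
  apply: le_trans h2 _; rewrite ler_wpM2l ?expR_ge0 //.
have b1 := ler_normB (expR x - 1 - x) (expR x * (1 - cos y)).
have b2 := ler_normD ((expR x - 1) * sin y) (sin y - y).
have b3 : expR 1 * `|x| ^+ 2 <= expR 1 * n ^+ 2 by rewrite ler_wpM2l ?expR_ge0.
have b4 : n ^+ 2 <= expR 1 * n ^+ 2 by rewrite ler_peMl // exprn_ge0.
lra.
Qed.

Lemma sder_cexp z : sder (@cexp R) z (cexp z).
Proof.
have [K K0 hK] := cexp_quad; exists (normc (cexp z) * K), 1; split=> //.
  by rewrite mulr_ge0 ?normc_ge0 // ltW.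
move=> h h1; rewrite cexpD.
have -> : cexp z * cexp h - cexp z - cexp z * h = cexp z * (cexp h - 1 - h) by ring.
by rewrite normcM -mulrA ler_wpM2l ?normc_ge0 // hK.
Qed.

End StrictDerivative.

(** * Coefficient bounds for power series in q *)

Section QSeries.
Variable R : realType.
Local Notation C := R[i].
Implicit Types (a b : C).

(** For Im t >= 43/50, a rational number just below sqrt 3 / 2, one has 2 pi Im t >= 2 * 3 * 43/50 >
    128/25, and e^(128/25) exceeds 160. *)
Definition rb : R := 160^-1.
Definition nidx (v : nat * nat) : nat := (v.1.+1 * v.2.+1)%N.

Lemma pow_diff (r : R) a b n : normc a <= r -> normc b <= r ->
  normc (a ^+ n.+1 - b ^+ n.+1) <= n.+1%:R * r ^+ n * normc (a - b).
Proof.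
move=> ha hb; have r0 := le_trans (normc_ge0 a) ha.
elim: n => [|n IH]; first by rewrite !expr1 expr0 mulr1 mul1r.
have -> : a ^+ n.+2 - b ^+ n.+2 = a * (a ^+ n.+1 - b ^+ n.+1) + (a - b) * b ^+ n.+1.
  by rewrite [a ^+ n.+2]exprS [b ^+ n.+2]exprS; ring.
apply: le_trans (normcD _ _) _; rewrite (normcM a) (normcM (a - b)) normcX.
have h1 := ler_pM (normc_ge0 _) (normc_ge0 _) ha IH.
have h2 : normc (a - b) * normc b ^+ n.+1 <= normc (a - b) * r ^+ n.+1.
  by rewrite ler_wpM2l ?normc_ge0 // ler_pXn2r ?nnegrE ?normc_ge0.
apply: le_trans (lerD h1 h2) _; rewrite -[n.+2%:R]natr1 [r ^+ n.+1]exprS; lra.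
Qed.

(** The bound uses r^n / r in place of a truncated exponent n - 1, so that the induction starts at n
    = 0. *)
Lemma pow_diff2 (r : R) a b n : 0 < r -> normc a <= r -> normc b <= r ->
  normc (a ^+ n.+1 - b ^+ n.+1 - n.+1%:R * b ^+ n * (a - b)) <=
    n.+1%:R ^+ 2 * r ^+ n / r * normc (a - b) ^+ 2.
Proof.
move=> r0 ha hb; elim: n => [|n IH].
  rewrite !expr1 expr0 mulr1 mul1r subrr normc0 mulr_ge0 ?exprn_ge0 ?normc_ge0 //.
  by rewrite divr_ge0 ?mulr_ge0 ?exprn_ge0 // ltW.
have -> : a ^+ n.+2 - b ^+ n.+2 - n.+2%:R * b ^+ n.+1 * (a - b) =
  a * (a ^+ n.+1 - b ^+ n.+1 - n.+1%:R * b ^+ n * (a - b)) + n.+1%:R * b ^+ n * (a - b) ^+ 2.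
  by rewrite [a ^+ n.+2]exprS [b ^+ n.+2]exprS [b ^+ n.+1]exprS -[n.+2%:R]natr1; ring.
apply: le_trans (normcD _ _) _; rewrite (normcM a) (normcM (n.+1%:R * _)).
rewrite (normcM n.+1%:R) !normcX normc_nat.
have h1 := ler_pM (normc_ge0 _) (normc_ge0 _) ha IH.
have h2 : n.+1%:R * normc b ^+ n * normc (a - b) ^+ 2 <=
    n.+1%:R * r ^+ n * normc (a - b) ^+ 2.
  rewrite ler_wpM2r ?exprn_ge0 ?normc_ge0 // ler_wpM2l //.
  by rewrite lerXn2r ?nnegrE ?normc_ge0 // ltW.
apply: le_trans (lerD h1 h2) _.
rewrite -[n.+2%:R]natr1 [r ^+ n.+1]exprS.
move: (r ^+ n) (exprn_ge0 n (ltW r0)) (n.+1%:R : R) (ler0n R n.+1) => P P0 N N0.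
move: (normc (a - b) ^+ 2) (exprn_ge0 2 (normc_ge0 (a - b))) => d d0.
have -> : r * (N ^+ 2 * P / r * d) + N * P * d = (N ^+ 2 + N) * (P * d).
  by field; rewrite gt_eqF.
have -> : (N + 1) ^+ 2 * (r * P) / r * d = (N + 1) ^+ 2 * (P * d).
  by field; rewrite gt_eqF.
rewrite ler_wpM2r ?mulr_ge0 //; lra.
Qed.

Lemma bsum_weights (al be : nat) : (0 < al < 160)%N -> (0 < be < 160)%N ->
  bsum (fun v : nat * nat => (al%:R * rb) ^+ v.1 * (be%:R * rb) ^+ v.2)
    (((1 - al%:R * rb) * (1 - be%:R * rb))^-1).
Proof.
have h (c : nat) : (0 < c < 160)%N -> 0 <= c%:R * rb < 1.
  move=> /andP[c0 c1]; rewrite mulr_ge0 ?invr_ge0 //= /rb ltr_pdivrMr // mul1r.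
  by rewrite ltr_nat.
by move=> /h ha /h hb; rewrite invfM; exact: bsum_prod (bsum_geo ha) (bsum_geo hb).
Qed.

(** Polynomial coefficients are absorbed into the ratios, and (m + 1)(k + 1) - 1 >= m + k turns the
    double series into a product of two geometric series. *)
Lemma coef_bound (i j al be : nat) (v : nat * nat) :
  (forall m, m.+1 ^ i <= al ^ m)%N -> (forall k, k.+1 ^ j <= be ^ k)%N ->
  (v.1.+1 ^ i * v.2.+1 ^ j)%:R * rb ^+ (nidx v).-1 <= (al%:R * rb) ^+ v.1 * (be%:R * rb) ^+ v.2.
Proof.
move=> ha hb; case: v => m k /=; rewrite !exprMn mulrACA -!natrX -natrM.
have r0 : 0 <= rb by rewrite invr_ge0.
apply: ler_pM => //; first exact: exprn_ge0.
  by rewrite ler_nat leq_mul.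
have r1 : rb <= 1 by rewrite /rb; lra.
by rewrite -exprD ler_wiXn2l // /nidx /=; nia.
Qed.

End QSeries.

(** * Estimates for Phi, E2 and the numerator of p' *)

Section PhiEstimates.
Variable R : realType.
Local Notation C := R[i].
Local Notation r := (rb R).
Implicit Types (a b x : C).

Lemma rb_gt0 : 0 < r. Proof. by rewrite invr_gt0. Qed.
Lemma rb_lt1 : r < 1. Proof. by rewrite /rb; lra. Qed.

(** Coefficients of the iterated derivatives x d/dx of [Phi]: each derivative multiplies by the
    exponent (m + 1)(k + 1) and so raises both [i] and [j] by one, starting from (0, 1). *)
Definition pc_ (i j : nat) (v : nat * nat) : C := (v.1.+1 ^ i * v.2.+1 ^ j)%:R.

Lemma pow0 m : (m.+1 ^ 0 <= 1 ^ m)%N. Proof. by rewrite expn0 exp1n. Qed.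
Lemma pow1 m : (m.+1 ^ 1 <= 2 ^ m)%N. Proof. by rewrite expn1; exact: ltn_expl. Qed.
Lemma pow2 m : (m.+1 ^ 2 <= 4 ^ m)%N.
Proof. by rewrite (_ : 4 = 2 ^ 2)%N // -expnM mulnC expnM leq_exp2r // ltn_expl. Qed.
Lemma pow3 m : (m.+1 ^ 3 <= 8 ^ m)%N.
Proof. by rewrite (_ : 8 = 2 ^ 3)%N // -expnM mulnC expnM leq_exp2r // ltn_expl. Qed.

Definition geo2 (al be : nat) (v : nat * nat) : R := (al%:R * r) ^+ v.1 * (be%:R * r) ^+ v.2.
Definition geoS (al be : nat) : R := ((1 - al%:R * r) * (1 - be%:R * r))^-1.

Lemma geoS12 : geoS 1 2 = 160 / 159 * (80 / 79). Proof. by rewrite /geoS /rb; field. Qed.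
Lemma geoS24 : geoS 2 4 = 80 / 79 * (40 / 39). Proof. by rewrite /geoS /rb; field. Qed.
Lemma geoS48 : geoS 4 8 = 40 / 39 * (20 / 19). Proof. by rewrite /geoS /rb; field. Qed.

Lemma bsum_geo2 al be : (0 < al < 160)%N -> (0 < be < 160)%N -> bsum (geo2 al be) (geoS al be).
Proof. exact: bsum_weights. Qed.

(* Phi and F = x Phi'(x), with the derivative D = Phi'. *)
Definition Fq x : C := sum (fun v : nat * nat => pc_ 1 2 v * x ^+ nidx v).
Definition Dq x : C := sum (fun v : nat * nat => pc_ 1 2 v * x ^+ (nidx v).-1).

Lemma nidxS v : nidx v = (nidx v).-1.+1.
Proof. by case: v. Qed.

Lemma pc_norm i j v n x al be : normc x <= r -> n = (nidx v).-1 ->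
  (forall m, m.+1 ^ i <= al ^ m)%N -> (forall k, k.+1 ^ j <= be ^ k)%N ->
  normc (pc_ i j v * x ^+ n) <= geo2 al be v.
Proof.
move=> hx -> ha hb; rewrite normcM normcX normc_nat.
apply: le_trans (coef_bound R v ha hb); apply: ler_wpM2l => //.
by rewrite lerXn2r ?nnegrE ?normc_ge0 // ltW // rb_gt0.
Qed.

Lemma Dq_has_sum x : normc x <= r -> has_sum (fun v => pc_ 1 2 v * x ^+ (nidx v).-1) (Dq x).
Proof.
move=> hx; have [|s hs] := has_sum_ex (f := fun v => pc_ 1 2 v * x ^+ (nidx v).-1)
  (bsum_geo2 (isT : 0 < 2 < 160)%N (isT : 0 < 4 < 160)%N).
  by move=> v; apply: pc_norm => //; [exact: pow1|exact: pow2].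
by rewrite /Dq (has_sum_sum hs).
Qed.

Lemma Fq_has_sum x : normc x <= r -> has_sum (fun v => pc_ 1 2 v * x ^+ nidx v) (x * Dq x).
Proof.
move=> hx; apply: has_sum_ext (has_sumZ x (Dq_has_sum hx)) => v.
by rewrite [in RHS]nidxS exprS mulrCA.
Qed.

Lemma FqE x : normc x <= r -> Fq x = x * Dq x.
Proof. by move=> /Fq_has_sum/has_sum_sum. Qed.

Lemma Phi_has_sum' x : normc x <= r -> has_sum (fun v => pc_ 0 1 v * x ^+ nidx v) (Phi x).
Proof.
move=> hx; have x1 : normc x < 1 by apply: le_lt_trans hx rb_lt1.
by apply: has_sum_ext (Phi_has_sum x1) => v; rewrite /pc_ expn0 mul1n expn1.
Qed.

Lemma sum_le (f : nat * nat -> C) s (c : R) al be : (0 < al < 160)%N -> (0 < be < 160)%N ->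
  0 <= c -> has_sum f s -> (forall v, normc (f v) <= c * geo2 al be v) ->
  normc s <= c * geoS al be.
Proof.
move=> ha hb c0 hs hf; exact: has_sum_normB hs (bsum_scale c0 (bsum_geo2 ha hb)) hf.
Qed.

(** The index (0, 0) carries the linear term of the power series. Its weight is 1, so removing it
    leaves the total weight minus 1, which is small. *)
Lemma sum_tail_le (f : nat * nat -> C) s (c : R) al be : (0 < al < 160)%N -> (0 < be < 160)%N ->
  0 <= c -> has_sum f s -> (forall v, normc (f v) <= c * geo2 al be v) ->
  normc (s - f (0, 0)%N) <= c * (geoS al be - 1).
Proof.
move=> ha hb c0 hs hf; have z0 : geo2 al be (0, 0)%N = 1 by rewrite /geo2 !expr0 mulr1.
have hb' := bsum_scale c0 (bsum_D1 (0, 0)%N (bsum_geo2 ha hb)).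
rewrite z0 in hb'.
have h := has_sumB hs (has_sum1 (0, 0)%N (f (0, 0)%N)).
apply: has_sum_normB h hb' _ => v; case: eqVneq => [->|_].
  by rewrite subrr normc0 mulr0.
by rewrite subr0 hf.
Qed.

Lemma pc_lip i j v a b al be : normc a <= r -> normc b <= r ->
  (forall m, m.+1 ^ i.+1 <= al ^ m)%N -> (forall k, k.+1 ^ j.+1 <= be ^ k)%N ->
  normc (pc_ i j v * a ^+ nidx v - pc_ i j v * b ^+ nidx v) <= normc (a - b) * geo2 al be v.
Proof.
move=> ha hb hal hbe; rewrite -mulrBr normcM normc_nat [in a ^+ _]nidxS [in b ^+ _]nidxS.
apply: le_trans (ler_wpM2l _ (pow_diff _ ha hb)) _ => //.
rewrite -nidxS; have := ler_wpM2l (normc_ge0 (a - b)) (coef_bound R v hal hbe).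
apply: le_trans; rewrite le_eqVlt; apply/orP; left; apply/eqP.
rewrite /nidx [(v.1.+1 ^ i.+1)%N]expnS [(v.2.+1 ^ j.+1)%N]expnS !natrM; ring.
Qed.

Lemma Phi_small x : normc x <= r -> normc (Phi x) <= 1 / 150.
Proof.
move=> hx; apply: le_trans (sum_le (al := 1) (be := 2) isT isT (ltW rb_gt0) (Phi_has_sum' hx) _) _.
  move=> v; rewrite nidxS exprS mulrCA normcM; apply: ler_pM; rewrite ?normc_ge0 //.
  by apply: pc_norm => //; [exact: pow0|exact: pow1].
rewrite geoS12 /rb; lra.
Qed.

(** The linear coefficient of [Phi] is 1, and the higher terms have Lipschitz constant at most
    (80/79)(40/39) - 1 < 1/25. *)
Lemma Phi_tail_lip a b : normc a <= r -> normc b <= r ->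
  normc ((Phi a - Phi b) - (a - b)) <= normc (a - b) * (1 / 25).
Proof.
move=> ha hb; have h := has_sumB (Phi_has_sum' ha) (Phi_has_sum' hb).
have := sum_tail_le (al := 2) (be := 4) isT isT (normc_ge0 (a - b)) h
  (fun v => pc_lip v ha hb pow1 pow2).
rewrite /pc_ /nidx /= !expr1 !mul1r => h1; apply: le_trans h1 _.
rewrite ler_wpM2l ?normc_ge0 // geoS24; lra.
Qed.

Lemma Fq_tail_lip a b : normc a <= r -> normc b <= r ->
  normc ((Fq a - Fq b) - (a - b)) <= normc (a - b) * (2 / 25).
Proof.
move=> ha hb; rewrite !FqE //.
have h := has_sumB (Fq_has_sum ha) (Fq_has_sum hb).
have := sum_tail_le (al := 4) (be := 8) isT isT (normc_ge0 (a - b)) h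
  (fun v => pc_lip v ha hb pow2 pow3).
rewrite /pc_ /nidx /= !expr1 !mul1r => h1; apply: le_trans h1 _.
rewrite ler_wpM2l ?normc_ge0 // geoS48; lra.
Qed.

(** The quadratic remainder costs the square of the exponent, which raises the coefficient exponents
    from (0, 1) to (2, 3). *)
Lemma Phi_sder b : normc b < r -> sder (@Phi R) b (Dq b).
Proof.
move=> hb; have r0 := rb_gt0; exists (geoS 4 8 / r), (r - normc b); split.
- by rewrite divr_ge0 ?(ltW r0) // geoS48; lra.
- by rewrite subr_gt0.
move=> h hh; have hbr := ltW hb.
have ha : normc (b + h) <= r by have := normcD b h; lra.
have hs := has_sumB (has_sumB (Phi_has_sum' ha) (Phi_has_sum' hbr)) (has_sumZ h (Dq_has_sum hbr)).
rewrite [Dq b * h]mulrC.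
have E : geoS 4 8 / r * normc h ^+ 2 = normc h ^+ 2 / r * geoS 4 8 by ring.
have c0 : 0 <= normc h ^+ 2 / r by rewrite divr_ge0 ?exprn_ge0 ?normc_ge0 ?ltW.
rewrite E; apply: (sum_le (al := 4) (be := 8) _ _ c0 hs) => // v.
have -> : pc_ 0 1 v * (b + h) ^+ nidx v - pc_ 0 1 v * b ^+ nidx v -
    h * (pc_ 1 2 v * b ^+ (nidx v).-1) =
  pc_ 0 1 v * ((b + h) ^+ (nidx v).-1.+1 - b ^+ (nidx v).-1.+1 -
    (nidx v).-1.+1%:R * b ^+ (nidx v).-1 * (b + h - b)).
  have -> : pc_ 1 2 v = pc_ 0 1 v * (nidx v)%:R.
    by rewrite /pc_ /nidx -natrM; congr (_%:R); ring.
  by rewrite -!nidxS; ring.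
rewrite normcM normc_nat.
apply: le_trans (ler_wpM2l _ (pow_diff2 _ r0 ha hbr)) _ => //.
rewrite -nidxS (_ : b + h - b = h); last by ring.
have := ler_wpM2l c0 (coef_bound R v pow2 pow3).
apply: le_trans; rewrite le_eqVlt; apply/orP; left; apply/eqP.
by rewrite /nidx !natrM !natrX; ring.
Qed.

(** The numerator of p'. By Ramanujan's identity q dE2/dq = (E2^2 - E4) / 12 this is the Eisenstein
    series E4 = 1 + 240 q + ... *)
Definition Nq x : C := E2 x ^+ 2 + 288 * Fq x.

Lemma E2_near1 x : normc x <= r -> normc (E2 x - 1) <= 4 / 25.
Proof.
move=> hx; have -> : E2 x - 1 = - (24 * Phi x) by rewrite /E2; ring.
by rewrite normcN normcM normc_nat; have := Phi_small hx; lra.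
Qed.

Lemma E2_neq0 x : normc x <= r -> E2 x != 0.
Proof.
move=> hx; apply/eqP => h; have := E2_near1 hx.
by rewrite h sub0r normcN normc1; lra.
Qed.

(** The linear coefficient is 288 - 2 * 24 = 240. The remaining terms contribute 288 * 2/25, 48/25
    and 576 * (2/150) * (26/25), in total less than 33. *)
Lemma Nq_lip a b : normc a <= r -> normc b <= r ->
  normc (Nq a - Nq b - 240 * (a - b)) <= 33 * normc (a - b).
Proof.
move=> ha hb; have h1 := Phi_tail_lip ha hb; have h2 := Fq_tail_lip ha hb.
have h3 := Phi_small ha; have h4 := Phi_small hb; have n0 := normc_ge0 (a - b).
have -> : Nq a - Nq b - 240 * (a - b) = 288 * ((Fq a - Fq b) - (a - b)) -
   48 * ((Phi a - Phi b) - (a - b)) + 576 * ((Phi a + Phi b) * (Phi a - Phi b)).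
  rewrite /Nq /E2; have -> : (288 : C) = 12 * 24 by rewrite -natrM.
  have -> : (240 : C) = 10 * 24 by rewrite -natrM.
  have -> : (576 : C) = 24 * 24 by rewrite -natrM.
  have -> : (48 : C) = 2 * 24 by rewrite -natrM.
  move: (Phi a) (Phi b) (Fq a) (Fq b) (24 : C) => x y z w c; ring.
have h5 : normc (Phi a - Phi b) <= normc (a - b) * (26 / 25).
  by have := normcD ((Phi a - Phi b) - (a - b)) (a - b); rewrite subrK; clear -h1; lra.
have h6 : normc ((Phi a + Phi b) * (Phi a - Phi b)) <= (2 / 150) * (normc (a - b) * (26 / 25)).
  rewrite normcM ler_pM ?normc_ge0 //; have := normcD (Phi a) (Phi b); clear -h3 h4; lra.
apply: le_trans (normcD _ _) _; have := normcB (288 * ((Fq a - Fq b) - (a - b)))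
  (48 * ((Phi a - Phi b) - (a - b))).
rewrite (normcM 288) (normcM 48) (normcM 576) !normc_nat; clear -h1 h2 h6 n0; lra.
Qed.

End PhiEstimates.

(** * Numerical bounds, the derivative of p, and its zero at rho *)

Section PcDerivative.
Variable R : realType.
Local Notation C := R[i].
Local Notation pic := ((pi : R)%:C).
Local Notation c2pi := (2 * pic * 'i%C : C).
Local Notation r := (rb R).
Implicit Types (t z w : C).

(** For s = sin(pi/6) the triple angle formula at pi/2 reads 3 s - 4 s^3 = 1, that is (s + 1)(2 s -
    1)^2 = 0; so s = 1/2, and sin x <= x gives the bound. *)
Lemma pi_ge3 : 3 <= pi :> R.
Proof.
have p0 := pi_gt0 R; pose u : R := pi / 6.
have E : pi / 2 = (u *+ 2) + u by rewrite /u -mulr_natr; field.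
have := sin_pihalf R; rewrite E sinD sin_mulr2n cos_mulr2n cos2sin2 !mulr2n.
have := cos2sin2 u; rewrite expr2 => c2; set s := sin u.
have s0 : 0 < s by apply: sin_gt0_pihalf; rewrite divr_gt0 //= /u; lra.
move=> E1; have E2 : 3 * s - 4 * s ^+ 3 = 1.
  rewrite -[RHS]E1; have -> : (cos u * s + cos u * s) * cos u = 2 * s * (cos u * cos u) by ring.
  by rewrite c2 -/s; ring.
have /eqP : (s + 1) * (2 * s - 1) ^+ 2 = 0.
  have -> : (s + 1) * (2 * s - 1) ^+ 2 = 1 - (3 * s - 4 * s ^+ 3) by ring.
  by rewrite E2 subrr.
rewrite mulf_eq0 sqrf_eq0 gt_eqF /=; last by lra.
move=> /eqP h; have := norm_sin_le u; rewrite -/s !ger0_norm ?(ltW s0) //.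
  by rewrite /u; lra.
by rewrite divr_ge0 // ltW.
Qed.

Lemma expR_ge2 (x : R) : 0 <= x -> 1 + x + x ^+ 2 / 2 <= expR x.
Proof.
move=> x0.
have h (y : R) : is_derive y 1 (fun z : R => expR z - 1 - z - z ^+ 2 / 2) (expR y - 1 - y).
  have h1 : is_derive y 1 (fun z : R => expR z - 1 - z) (expR y - 0 - 1) by apply: is_deriveB.
  have h2 : is_derive y 1 (fun z : R => z ^+ 2 / 2) y.
    have hid : is_derive y (1 : R) (@id R) 1 by exact: is_derive_id.
    rewrite (_ : (fun z : R => _) = 2^-1 \*: ((@id R) ^+ 2)); last first.
      by apply/funext => z; rewrite /GRing.scale /= !expr2 mulrC.
    apply: is_derive_eq (is_deriveZ (2^-1 : R) (is_deriveX 2 hid)) _.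
    by rewrite /GRing.scale /= expr1 mulr1 mulrA mulVf ?mul1r // pnatr_eq0.
  by apply: is_derive_eq (is_deriveB h1 h2) _; rewrite subr0.
have [c cx] := mvt0 x h; rewrite expR0 expr0n /= mul0r !subr0 subrr => E.
have := mulr_ge0 (_ : 0 <= expR c - 1 - c) x0; rewrite -E.
by have := expR_ge1Dx c => h1 h2; have := h2 ltac:(lra); lra.
Qed.

(** The quadratic Taylor bound at 4/25 is squared five times, with rational lower bounds rounded at
    each stage. *)
Lemma expR_big : 160 < expR (128 / 25) :> R.
Proof.
have h0 : expR (128 / 25) = expR (4 / 25 : R) ^+ 32.
  by rewrite -expRM_natl; congr expR; field.
have h1 : 129 / 110 <= expR (4 / 25) :> R.
  have := @expR_ge2 (4 / 25) ltac:(lra); lra.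
have step (a b x : R) : 0 <= a -> b <= a ^+ 2 -> a <= x -> b <= x ^+ 2.
  move=> a0 ab ax; apply: le_trans ab _.
  by rewrite ler_pXn2r ?nnegrE //; apply: le_trans ax.
rewrite h0 (_ : 32 = 2 * (2 * (2 * (2 * 2))))%N // !exprM.
move: (expR _) h1 => x h1.
have k1 : 11 / 8 <= x ^+ 2 by apply: step h1; rewrite ?expr2; lra.
have k2 : 189 / 100 <= (x ^+ 2) ^+ 2 by apply: step k1; rewrite ?expr2; lra.
have k3 : 25 / 7 <= ((x ^+ 2) ^+ 2) ^+ 2 by apply: step k2; rewrite ?expr2; lra.
have k4 : 51 / 4 <= (((x ^+ 2) ^+ 2) ^+ 2) ^+ 2 by apply: step k3; rewrite ?expr2; lra.
have k5 : 161 <= ((((x ^+ 2) ^+ 2) ^+ 2) ^+ 2) ^+ 2 by apply: step k4; rewrite ?expr2; lra.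
lra.
Qed.

Lemma qe_small t : 43 / 50 <= Im t -> normc (qe t) < r.
Proof.
move=> h; rewrite normc_qe expRN ltf_pV2 ?posrE ?expR_gt0 //.
apply: lt_le_trans expR_big _; rewrite ler_expR.
have p3 := pi_ge3; have : 3 * Im t <= pi * Im t by rewrite ler_wpM2r //; lra.
lra.
Qed.

(** The finite value of p where |q| <= 1/160, since E2 has no zero there. *)
Definition pc t : C := t - c2pi / G2 t.
Definition pd t : C := Nq (qe t) / E2 (qe t) ^+ 2.

Lemma pic_neq0 : pic != 0 :> C.
Proof. by rewrite -normc_gt0 normc_real normr_gt0 gt_eqF ?pi_gt0. Qed.

Lemma G2_neq0 t : normc (qe t) <= r -> G2 t != 0.
Proof.
move=> /(@E2_neq0 R) h; have p0 := pic_neq0.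
by rewrite /G2 !mulf_neq0 ?invr_eq0 ?expf_neq0 ?pnatr_eq0.
Qed.

Lemma p_pc t : 0 < Im t -> normc (qe t) <= r -> p t = Some (pc t).
Proof.
move=> t0 /G2_neq0 g0; rewrite pE // (negbTE g0); congr Some.
by rewrite /pc mulrBl mulfK.
Qed.

Lemma ciC : 'i%C * 'i%C = -1 :> C. Proof. by rewrite -expr2 sqr_i. Qed.

Lemma pcE t : normc (qe t) <= r -> pc t = t + (- (6 * 'i%C / pic)) * (E2 (qe t))^-1.
Proof.
move=> h; rewrite /pc /G2; have p0 := pic_neq0; have e0 := E2_neq0 h.
by move: (E2 (qe t)) ('i%C : C) pic e0 p0 => e i P e0 P0; field; rewrite P0 e0.
Qed.

Lemma sder_qe t : sder (@qe R) t (c2pi * qe t).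
Proof.
have h1 : sder (fun x : C => c2pi * x) t (c2pi * 1) by exact: sderZ (sder_id _).
rewrite mulrC -{1}[c2pi]mulr1; exact: (sder_comp h1 (sder_cexp _)).
Qed.

Lemma pc_sder t : normc (qe t) < r -> sder pc t (pd t).
Proof.
move=> h; have hr := ltW h; have e0 := E2_neq0 hr; have p0 := pic_neq0.
have h1 : sder (@E2 R) (qe t) (- (24 * Dq (qe t))).
  have := sderD (sder_cst 1 (qe t)) (sderZ (- 24) (Phi_sder h)); rewrite add0r mulNr.
  by apply: sder_ext; exists 1 => // x _; rewrite /E2 mulNr.
have h2 := sder_comp (sder_comp (sder_qe t) h1) (sder_inv e0).
have h3 := sderD (sder_id t) (sderZ (- (6 * 'i%C / pic)) h2).
(* The chain rule for t - (6 i / pi) / E2(q). The constants combine to 6 * 2 * 24 = 288, with i^2 =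
   -1 fixing the sign. *)
suff E : pd t = 1 + - (6 * 'i%C / pic) * (- (E2 (qe t) ^+ 2)^-1 * (- (24 * Dq (qe t)) * (c2pi * qe t))).
  rewrite E; apply: sder_ext h3; have [K [e [K0 e1 hK]]] := sder_lip (sder_qe t).
  exists (Num.min e ((r - normc (qe t)) / K)); first by rewrite lt_min e1 divr_gt0 // subr_gt0.
  move=> x; rewrite le_min ler_pdivlMr // => /andP[x1 x2] /=.
  rewrite pcE //; have := hK _ x1; have := normcD (qe (t + x) - qe t) (qe t).
  by rewrite subrK; lra.
rewrite /pd /Nq FqE //.
have e24 : (288 : C) = 12 * 24 by rewrite -natrM.
rewrite e24; have := ciC; move: (qe t) (Dq (qe t)) (E2 (qe t)) e0 => q D e e0.
move: ('i%C : C) pic p0 (24 : C) => i P P0 c ii.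
transitivity (1 - (6 * 2) * c * D * q * (i * i) / e ^+ 2); last by field; rewrite e0 P0.
by rewrite ii -natrM; field.
Qed.

Definition rho : C := 2^-1 +i* (Num.sqrt 3 / 2).

Lemma sqrt3_bounds : 43 / 25 < Num.sqrt (3 : R) < 9 / 5.
Proof.
have s2 : Num.sqrt 3 ^+ 2 = 3 :> R by rewrite sqr_sqrtr.
have s0 : 0 <= Num.sqrt 3 :> R := sqrtr_ge0 _.
by apply/andP; split; rewrite ltNge; apply/negP => h; nra.
Qed.

Lemma sqrt3_sqr : Num.sqrt 3 ^+ 2 = 3 :> R. Proof. by rewrite sqr_sqrtr. Qed.

Lemma rho_neq0 : rho != 0.
Proof. by rewrite eq_complex /= negb_and invr_eq0 pnatr_eq0. Qed.

Lemma rho_quad : rho ^+ 2 = rho - 1.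
Proof.
have := sqrt3_sqr; rewrite expr2 => s2.
by apply: eqReIm; rewrite expr2 !cE /=; [rewrite mulf_div s2|]; field.
Qed.

Lemma rho_fix : 1 - rho^-1 = rho.
Proof.
have h := rho_quad; have r0 := rho_neq0.
by apply: (mulIf r0); rewrite mulrBl mul1r mulVf // -expr2 h.
Qed.

Lemma rho_small : normc (qe rho) < r.
Proof. by apply: qe_small; rewrite /rho /=; have /andP[] := sqrt3_bounds; lra. Qed.

Lemma c2pi_neq0 : c2pi != 0.
Proof. by rewrite -normc_gt0 -mulrA normcM normc_nat normc_pii mulr_gt0 // pi_gt0. Qed.

(** Two generating reflections fix rho, so p(rho) lies on the circles Re w = 1/2 and |w| = 1 and is
    rho or its conjugate. It is not rho because p(t) - t = -2 pi i / G2(t) never vanishes here. *)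
Lemma pc_rho : pc rho = conjc rho.
Proof.
have hr := ltW rho_small; have r0 : 0 < Im rho.
  by rewrite /rho /= divr_gt0 // sqrtr_gt0.
have P : pbar (Some rho) = Some (conjc (pc rho)) by rewrite /= p_pc.
have f1 : reflection (T0_circle R 1) (Some rho) = Some rho.
  by rewrite refl1E /=; congr Some; apply: eqReIm; rewrite !cE /=; field.
have f0 : reflection (T0_circle R 0) (Some rho) = Some rho.
  have -> : reflection (T0_circle R 0) (Some rho) = Some (conjc (rho^-1)).
    by rewrite refl0E /sinv (negbTE rho_neq0).
  have -> : rho^-1 = 1 - rho by rewrite -{2}rho_fix; ring.
  by congr Some; apply: eqReIm; rewrite !cE /=; field.
have := pbar_refl 1 r0; rewrite f1 P refl1E /= => -[e1].
have := pbar_refl 0 r0; rewrite f0 P refl0E /= conjc_eq0.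
case: eqP => //= w0 [e0].
set w := pc rho in P e1 w0 e0 *; have wr : w != rho.
  rewrite /w /pc subr_eq addrC -subr_eq subrr eq_sym mulf_neq0 ?c2pi_neq0 //.
  by rewrite invr_eq0 G2_neq0.
clearbody w.
have x2 : Re w = 2^-1.
  by have := congr1 (@complex.Re R) e1; rewrite !cE /=; lra.
have n1 : normc w ^+ 2 = 1.
  have n0 : normc w != 0 by rewrite normc_eq0; apply/eqP.
  have := congr1 (@normc R) e0; rewrite !normcJ' normcV normcJ' => h.
  by rewrite expr2 {1}h mulVf.
have y2 : Im w ^+ 2 = 3 / 4 by move: n1; rewrite sqr_normcE x2 exprVn -natrX; lra.
have := sqrt3_sqr; set s := Num.sqrt 3 => s2.
have /eqP : (Im w - s / 2) * (Im w + s / 2) = 0.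
  have -> : (Im w - s / 2) * (Im w + s / 2) = Im w ^+ 2 - s ^+ 2 / 4 by field.
  by rewrite y2 s2; lra.
rewrite mulf_eq0 subr_eq0 addr_eq0 => /orP[/eqP y|/eqP y].
  by move/eqP: wr; case; apply: eqReIm.
by apply: eqReIm; rewrite /= ?x2 ?y.
Qed.

(** Both sides of p(1 - 1/t) = 1 - 1/p(t) are differentiated at the fixed point rho. As p(rho) is
    the conjugate of rho, the factors of p'(rho) are rho^-2 and its conjugate, which differ. *)
Lemma pd_rho : pd rho = 0.
Proof.
have hr := rho_small; have r0 := rho_neq0; have h1 := sder_inv r0.
have hS : sder (fun t : C => 1 - t^-1) rho (rho ^+ 2)^-1.
  have := sderD (sder_cst 1 rho) (sderZ (-1) h1); rewrite add0r mulN1r opprK.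
  by apply: sder_ext; exists 1 => // h _; rewrite mulN1r.
have hL : sder (fun t => pc (1 - t^-1)) rho (pd rho * (rho ^+ 2)^-1).
  have := sder_comp hS (_ : sder pc (1 - rho^-1) (pd rho)); apply.
  by rewrite rho_fix; exact: pc_sder.
have pn0 : pc rho != 0 by rewrite pc_rho conjc_eq0.
have hR : sder (fun t => 1 - (pc t)^-1) rho ((conjc rho ^+ 2)^-1 * pd rho).
  have h2 := sder_comp (pc_sder hr) (sder_inv pn0).
  have := sderD (sder_cst 1 rho) (sderZ (-1) h2); rewrite add0r mulN1r mulNr opprK pc_rho.
  by apply: sder_ext; exists 1 => // h _; rewrite mulN1r.
have hE : exists2 e : R, 0 < e & forall h, normc h <= e ->
    pc (1 - (rho + h)^-1) = 1 - (pc (rho + h))^-1.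
  have [K [e [K0 e0 hK]]] := sder_lip hS.
  have /andP[s1 s2] := sqrt3_bounds.
  pose y := Num.sqrt 3 / 2 - 43 / 50 : R; have y0 : 0 < y by rewrite /y; lra.
  exists (Num.min e (Num.min y (y / K))); first by rewrite !lt_min e0 y0 divr_gt0.
  move=> h; rewrite !le_min => /andP[h1' /andP[h2 h3]].
  have hh := hK _ h1'; rewrite rho_fix in hh.
  have i1 : 43 / 50 <= Im (rho + h).
    by rewrite cImD /=; have := Im_le_normc h; rewrite ler_norml /y in h2 *; lra.
  have i2 : 43 / 50 <= Im (1 - (rho + h)^-1).
    have -> : 1 - (rho + h)^-1 = rho + (1 - (rho + h)^-1 - rho) by ring.
    rewrite cImD /=; have := Im_le_normc (1 - (rho + h)^-1 - rho).
    by move: h3; rewrite ler_pdivlMr // ler_norml /y; lra.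
  have q1 := ltW (qe_small i1); have q2 := ltW (qe_small i2).
  have p1 : 0 < Im (rho + h) by lra.
  have p2 : 0 < Im (1 - (rho + h)^-1) by lra.
  have := p_pc p2 q2; rewrite addrC pJ_D1 ?Im_invN // p_inv // p_pc //=.
  by case: eqP => //= _ [<-]; rewrite addrC.
have E := sder_uniq (sder_ext hE hL) hR.
have h2 : (rho ^+ 2)^-1 - (conjc rho ^+ 2)^-1 != 0.
  rewrite subr_eq0 (inj_eq invr_inj) rho_quad; apply/eqP => /(congr1 (@complex.Im R)).
  rewrite expr2 !cE /=; have /andP[] := sqrt3_bounds; lra.
apply: (mulIf h2); rewrite mul0r mulrBr E; ring.
Qed.

End PcDerivative.

(** * Univalence on the strip *)

Section Univalence.
Variable R : realType.
Local Notation C := R[i].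
Local Notation r := (rb R).
Local Notation rho := (rho R).
Local Notation s3 := (Num.sqrt (3 : R)).
Implicit Types (t z w a b : C).

(** A convex set containing the finite part of T0, with rho as a corner. *)
Definition strip t : Prop := 0 <= Re t <= 2^-1 /\ s3 / 2 <= Im t.

Lemma strip_small t : strip t -> normc (qe t) < r.
Proof. by move=> [_ h]; apply: qe_small; have /andP[] := sqrt3_bounds R; lra. Qed.

Lemma qeE t : qe t = (expR (- (2 * pi * Im t)))%:C * (cos (2 * pi * Re t) +i* sin (2 * pi * Re t)).
Proof. by rewrite /qe qe_arg. Qed.

Lemma qe_rho : qe rho = (- expR (- (pi * s3)))%:C.
Proof.
rewrite qeE /= (_ : 2 * pi * 2^-1 = pi); last by field.
rewrite cospi sinpi (_ : 2 * pi * (s3 / 2) = pi * s3); last by field.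
by apply: eqReIm; rewrite !cE /=; ring.
Qed.

(** q(rho) is a negative real number of the largest modulus that q attains on the strip, which gives
    the real part; the argument of q lies in [0, pi], which gives the imaginary part. *)
Lemma strip_q t : strip t -> 0 <= Re (qe t - qe rho) /\ 0 <= Im (qe t - qe rho).
Proof.
move=> [/andP[x0 x1] y0]; have p0 := pi_gt0 R.
have s0 : 0 <= sin (2 * pi * Re t).
  apply: sin_ge0_pi; rewrite !mulr_ge0 ?pi_ge0 //=.
  have : pi * Re t <= pi * 2^-1 by rewrite ler_pM2l.
  lra.
have e0 := expR_gt0 (- (2 * pi * Im t)).
rewrite cReD cImD cReN cImN qe_rho qeE cReM cImM /=; split; last first.
  by rewrite mul0r subr0 addr0 mulr_ge0 // ltW.
rewrite mul0r subr0 opprK.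
have h : expR (- (2 * pi * Im t)) <= expR (- (pi * s3)).
  rewrite ler_expR lerN2; have : pi * (s3 / 2) <= pi * Im t by rewrite ler_pM2l.
  lra.
have := ler_wpM2l (ltW e0) (cos_geN1 (2 * pi * Re t)); lra.
Qed.

Lemma strip_rho t : strip t -> qe t = qe rho -> t = rho.
Proof.
move=> [/andP[x0 x1] y0] E.
have : qe (t - rho) = 1 by rewrite qeD qeN E divff // qe_neq0.
move=> /qe_eq1[n En]; have := congr1 (@complex.Re R) En; have := congr1 (@complex.Im R) En.
rewrite Reint Imint !cE /= => h1 h2.
have n0 : n = 0.
  have a1 : n%:~R < (1%:~R : R) by lra.
  have a2 : (-1)%:~R < (n%:~R : R) by rewrite mulrNz; lra.
  move: a1 a2; rewrite !ltr_int; lia.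
by apply: eqReIm => /=; move: h1 h2; rewrite n0; lra.
Qed.

Lemma Nq_rho : Nq (qe rho) = 0.
Proof.
have := pd_rho R; rewrite /pd => /eqP; rewrite mulf_eq0 invr_eq0 expf_eq0 /=.
by rewrite (negbTE (E2_neq0 (ltW (rho_small R)))) orbF => /eqP.
Qed.

(* With X = q - q(rho) in the first quadrant, N(q) = 240 X + O(33 |X|). *)
Lemma pd_pos t : strip t -> t != rho -> 0 < Re (pd t) + Im (pd t).
Proof.
move=> ht tr; have [X1 X2] := strip_q ht.
have hq := ltW (strip_small ht); have hr := ltW (rho_small R).
have X0 : qe t - qe rho != 0.
  by rewrite subr_eq0; apply: contra tr => /eqP /(strip_rho ht) ->.
have hN := Nq_lip hq hr; rewrite Nq_rho subr0 in hN.
have hE := E2_near1 hq; have e0 := E2_neq0 hq; rewrite /pd.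
move: (qe t - qe rho) (Nq (qe t)) (E2 (qe t)) X0 X1 X2 hN hE e0 => X N e X0 X1 X2 hN hE e0.
have n0 : 0 < normc X by rewrite normc_gt0.
have XX : normc X <= Re X + Im X by have := normc_le_ReIm X; rewrite !ger0_norm.
have ne : 0 < normc e by rewrite normc_gt0.
(* 1 / e^2 = conj(e)^2 / |e|^4, and the positive factor |e|^-4 does not affect the sign. *)
have [Y EY] : exists Y, Y = N * conjc e ^+ 2 by eexists.
have E : N / e ^+ 2 = Y * ((normc e ^+ 4)^-1)%:C.
  have Ee : e * conjc e = (normc e ^+ 2)%:C.
    by rewrite sqr_normcE; case: (e) => x y; apply: eqReIm => /=; ring.
  have c0 : conjc e != 0 by rewrite conjc_eq0.
  have -> : ((normc e ^+ 4)^-1)%:C = ((e * conjc e) ^+ 2)^-1.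
    by rewrite Ee -(rmorphXn (real_complex R)) -(fmorphV (real_complex R)) -exprM.
  by rewrite EY; field; rewrite c0 e0.
rewrite E cReM cImM /= !mulr0 subr0 add0r -mulrDl mulr_gt0 ?invr_gt0 ?exprn_gt0 //.
(* Y = 240 X + Z with |Z| <= (273 * 7/20 + 33) |X| <= 140 |X|. As |1 - i| <= 3/2, the loss is at
   most 210 |X|, while Re X + Im X >= |X|. *)
have [Z EZ] : exists Z, Z = Y - 240 * X by eexists.
have hc : normc (conjc e ^+ 2 - 1) <= 7 / 20.
  have -> : conjc e ^+ 2 - 1 = conjc ((e - 1) * (e - 1) + 2 * (e - 1)).
    by rewrite cJD !cJM cJD cJN cJ1 cJnat; ring.
  rewrite normcJ'; apply: le_trans (normcD _ _) _; rewrite !normcM normc_nat.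
  have := ler_pM (normc_ge0 _) (normc_ge0 _) hE hE; lra.
have hN' : normc N <= 273 * normc X.
  by have := normcD (N - 240 * X) (240 * X); rewrite subrK (normcM 240) normc_nat; lra.
have hZ : normc Z <= 140 * normc X.
  have -> : Z = N * (conjc e ^+ 2 - 1) + (N - 240 * X) by rewrite EZ EY; ring.
  apply: le_trans (normcD _ _) _; rewrite normcM.
  have := ler_pM (normc_ge0 _) (normc_ge0 _) hN' hc; lra.
have hW : normc ((1 -i* 1) * Z) <= 3 / 2 * normc Z.
  rewrite normcM ler_wpM2r ?normc_ge0 //; apply: normc_le; rewrite /=; lra.
have := Re_le_normc ((1 -i* 1) * Z); rewrite !cE /= ler_norml => /andP[h1 _].
have -> : Re Y + Im Y = 240 * (Re X + Im X) + (Re Z + Im Z).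
  by rewrite EZ !cE !mul0r; ring.
have := normc_ge0 Z; lra.
Qed.

Lemma pd_neq0 t : strip t -> t != rho -> pd t != 0.
Proof.
by move=> ht tr; apply: contraTneq (pd_pos ht tr) => ->; rewrite addr0 ltxx.
Qed.

Lemma is_derive_quad (f : R -> R) (x d : R) :
  (exists K e : R, 0 < e /\ forall h, `|h| <= e -> `|f (x + h) - f x - d * h| <= K * h ^+ 2) ->
  is_derive x 1 f d.
Proof.
move=> [K [e [e0 hK]]].
have h : (fun h => h^-1 *: ((f \o shift x) (h *: (1 : R)) - f x)) @ 0^' --> d.
  apply/cvgrPdist_lt => eps eps0; near=> h.
  have h0 : h != 0 by near: h; exact: nbhs_dnbhs_neq.
  have nh : 0 < `|h| by rewrite normr_gt0.
  have he : `|h| <= e.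
    near: h; apply: dnbhs0_le => //.
  have h2 : `|h| < eps / (`|K| + 1).
    by near: h; apply: dnbhs0_lt; rewrite divr_gt0 // ltr_wpDl.
  rewrite /= /GRing.scale /= mulr1 distrC.
  have -> : h^-1 * (f (h + x) - f x) - d = h^-1 * (f (x + h) - f x - d * h).
    by rewrite [h + x]addrC; field.
  rewrite normrM normfV mulrC ltr_pdivrMr //; apply: le_lt_trans (hK _ he) _.
  rewrite -[h ^+ 2]real_normK ?num_real // expr2 mulrA ltr_pM2r //.
  rewrite ltr_pdivlMr ?ltr_wpDl // in h2.
  apply: le_lt_trans h2; rewrite [K * _]mulrC ler_wpM2l // (le_trans (ler_norm _)) //.
  by rewrite lerDl.
split; last exact: cvg_lim h.
by apply/cvg_ex; exists d.
Unshelve. all: by end_near. Qed.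

Lemma strip_conv a b (s : R) : strip a -> strip b -> 0 <= s <= 1 ->
  strip (a + s%:C * (b - a)).
Proof.
move=> [/andP[a1 a2] a3] [/andP[b1 b2] b3] /andP[s0 s1].
rewrite /strip !cE /= !mul0r subr0 addr0.
have h0 : 0 <= 1 - s by lra.
have k1 := mulr_ge0 h0 a1; have k2 := mulr_ge0 s0 b1.
have k3 := ler_wpM2l h0 a2; have k4 := ler_wpM2l s0 b2.
have k5 := ler_wpM2l h0 a3; have k6 := ler_wpM2l s0 b3.
split; last by lra.
by apply/andP; split; lra.
Qed.

(* The segment [a, b] stays in the strip and meets its corner rho at most at
   an end point, and Re ((1 - i) p') > 0 elsewhere. *)
Lemma pc_inj a b : strip a -> strip b -> pc a = pc b -> a = b.
Proof.
move=> ha hb E; apply/eqP; apply/negP => /negP ab.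
have ba0 : b - a != 0 by rewrite subr_eq0 eq_sym.
(* Division by b - a makes the derivative along the segment (1 - i) p', whose real part is Re p' +
   Im p'. *)
pose g (s : R) : C := (1 -i* 1) * (pc (a + s%:C * (b - a)) / (b - a)).
have der (s : R) : 0 <= s <= 1 ->
    is_derive s 1 (fun s => Re (g s)) (Re ((1 -i* 1) * pd (a + s%:C * (b - a)))).
  move=> hs; have := pc_sder (strip_small (strip_conv ha hb hs)).
  set z := a + _; move=> [K [e [K0 e0 hK]]]; apply: is_derive_quad.
  have nb : 0 < normc (b - a) by rewrite normc_gt0.
  exists (normc (1 -i* 1 : C) * K * normc (b - a)), (e / normc (b - a)).
  split; first by rewrite divr_gt0.
  move=> h; rewrite ler_pdivlMr // => hh.
  have nh : normc (h%:C * (b - a)) <= e by rewrite normcM normc_real.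
  have := hK _ nh.
  have -> : z + h%:C * (b - a) = a + (s + h)%:C * (b - a).
    by rewrite /z rmorphD /=; ring.
  set k := _ - _ - _ => hk.
  have -> : Re (g (s + h)) - Re (g s) - Re ((1 -i* 1) * pd z) * h =
      Re ((1 -i* 1) * (k / (b - a))).
    have -> : Re ((1 -i* 1) * pd z) * h = Re ((1 -i* 1) * pd z * h%:C).
      by rewrite [in RHS]cReM /= mulr0 subr0.
    rewrite -!cReN -!cReD; congr complex.Re; rewrite /g /k -/z.
    by move: (1 -i* 1) (pc _) (pc z) (pd z) => c u v d; field; rewrite subr_eq0 eq_sym.
  apply: le_trans (Re_le_normc _) _; rewrite normcM (normcM k) normcV.
  have hh2 : h ^+ 2 = `|h| ^+ 2 by rewrite real_normK ?num_real.
  have -> : normc (1 -i* 1 : C) * K * normc (b - a) * h ^+ 2 =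
      normc (1 -i* 1 : C) * (K * (`|h| * normc (b - a)) ^+ 2 / normc (b - a)).
    by rewrite hh2; move: (normc (1 -i* 1)) => c; field; rewrite gt_eqF.
  apply: ler_wpM2l; first exact: normc_ge0.
  apply: ler_wpM2r; first by rewrite invr_ge0 ltW.
  by move: hk; rewrite normcM normc_real.
have der' (s : R) : s \in `]0, 1[ -> is_derive s 1 (fun s => Re (g s))
   (Re ((1 -i* 1) * pd (a + s%:C * (b - a)))).
  by rewrite in_itv /= => /andP[s0 s1]; apply: der; rewrite !ltW.
have cont : {within `[0, 1], continuous (fun s => Re (g s))}.
  apply: derivable_within_continuous => s; rewrite in_itv /= => hs.
  by have := der s hs; move=> hd; exact: ex_derive.
have [s s01] := MVT ltr01 der' cont.
have -> : Re (g 1) - Re (g 0) = 0.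
  rewrite /g mul0r addr0 mul1r (_ : a + (b - a) = b); last by ring.
  by rewrite E subrr.
rewrite subr0 mulr1 => H; move: s01; rewrite in_itv /= => /andP[s0 s1].
have hs : 0 <= s <= 1 by rewrite !ltW.
(* A convex combination with positive weights attains the largest real part and the smallest
   imaginary part of the strip only if both end points do, so a and b would coincide. *)
have zr : a + s%:C * (b - a) != rho.
  apply: contraNneq ab => hz.
  have := congr1 (@complex.Re R) hz; have := congr1 (@complex.Im R) hz.
  rewrite !cE /= !mul0r subr0 addr0 => i1 i2.
  case: ha hb => [/andP[a1 a2] a3] [/andP[b1 b2] b3].
  have s0' : 0 < 1 - s by lra.
  have m1 : (1 - s) * (2^-1 - Re a) = 0.
    have := mulr_ge0 (ltW s0') (_ : 0 <= 2^-1 - Re a).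
    have := mulr_ge0 (ltW s0) (_ : 0 <= 2^-1 - Re b).
    move=> /(_ ltac:(lra)) j1 /(_ ltac:(lra)) j2; lra.
  have m2 : s * (2^-1 - Re b) = 0 by lra.
  have m3 : (1 - s) * (Im a - s3 / 2) = 0.
    have := mulr_ge0 (ltW s0') (_ : 0 <= Im a - s3 / 2).
    have := mulr_ge0 (ltW s0) (_ : 0 <= Im b - s3 / 2).
    move=> /(_ ltac:(lra)) j1 /(_ ltac:(lra)) j2; lra.
  have m4 : s * (Im b - s3 / 2) = 0 by lra.
  move/eqP: m1; rewrite mulf_eq0 gt_eqF //= => /eqP m1.
  move/eqP: m2; rewrite mulf_eq0 gt_eqF //= => /eqP m2.
  move/eqP: m3; rewrite mulf_eq0 gt_eqF //= => /eqP m3.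
  move/eqP: m4; rewrite mulf_eq0 gt_eqF //= => /eqP m4.
  by apply/eqP/eqReIm; lra.
have := pd_pos (strip_conv ha hb hs) zr.
move: H; rewrite cReM /= mul1r mulN1r opprK; lra.
Qed.

End Univalence.

(** * Local surjectivity at points with nonzero derivative, and connectedness *)

Section OpenMapping.
Variable R : realType.
Local Notation C := R[i].
Implicit Types (f g : C -> C) (z d h w s t : C).

Lemma continuousC_at (T : topologicalType) (f : T -> C) (x : T) :
  {for x, continuous (fun y => Re (f y))} -> {for x, continuous (fun y => Im (f y))} ->
  {for x, continuous f}.
Proof.
move=> h1 h2 U /nbhsC[e e0 hU].
have e2 : 0 < e / 2 by rewrite divr_gt0.
have k1 : nbhs x [set y | ball (Re (f x)) (e / 2) (Re (f y))] by exact/h1/nbhsx_ballx.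
have k2 : nbhs x [set y | ball (Im (f x)) (e / 2) (Im (f y))] by exact/h2/nbhsx_ballx.
change (nbhs x (f @^-1` U)); refine (filterS _ (filterI k1 k2)) => y [/=]; rewrite -!ball_normE /= => b1 b2.
apply: hU; apply: le_lt_trans (normc_le_ReIm _) _; rewrite !cE [ltRHS]splitr.
by rewrite ltrD // distrC.
Qed.

Lemma continuous_epsC f t : {for t, continuous f} <->
  forall e : R, 0 < e -> exists2 r : R, 0 < r & forall s, normc (s - t) < r -> normc (f s - f t) < e.
Proof.
split=> [h e e0|h U /nbhsC[e e0 hU]].
  have : nbhs (f t) [set w | normc (w - f t) < e] by apply/nbhsC; exists e.
  by move=> /h /nbhsC.
by have [r r0 hr] := h e e0; apply/nbhsC; exists r => // s /hr /hU.
Qed.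

Lemma sder_continuous f t d : sder f t d -> {for t, continuous f}.
Proof.
move=> /sder_lip[K [e [K0 e0 hK]]]; apply/continuous_epsC => x x0.
exists (Num.min e (x / K)); first by rewrite lt_min e0 divr_gt0.
move=> s; rewrite lt_min ltr_pdivlMr // => /andP[h1 h2].
have := hK (s - t) (ltW h1); rewrite subrKC; lra.
Qed.

Lemma closed_disk z (r : R) : closed [set s : C | normc (s - z) <= r].
Proof.
apply: closedC_norm; apply: (continuousC_lip (K := 1)) => a b.
rewrite mul1r; have h1 := normc_triangle b a z; have h2 := normc_triangle a b z.
have h3 := normcBC a b; rewrite ler_norml; lra.
Qed.

Lemma compact_diskC z (r : R) : compact [set s : C | normc (s - z) <= r].
Proof.
apply: (subclosed_compact _ (@compact_disk R (r + normc z))); first exact: closed_disk.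
by move=> w /= h; have := normcD (w - z) z; rewrite subrK; lra.
Qed.

(** The distance |f - w| is minimised over a small closed disk. The minimum is not on the rim, and
    at an interior point a nonzero minimum could be lowered by a Newton step. *)
Lemma open_sder f t (e0 : R) : 0 < e0 ->
  (forall s, normc (s - t) <= e0 -> exists2 d, d != 0 & sder f s d) ->
  forall e : R, 0 < e -> exists2 x : R, 0 < x &
    forall w, normc (w - f t) < x -> exists2 s, normc (s - t) <= e & f s = w.
Proof.
move=> e00 hf e ep.
have [|d d0 [K [e1 [K0 e10 hK]]]] := hf t; first by rewrite subrr normc0 ltW.
have nd : 0 < normc d by rewrite normc_gt0.
pose r := Num.min (Num.min e0 e) (Num.min e1 (normc d / (2 * (K + 1)))).
have r0 : 0 < r by rewrite !lt_min e00 ep e10 !divr_gt0 // mulr_gt0 // ltr_wpDl.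
have re0 : r <= e0 by rewrite !ge_min lexx.
have re : r <= e by rewrite !ge_min lexx orbT.
have re1 : r <= e1 by rewrite !ge_min lexx !orbT.
have rd : r * (2 * (K + 1)) <= normc d.
  by rewrite -ler_pdivlMr ?mulr_gt0 // ?ltr_wpDl // !ge_min lexx !orbT.
exists (normc d * r / 4); first by rewrite divr_gt0 // mulr_gt0.
move=> w hw; pose D := [set s : C | normc (s - t) <= r].
have Dt : D t by rewrite /D /= subrr normc0 ltW.
have cg : {within D, continuous (fun s => normc (f s - w))}.
  apply: continuous_in_subspaceT => s; rewrite inE => Ds.
  have [|d1 _ h1] := hf s; first exact: le_trans re0.
  have := sder_continuous h1 => cf.
  apply: (@continuous_comp _ _ _ f (fun u => normc (u - w))) => //.
  apply: (continuousC_lip (K := 1)) => a b; rewrite mul1r.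
  have q1 := normc_triangle b a w; have q2 := normc_triangle a b w.
  have q3 := normcBC a b; rewrite ler_norml; lra.
have [s0 + hmin] := @compact_EVT_min _ R _ D (ex_intro _ t Dt) (@compact_diskC t r) cg.
rewrite inE => Ds0.
have ht : normc (f s0 - w) <= normc (f t - w) by apply: hmin; rewrite inE.
(* On the rim |f - f(t)| exceeds |d| r / 2, so |f - w| exceeds |d| r / 4, which is more than its
   value at the centre. *)
have s0r : normc (s0 - t) < r.
  rewrite lt_neqAle Ds0 andbT; apply/eqP => E.
  have := hK (s0 - t); rewrite E => /(_ re1); rewrite subrKC => hh.
  have q1 := lenD (f s0 - f t - d * (s0 - t)) (d * (s0 - t)).
  have q2 := normcD (d * (s0 - t)) (f s0 - f t - d * (s0 - t)).
  have q3 := lenB (d * (s0 - t)) (- (f s0 - f t - d * (s0 - t))).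
  move: q3; rewrite opprK normcN subrKC normcM E.
  have := normc_triangle w (f s0) (f t); rewrite (normcBC w) => q4.
  have q5 : r * (r * (2 * (K + 1))) <= r * normc d by rewrite ler_wpM2l // ltW.
  have q6 : 0 < r * normc d by rewrite mulr_gt0.
  have q7 := mulr_gt0 r0 r0.
  move: hw ht; rewrite (normcBC w); rewrite expr2 in hh => hw ht q3; lra.
exists s0; first exact: le_trans re.
apply/eqP; rewrite -subr_eq0; apply/negP => /negP u0.
have [|d1 d10 [K1 [e2 [K10 e20 hK1]]]] := hf s0; first by exact: le_trans re0.
have [u Eu] : exists u, u = f s0 - w by eexists.
rewrite -Eu in u0; have nu : 0 < normc u by rewrite normc_gt0.
pose v := normc u / normc d1.
have nd1 : 0 < normc d1 by rewrite normc_gt0.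
have v0 : 0 < v by rewrite divr_gt0.
pose y := Num.min (Num.min 1 (e2 / v)) (Num.min ((r - normc (s0 - t)) / v) (normc u / (2 * (K1 + 1) * v ^+ 2))).
have sr0 : 0 < r - normc (s0 - t) by rewrite subr_gt0.
have K11 : 0 < 2 * (K1 + 1) by rewrite mulr_gt0 // ltr_wpDl.
have y0 : 0 < y by rewrite !lt_min ltr01 !divr_gt0 // mulr_gt0 // exprn_gt0.
have y1 : y <= 1 by rewrite !ge_min lexx.
have y2 : y * v <= e2 by rewrite -ler_pdivlMr // !ge_min lexx orbT.
have y3 : y * v <= r - normc (s0 - t) by rewrite -ler_pdivlMr // !ge_min lexx !orbT.
have y4 : y * (2 * (K1 + 1) * v ^+ 2) <= normc u.
  rewrite -ler_pdivlMr; last by rewrite mulr_gt0 // exprn_gt0.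
  by rewrite !ge_min lexx !orbT.
(* A Newton step damped by y: to first order f - w shrinks by the factor 1 - y, and y is so small
   that the quadratic error takes back at most half of the gain and the point stays in the disk. *)
pose h := - (y%:C * (u / d1)).
have nh : normc h = y * v.
  by rewrite /h normcN !normcM normcV normc_real ger0_norm // ltW.
have := hK1 h; rewrite nh => /(_ y2) hh.
have : normc (f s0 - w) <= normc (f (s0 + h) - w).
  apply: hmin; rewrite inE /D /=.
  by have := normc_triangle s0 (s0 + h) t; rewrite [s0 + h]addrC addrK nh; lra.
rewrite -Eu => hm.
have E : f (s0 + h) - w = (1 - y)%:C * u + (f (s0 + h) - f s0 - d1 * h).
  have -> : d1 * h = - (y%:C * u) by rewrite /h; field.
  by rewrite Eu rmorphB /=; ring.
have := normcD ((1 - y)%:C * u) (f (s0 + h) - f s0 - d1 * h).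
rewrite -E normcM normc_real ger0_norm ?subr_ge0 // => hn.
have q1 : y * (y * (2 * (K1 + 1) * v ^+ 2)) <= y * normc u by rewrite ler_wpM2l // ltW.
have q2 : 0 < y * normc u by rewrite mulr_gt0.
have q3 : 0 < y ^+ 2 * v ^+ 2 by rewrite mulr_gt0 ?exprn_gt0.
have q4 : 0 <= K1 * (y ^+ 2 * v ^+ 2) by rewrite mulr_ge0 // ltW.
rewrite exprMn in hh; lra.
Qed.

Lemma path_clopen (g : R -> C) (A O F : set C) : continuous g ->
  (forall s : R, 0 <= s <= 1 -> A (g s)) -> open O -> closed F ->
  (forall z, A z -> (O z <-> F z)) -> O (g 0) -> O (g 1).
Proof.
move=> cg gA oO cF OF O0.
have cI : connected (`[0, 1]%classic : set R) by apply/connected_intervalP/interval_is_interval.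
have E : `[0, 1]%classic `&` (g @^-1` O) = `[0, 1]%classic.
  apply: cI.
  - by exists 0; split=> //=; rewrite in_itv /= lexx ler01.
  - exists (g @^-1` O) => //; apply: open_comp => // x _; exact: cg.
  - exists (g @^-1` F); first by apply: closed_comp => // x _; exact: cg.
    apply/seteqP; split=> s [] /=; rewrite in_itv /= => hs /(OF _ (gA s hs)) hO //.
have : (`[0, 1]%classic : set R) 1 by rewrite /= in_itv /= ler01 lexx.
by rewrite -E => -[].
Qed.

End OpenMapping.

(** * The triangle T0 and its complementary triangle *)

Section FundamentalTriangle.
Variable R : realType.
Local Notation C := R[i].
Local Notation s3 := (Num.sqrt (3 : R)).
Local Notation rho := (rho R).
Implicit Types (z w t : C) (x y : R).

Definition arcf x : R := Num.sqrt (1 - x ^+ 2).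

Lemma arcf_ge0 x : 0 <= arcf x. Proof. exact: sqrtr_ge0. Qed.

Lemma arcf_sqr x : 0 <= x <= 2^-1 -> arcf x ^+ 2 = 1 - x ^+ 2.
Proof. by move=> hx; rewrite sqr_sqrtr //; nra. Qed.

Lemma arcf0 : arcf 0 = 1. Proof. by rewrite /arcf expr0n subr0 sqrtr1. Qed.

Lemma arcf_half : arcf 2^-1 = s3 / 2.
Proof.
apply/eqP; rewrite -(eqrXn2 (n := 2)) ?arcf_ge0 ?divr_ge0 ?sqrtr_ge0 //.
by rewrite arcf_sqr ?expr_div_n ?sqrt3_sqr; [apply/eqP; field|lra].
Qed.

Lemma arcf_bounds x : 0 <= x <= 2^-1 -> s3 / 2 <= arcf x <= 1.
Proof.
move=> hx; have h1 := arcf_sqr hx; have h2 := sqrt3_sqr R; have h3 := arcf_ge0 x.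
have h4 : 0 <= s3 := sqrtr_ge0 _.
by apply/andP; split; rewrite -ler_sqr ?nnegrE ?divr_ge0 // h1 ?expr_div_n ?h2; nra.
Qed.

Lemma continuous_arcf : continuous arcf.
Proof.
move=> x; apply: (@continuous_comp _ _ _ (fun x : R => 1 - x ^+ 2) (@Num.sqrt R)).
  by apply: cvgB; [exact: cvg_cst|exact: exprn_continuous].
exact: sqrt_continuous.
Qed.

(* The part of the strip on or above (k = 1), resp. on or below (k = -1),
   the unit circle. *)
Definition side_of (k : R) t : Prop := 0 <= Re t <= 2^-1 /\ 0 <= k * (Im t - arcf (Re t)).
Definition side_of_i (k : R) t : Prop := 0 < Re t < 2^-1 /\ 0 < k * (Im t - arcf (Re t)).
Local Notation T0f := (side_of 1).
Local Notation T0i := (side_of_i 1).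
Local Notation Uf := (side_of (-1)).
Local Notation Ui := (side_of_i (-1)).

Lemma side_of_iW k t : side_of_i k t -> side_of k t.
Proof.
by move=> [/andP[h1 h2] h3]; split; [apply/andP; split|]; apply: ltW.
Qed.

Lemma T0fE t : T0f t <-> [/\ 0 <= Re t <= 2^-1, 0 < Im t & 1 <= normc t].
Proof.
split=> [[h]|[h h1 h2]].
  rewrite mul1r subr_ge0 => h1; have /andP[h2 h3] := arcf_bounds h.
  have h4 : 0 < s3 by rewrite sqrtr_gt0.
  split=> //; first by lra.
  by apply: le_normc => //; have := arcf_sqr h; nra.
split=> //; rewrite mul1r subr_ge0 -ler_sqr ?nnegrE ?arcf_ge0 ?(ltW h1) //.
by rewrite arcf_sqr //; have := sqr_normcE t; nra.
Qed.

Lemma T0f_strip t : T0f t -> strip t.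
Proof.
move=> [h]; rewrite mul1r subr_ge0 => h1; have /andP[h2 h3] := arcf_bounds h.
by split=> //; lra.
Qed.

Lemma continuous_mulB (T : topologicalType) (k : R) (f g : T -> R) (x : T) :
  {for x, continuous f} -> {for x, continuous g} ->
  {for x, continuous (fun y : T => k * (f y - g y))}.
Proof.
move=> h1 h2; apply: cvgM; first exact: cvg_cst.
by apply: cvgB; [exact: h1|exact: h2].
Qed.

Lemma continuous_height (k : R) : continuous (fun t => k * (Im t - arcf (Re t))).
Proof.
move=> t; apply: continuous_mulB; first exact: continuous_Im.
by apply: (@continuous_comp _ _ _ (@complex.Re R) arcf); [exact: continuous_Re|exact: continuous_arcf].
Qed.

Lemma side_of_i_open k : open (side_of_i k).
Proof.
have -> : side_of_i k = (@complex.Re R @^-1` [set x | 0 < x]) `&`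
    ((@complex.Re R @^-1` [set x | x < 2^-1]) `&`
     ((fun t => k * (Im t - arcf (Re t))) @^-1` [set x | 0 < x])).
  by apply/seteqP; split=> t /= => [[/andP[h1 h2] h3]|[h1 [h2 h3]]]; split=> //; apply/andP.
apply: openI; last apply: openI.
- apply: open_comp; [by move=> t _; exact: continuous_Re|exact: open_gt].
- apply: open_comp; [by move=> t _; exact: continuous_Re|exact: open_lt].
apply: open_comp; last exact: open_gt.
move=> t _; exact: continuous_height.
Qed.

Lemma side_of_closed k : closed (side_of k).
Proof.
have -> : side_of k = (@complex.Re R @^-1` [set x | 0 <= x]) `&`
    ((@complex.Re R @^-1` [set x | x <= 2^-1]) `&`
     ((fun t => k * (Im t - arcf (Re t))) @^-1` [set x | 0 <= x])).
  by apply/seteqP; split=> t /= => [[/andP[h1 h2] h3]|[h1 [h2 h3]]]; split=> //; apply/andP.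
apply: closedI; last apply: closedI.
- apply: closed_comp; [by move=> t _; exact: continuous_Re|exact: closed_ge].
- apply: closed_comp; [by move=> t _; exact: continuous_Re|exact: closed_le].
apply: closed_comp; last exact: closed_ge.
move=> t _; exact: continuous_height.
Qed.

(* In the coordinates (Re t, Im t - arcf (Re t)) these sets are convex. *)
Lemma side_path k a b : side_of_i k a -> side_of_i k b -> exists g : R -> C,
  [/\ continuous g, g 0 = a, g 1 = b & forall s : R, 0 <= s <= 1 -> side_of_i k (g s)].
Proof.
move=> [/andP[a1 a2] a3] [/andP[b1 b2] b3].
pose X (s : R) := Re a + s * (Re b - Re a).
pose u t := Im t - arcf (Re t).
pose Y (s : R) := arcf (X s) + (u a + s * (u b - u a)).
have cl (c d : R) : continuous (fun s : R => c + s * d).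
  move=> s; apply: cvgD; first exact: cvg_cst.
  by apply: cvgM; [exact: cvg_id|exact: cvg_cst].
exists (fun s => X s +i* Y s); split.
- move=> s; apply: continuousC_at => /=; first exact: cl.
  apply: cvgD; last exact: cl.
  apply: (@continuous_comp _ _ _ X arcf); first exact: cl.
  exact: continuous_arcf.
- by apply: eqReIm => /=; rewrite /Y /X ?mul0r !addr0 // addrC subrK.
- by apply: eqReIm => /=; rewrite /Y /X ?mul1r !subrKC.
move=> s /andP[s0 s1].
have pos (c d : R) : 0 < c -> 0 < d -> 0 < c + s * (d - c).
  move=> c0 d0; have [->|sn] := eqVneq s 0; first by rewrite mul0r addr0.
  have sp : 0 < s by rewrite lt_def sn.
  by have := mulr_gt0 sp d0; have := mulr_ge0 (_ : 0 <= 1 - s) (ltW c0); rewrite subr_ge0 => /(_ s1); lra.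
split=> /=.
  rewrite /X pos //=; have := @pos (2^-1 - Re a) (2^-1 - Re b).
  by rewrite !subr_gt0 => /(_ a2 b2); lra.
rewrite /Y addrC addKr; have := pos _ _ a3 b3; rewrite -/(u a) -/(u b); lra.
Qed.

Lemma side_clopen k a b (O F : set C) : open O -> closed F ->
  (forall z, side_of_i k z -> (O z <-> F z)) -> side_of_i k a -> side_of_i k b -> O a -> O b.
Proof.
move=> oO cF h ha hb; have [g [cg <- <- hg]] := side_path ha hb.
exact: (path_clopen cg hg oO cF h).
Qed.

(* The map [pbar] on the finite points of T0. *)
Definition f0 t := conjc (pc t).

Lemma f0E t : strip t -> pbar (Some t) = Some (f0 t).
Proof.
move=> ht; have := strip_small ht => /ltW hq.
have t0 : 0 < Im t by case: ht => _; have /andP[] := sqrt3_bounds R; lra.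
by rewrite /= p_pc.
Qed.

(** The distance is 6 / (pi |E2|), with pi >= 3 and |E2| >= 21/25. This bound governs [pbar] near
    the cusp. *)
Lemma f0_dist t : strip t -> normc (f0 t - conjc t) <= 12 / 5.
Proof.
move=> /strip_small /ltW hq; rewrite /f0 -cJN -cJD normcJ' pcE // addrC addKr.
have e := E2_near1 hq; have := E2_neq0 hq; move: (E2 _) e => e he e0.
have ne : 21 / 25 <= normc e by have := normc_triangle 1 e 0; have := normc_triangle e 1 0; rewrite !subr0 normc1 (normcBC 1); lra.
have p3 := pi_ge3 R.
rewrite normcM normcN !normcM !normcV normc_nat normc_i normc_real ger0_norm ?pi_ge0 // mulr1.
have ne0 : 0 < normc e by lra.
have -> : 6 / pi / normc e = 6 / (pi * normc e) by rewrite -mulrA -invfM.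
by rewrite ler_pdivrMr ?mulr_gt0 ?pi_gt0 //; nra.
Qed.

Lemma f0_edge0 t : strip t -> Re t = 0 -> Re (f0 t) = 0.
Proof.
move=> ht h; have t0 : 0 < Im t by case: ht => _; have /andP[] := sqrt3_bounds R; lra.
have := pbar_refl 2 t0; rewrite !refl2E f0E //= -/(pbar (Some (- conjc t))).
have -> : - conjc t = t by apply: eqReIm; rewrite !cE ?opprK // h oppr0.
by rewrite f0E //; move: (f0 t) => v [] /(congr1 (@complex.Re R)); rewrite !cE; lra.
Qed.

Lemma f0_edge1 t : strip t -> Re t = 2^-1 -> Re (f0 t) = 2^-1.
Proof.
move=> ht h; have t0 : 0 < Im t by case: ht => _; have /andP[] := sqrt3_bounds R; lra.
have := pbar_refl 1 t0; rewrite !refl1E f0E //= -/(pbar (Some (1 - conjc t))).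
have -> : 1 - conjc t = t by apply: eqReIm; rewrite !cE ?opprK ?h; lra.
by rewrite f0E //; move: (f0 t) => v [] /(congr1 (@complex.Re R)); rewrite !cE; lra.
Qed.

Lemma normc1_conj z : normc z = 1 <-> z != 0 /\ conjc z^-1 = z.
Proof.
have E : z * conjc z = (normc z ^+ 2)%:C.
  by rewrite sqr_normcE; case: z => x y; apply: eqReIm => /=; ring.
split=> [h|[z0 h]].
  have z0 : z != 0 by rewrite -normc_gt0 h.
  split=> //; rewrite cJV; apply: (mulIf (_ : conjc z != 0)); first by rewrite conjc_eq0.
  by rewrite mulVf ?conjc_eq0 // E h expr1n.
have : z * conjc z = 1 by rewrite -{1}h cJV mulVf // conjc_eq0.
rewrite E => /(congr1 (@complex.Re R)) /= hh.
by apply/eqP; rewrite -(eqrXn2 (n := 2)) ?normc_ge0 ?expr1n // hh.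
Qed.

Lemma f0_edge2 t : strip t -> normc t = 1 -> normc (f0 t) = 1.
Proof.
move=> ht h; have t0 : 0 < Im t by case: ht => _; have /andP[] := sqrt3_bounds R; lra.
have := pbar_refl 0 t0; rewrite !refl0E f0E //.
have [tn0 ht1] := (normc1_conj t).1 h.
rewrite /= (negbTE tn0) /sconj /= ht1 -/(sconj (p t)) -/(pbar (Some t)) f0E //.
case: eqP => //= /eqP fn0 [] hf.
by apply/normc1_conj; split.
Qed.

(** Equivariance only places the image of the arc on the unit circle; the sign selects its upper
    half. The imaginary part is -Im t + (6/pi) Re(1/E2) >= -1 + (6/4)(4/5) > 0. *)
Lemma f0_arc_im t : strip t -> Im t <= 1 -> 0 < Im (f0 t).
Proof.
move=> ht h; have hq := ltW (strip_small ht).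
rewrite /f0 cImJ pcE //.
have := E2_near1 hq; have := E2_neq0 hq; move: (E2 _) => e e0 he.
have p0 := pi_gt0 R; have p4 : pi <= 4 :> R by have := @pihalf_lt2 R; lra.
have ne : 21 / 25 <= normc e by have := normc_triangle e 1 0; rewrite !subr0 normc1 (normcBC 1); lra.
have ne0 : 0 < normc e by lra.
have hv : normc (e^-1 - 1) <= 1 / 5.
  have -> : e^-1 - 1 = - ((e - 1) / e) by field.
  by rewrite normcN normcM normcV ler_pdivrMr //; lra.
have hr : 4 / 5 <= Re e^-1.
  by have := Re_le_normc (e^-1 - 1); rewrite !cE ler_norml => /andP[]; lra.
have -> : - (6 * 'i%C / pi%:C) / e = (- (6 / pi))%:C * ('i%C * e^-1) :> C.
  rewrite rmorphN rmorphM fmorphV rmorph_nat /=.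
  by ring.
rewrite cImD cImM /= mul0r addr0 cImM /= mul0r add0r mul1r.
have : 6 / 4 <= 6 / (pi : R) by rewrite ler_pM2l // lef_pV2 ?posrE.
by move=> h6; have := ler_pM _ _ h6 hr; rewrite !divr_ge0 // => /(_ isT isT); lra.
Qed.

End FundamentalTriangle.

(** * Boundary values of the map on T0, and openness in its interior *)

Section FundamentalBijection.
Variable R : realType.
Local Notation C := R[i].
Local Notation S2 := (sphere R).
Local Notation s3 := (Num.sqrt (3 : R)).
Local Notation rho := (rho R).
Local Notation T0f := (side_of (1 : R)).
Local Notation T0i := (side_of_i (1 : R)).
Local Notation Uf := (side_of (-1 : R)).
Local Notation Ui := (side_of_i (-1 : R)).
Implicit Types (z w t : C) (x y : R).

(** (arcf x - arcf y)(arcf x + arcf y) = (y - x)(x + y), where the sum of the heights is at least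
    sqrt 3 and x + y <= 1. *)
Lemma arcf_lip x y : 0 <= x <= 2^-1 -> 0 <= y <= 2^-1 -> arcf x - arcf y <= `|x - y|.
Proof.
move=> hx hy; have h1 := arcf_sqr hx; have h2 := arcf_sqr hy.
have /andP[a1 a2] := arcf_bounds hx; have /andP[b1 b2] := arcf_bounds hy.
have /andP[k1 k2] := sqrt3_bounds R.
have [h|h] := leP (arcf x - arcf y) 0; first exact: le_trans (normr_ge0 _).
have E : (arcf x - arcf y) * (arcf x + arcf y) = (y - x) * (x + y).
  by rewrite -subr_sqr h1 h2; ring.
rewrite distrC; apply: le_trans (ler_norm _); nra.
Qed.

Lemma side_dense k t (e : R) : k ^+ 2 = 1 -> side_of k t -> 0 < e ->
  exists2 s, side_of_i k s & normc (s - t) < e.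
Proof.
move=> k1 [h1 h2] e0.
pose y := Num.min 1 (e / 4).
have y0 : 0 < y by rewrite lt_min ltr01 divr_gt0.
have y1 : y <= 1 by rewrite ge_min lexx.
have ye : y <= e / 4 by rewrite ge_min lexx orbT.
have nk : `|k| = 1.
  by apply/eqP; rewrite -(eqrXn2 (n := 2)) // real_normK ?num_real // k1 expr1n.
(* The real part moves towards 1/4 by at most y/4 and the height away from the arc by y; since
   [arcf] is 1-Lipschitz on [0, 1/2], the vertical move prevails. *)
pose s : C := (Re t + y * (4^-1 - Re t)) +i* (Im t + k * y).
case/andP: h1 => x0 x1.
have d1 : `|y * (4^-1 - Re t)| <= y / 4.
  by rewrite normrM (gtr0_norm y0) ler_pM2l // ler_norml; lra.
have s0 : 0 < Re s < 2^-1 by rewrite /=; apply/andP; split; nra.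
exists s.
  split=> //; rewrite [Im s]/=.
  have hs : 0 <= Re s <= 2^-1 by case/andP: s0 => ? ?; rewrite !ltW.
  have ht : 0 <= Re t <= 2^-1 by rewrite x0.
  have a1 := arcf_lip hs ht; have a2 := arcf_lip ht hs.
  have d2 : `|Re s - Re t| <= y / 4 by rewrite /= addrC addKr.
  rewrite distrC in a2.
  have -> : k * (Im t + k * y - arcf (Re s)) =
    k * (Im t - arcf (Re t)) + k ^+ 2 * y + k * (arcf (Re t) - arcf (Re s)) by ring.
  have : `|k * (arcf (Re t) - arcf (Re s))| <= y / 4.
    by rewrite normrM nk mul1r ler_norml; lra.
  by rewrite ler_norml k1 => /andP[]; lra.
apply: le_lt_trans (normc_le_ReIm _) _; rewrite !cE /=.
rewrite [Re t + _]addrC addrK [Im t + _]addrC addrK.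
by rewrite (normrM k) nk mul1r (gtr0_norm y0); lra.
Qed.

Lemma f0_inj s t : strip s -> strip t -> f0 s = f0 t -> s = t.
Proof. by move=> hs ht /(can_inj (@conjcK R)) /pc_inj; apply. Qed.

Lemma f0_conj t : conjc (f0 t) = pc t. Proof. exact: conjcK. Qed.

Lemma f0_continuous t : strip t -> {for t, continuous (@f0 R)}.
Proof.
move=> /strip_small /pc_sder /sder_continuous /continuous_epsC h.
apply/continuous_epsC => e /h[r r0 hr]; exists r => // s /hr.
by rewrite /f0; move: (pc s) (pc t) => u v; rewrite -cJN -cJD normcJ'.
Qed.

Lemma f0_curve (L : C -> R) (g : R -> C) (a b v : R) : continuous L -> continuous g -> a <= b ->
  (forall s : R, a <= s <= b -> strip (g s)) ->
  Num.min (L (f0 (g a))) (L (f0 (g b))) <= v <= Num.max (L (f0 (g a))) (L (f0 (g b))) ->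
  exists2 s, a <= s <= b & L (f0 (g s)) = v.
Proof.
move=> cL cg ab hg hv.
have [|s sab <-] := IVT (f := fun s => L (f0 (g s))) ab _ hv.
  apply: continuous_in_subspaceT => s; rewrite inE /= in_itv /= => hs.
  have := f0_continuous (hg s hs); move: (@f0 R) => f cf.
  apply: (@continuous_comp _ _ _ (fun s => f (g s)) L); last exact: cL.
  by apply: (@continuous_comp _ _ _ g f); [exact: cg|exact: cf].
by exists s => //; move: sab; rewrite in_itv.
Qed.

Lemma strip_ge t : 0 <= Re t <= 2^-1 -> 1 <= Im t -> T0f t.
Proof.
by move=> h1 h2; split=> //; have := arcf_bounds h1; lra.
Qed.

Lemma T0f_bdP t : T0f t -> ~ T0i t -> [\/ Re t = 0, Re t = 2^-1 | normc t = 1 /\ Im t <= 1].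
Proof.
move=> [h1 h2] h3; have [h|x0] := eqVneq (Re t) 0; first by constructor 1.
have [h|x1] := eqVneq (Re t) 2^-1; first by constructor 2.
constructor 3; move: h2; rewrite mul1r subr_ge0 => h2.
have E : Im t = arcf (Re t).
  apply/eqP; rewrite eq_le h2 andbT leNgt; apply/negP => h; apply: h3; split.
    by case/andP: h1 => a b; rewrite !lt_def x0 a /= eq_sym x1.
  by rewrite mul1r subr_gt0.
have /andP[_ a] := arcf_bounds h1; split; last by rewrite E.
apply/eqP; rewrite -(eqrXn2 (n := 2)) ?normc_ge0 // sqr_normcE E arcf_sqr // expr1n.
by apply/eqP; ring.
Qed.

Lemma Ui_norm w : Ui w -> normc w = 1 -> 0 < Im w -> False.
Proof.
move=> [h1 h2] h3 h4; have hx : 0 <= Re w <= 2^-1 by case/andP: h1 => a b; rewrite !ltW.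
have := sqr_normcE w; rewrite h3; have := arcf_sqr hx; have := arcf_ge0 (Re w); nra.
Qed.

Lemma f0_bd t : T0f t -> ~ T0i t -> ~ Ui (f0 t).
Proof.
move=> h1 h2 h3; have hs := T0f_strip h1; case: (T0f_bdP h1 h2) => [h|h|[h h']].
- by case: h3; rewrite (f0_edge0 hs h) ltxx.
- by case: h3; rewrite (f0_edge1 hs h) ltxx andbF.
- exact: Ui_norm h3 (f0_edge2 hs h) (f0_arc_im hs h').
Qed.

Lemma norm_unique z w : Re z = Re w -> normc z = 1 -> normc w = 1 -> 0 <= Im z -> 0 <= Im w -> z = w.
Proof.
move=> h1 h2 h3 h4 h5; apply: eqReIm => //; apply/eqP; rewrite -(eqrXn2 (n := 2)) //.
have := sqr_normcE z; have := sqr_normcE w; rewrite h2 h3 h1 => -> /addrI ->.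
by rewrite eqxx.
Qed.

Definition ii : C := 'i%C.

Lemma T0f_ii : T0f ii.
Proof. by split; rewrite /= ?arcf0 ?subrr ?mulr0 // lexx invr_ge0 ler0n. Qed.

Lemma f0_ii : f0 ii = ii.
Proof.
have hs := T0f_strip T0f_ii; have n1 : normc ii = 1 by exact: normc_i.
apply: norm_unique => //; first by rewrite f0_edge0.
- exact: f0_edge2.
- by apply/ltW/f0_arc_im.
Qed.

Lemma T0f_rho : T0f rho.
Proof.
split; first by rewrite /= invr_ge0 ler0n lexx.
by rewrite /= arcf_half subrr mulr0.
Qed.

Lemma f0_rho : f0 rho = rho. Proof. by rewrite /f0 pc_rho conjcK. Qed.

Lemma f0_Im t : strip t -> Im (f0 t) <= 12 / 5 - Im t.
Proof.
move=> ht; have := f0_dist ht; have := Im_le_normc (f0 t - conjc t).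
move: (f0 t) => v; rewrite cImD cImN cImJ opprK ler_norml => /andP[_]; lra.
Qed.

(** The intermediate value theorem on the ray upwards from the fixed vertex t0: the image starts at
    t0, stays on the line, and by [f0_Im] its imaginary part tends to minus infinity. *)
Lemma f0_vertical (x0 : R) t0 : (x0 = 0 \/ x0 = 2^-1) -> T0f t0 -> Re t0 = x0 ->
  f0 t0 = t0 -> forall w, Re w = x0 -> Im w <= Im t0 ->
  exists2 t, T0f t & Re t = x0 /\ f0 t = w.
Proof.
move=> hx T0 R0 F0 w Rw Iw.
(* High enough that 12/5 - Y lies below Im w. *)
pose Y := Im t0 + 4 + `|Im w|.
have hx0 : 0 <= x0 <= 2^-1 by rewrite -R0; case: T0.
have TY y : Im t0 <= y -> T0f (x0 +i* y).
  by move=> hy; case: T0 => _; rewrite R0 => h; split=> //=; move: h; rewrite !mul1r; lra.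
have gc : continuous (fun y => x0 +i* y : C).
  by move=> y; apply: continuousC_at => /=; [exact: cst_continuous|move=> ?].
have aw := normr_ge0 (Im w).
have I0 : 0 < Im t0 by have /T0fE[] := T0.
have EY : x0 +i* Im t0 = t0 by apply: eqReIm.
have yY : Im t0 <= Y by rewrite /Y; lra.
have [||y hy E] := f0_curve (g := fun y => x0 +i* y) (v := Im w) (@continuous_Im R) gc yY.
- move=> s /andP[hs _]; exact/T0f_strip/TY.
- rewrite EY F0 ge_min le_max Iw /=; apply/andP; split=> //; apply/orP; right.
  have := f0_Im (T0f_strip (TY _ yY)); rewrite [Im (_ +i* _)]/= /Y.
  have := ler_norm (- Im w); rewrite normrN; lra.
case/andP: hy => hy _; have Ty := TY _ hy.
exists (x0 +i* y) => //; split=> //; apply: eqReIm => //; rewrite Rw.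
have sy := T0f_strip Ty.
by case: hx => hx; rewrite [RHS]hx; [apply: f0_edge0 sy _|apply: f0_edge1 sy _].
Qed.

Lemma f0_bd_surj w : Uf w -> ~ Ui w -> exists t, [/\ T0f t, ~ T0i t & f0 t = w].
Proof.
move=> [h1 h2] h3; rewrite mulN1r opprB subr_ge0 in h2.
have [x0|x0] := eqVneq (Re w) 0.
  have hw : Im w <= Im ii by move: h2; rewrite x0 arcf0.
  have [t Tt [Rt Ft]] := f0_vertical (or_introl erefl) T0f_ii erefl f0_ii x0 hw.
  by exists t; split=> // -[]; rewrite Rt ltxx.
have [x1|x1] := eqVneq (Re w) 2^-1.
  have hw : Im w <= Im rho by move: h2; rewrite x1 arcf_half.
  have [t Tt [Rt Ft]] := f0_vertical (or_intror erefl) T0f_rho erefl f0_rho x1 hw.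
  by exists t; split=> // -[]; rewrite Rt ltxx andbF.
have E : Im w = arcf (Re w).
  apply/eqP; rewrite eq_le h2 leNgt; apply/negP => h; apply: h3; split.
    by case/andP: h1 => a b; rewrite !lt_def x0 a /= eq_sym x1.
  by rewrite mulN1r opprB subr_gt0.
(* On the arc the real part of the image runs from 0 at the fixed point i to 1/2 at the fixed point
   rho, and a point of the upper unit circle is determined by its real part. *)
pose g x : C := x +i* arcf x.
have gc : continuous g.
  by move=> x; apply: continuousC_at => /=; [move=> ?|exact: continuous_arcf].
have Tg (x : R) : 0 <= x <= 2^-1 -> T0f (g x).
  by move=> hx; split=> //=; rewrite subrr mulr0.
have g0 : g 0 = ii by apply: eqReIm; rewrite /= ?arcf0.
have g1 : g 2^-1 = rho by apply: eqReIm; rewrite /= ?arcf_half.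
have ng (x : R) : 0 <= x <= 2^-1 -> normc (g x) = 1 /\ Im (g x) <= 1.
  move=> hx; have /andP[_ a] := arcf_bounds hx; split=> //.
  apply/eqP; rewrite -(eqrXn2 (n := 2)) ?normc_ge0 // sqr_normcE /= arcf_sqr // expr1n.
  by apply/eqP; ring.
have hh : (0 : R) <= 2^-1 by lra.
have [||x hx Ex] := f0_curve (g := g) (v := Re w) (@continuous_Re R) gc hh.
- by move=> s hs; exact/T0f_strip/Tg.
- by rewrite g0 g1 f0_ii f0_rho /= ge_min le_max; case/andP: h1 => -> ->; rewrite orbT.
have sx := T0f_strip (Tg _ hx); have [n1 n2] := ng _ hx.
exists (g x); split; first exact: Tg.
  by case=> _; rewrite /= subrr mulr0 ltxx.
apply: norm_unique => //; [exact: f0_edge2| |exact/ltW/f0_arc_im|].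
  have [] := ng _ h1; rewrite /g -E; case: (w) => ? ? //.
by rewrite E arcf_ge0.
Qed.

Lemma T0i_neq_rho t : T0i t -> t != rho.
Proof. by move=> [/andP[_ h]] _; apply: contraTneq h => ->; rewrite ltxx. Qed.

(** A starting point for the connectedness arguments: at height 4 the real part of the image runs
    from 0 to 1/2, while its imaginary part is at most 12/5 - 4 < 0. *)
Lemma f0_base : exists2 t, T0i t & Ui (f0 t).
Proof.
pose g x : C := x +i* 4.
have gc : continuous g.
  by move=> x; apply: continuousC_at => /=; [move=> ?|exact: cst_continuous].
have Tg (x : R) : 0 <= x <= 2^-1 -> T0f (g x) by move=> hx; apply: strip_ge => //=; lra.
have z0 : 0 <= (0 : R) <= 2^-1 by rewrite lexx invr_ge0 ler0n.
have z1 : 0 <= (2^-1 : R) <= 2^-1 by rewrite lexx invr_ge0 ler0n.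
have h0 : (0 : R) <= 2^-1 by lra.
have [||x hx Ex] := f0_curve (g := g) (v := 4^-1) (@continuous_Re R) gc h0.
- by move=> s hs; exact/T0f_strip/Tg.
- have aux (a b : R) : a = 0 -> b = 2^-1 -> Num.min a b <= 4^-1 <= Num.max a b.
    by move=> -> ->; rewrite ge_min le_max; apply/andP; split; apply/orP; [left|right]; lra.
  exact: aux (f0_edge0 (T0f_strip (Tg _ z0)) erefl) (f0_edge1 (T0f_strip (Tg _ z1)) erefl).
have sx := T0f_strip (Tg _ hx).
have U : Ui (f0 (g x)).
  split; first by rewrite Ex; lra.
  rewrite Ex mulN1r opprB subr_gt0; apply: le_lt_trans (f0_Im sx) _.
  have : 0 <= arcf (4^-1 : R) := arcf_ge0 _.
  by rewrite /=; lra.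
exists (g x) => //; apply: contrapT => h; exact: f0_bd (Tg _ hx) h U.
Qed.

Lemma T0i_open_pc t : T0i t -> exists2 e0 : R, 0 < e0 & forall s, normc (s - t) <= e0 ->
  T0i s /\ exists2 d, d != 0 & sder (@pc R) s d.
Proof.
move=> Tt; have /nbhsC[e e0 he] := open_nbhs_nbhs (conj (@side_of_i_open R 1) Tt).
exists (e / 2); first by rewrite divr_gt0.
move=> s hs; have Ts : T0i s by apply: he; lra.
have st := T0f_strip (side_of_iW Ts); split=> //.
by exists (pd s); [apply: pd_neq0 => //; exact: T0i_neq_rho|exact/pc_sder/strip_small].
Qed.

Lemma f0_open t (e : R) : T0i t -> 0 < e -> exists2 x : R, 0 < x &
  forall w, normc (w - f0 t) < x -> exists s, [/\ T0i s, normc (s - t) <= e & f0 s = w].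
Proof.
move=> Tt ep; have [e0 e00 he] := T0i_open_pc Tt.
have e1 : 0 < Num.min e0 e by rewrite lt_min e00.
have [x x0 hx] := open_sder e00 (fun s hs => (he s hs).2) e1.
exists x => // w hw; have [|s hs Es] := hx (conjc w).
  by rewrite -normcJ' cJD cJN conjcK.
move: hs; rewrite le_min => /andP[/he[Ts _] hs].
by exists s; split=> //; rewrite /f0 Es conjcK.
Qed.

End FundamentalBijection.

(** * The homeomorphism of T0 onto its complementary triangle in the sphere *)

Section SphereTriangle.
Variable R : realType.
Local Notation C := R[i].
Local Notation S2 := (sphere R).
Local Notation T0f := (side_of (1 : R)).
Local Notation T0i := (side_of_i (1 : R)).
Local Notation Uf := (side_of (-1 : R)).
Local Notation Ui := (side_of_i (-1 : R)).
Implicit Types (z w t : C).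

#[local] Opaque f0.

Lemma compact_homeo (S U : topologicalType) (s0 : S) (X : set S) (Y : set U) (f : S -> U) :
  compact X -> hausdorff_space U -> set_bij X Y f -> {within X, continuous f} ->
  homeomorphism_onto X Y f.
Proof.
move=> cX hU bf cf; split=> //; have [hf injf surjf] := bf.
(* The inverse must be a total function; off [Y] it takes the default value [s0]. *)
have : forall y, exists x, Y y -> X x /\ f x = y.
  by move=> y; have [/surjf[x Xx <-]|nY] := pselect (Y y); [exists x|exists s0].
move=> /choice[g hg]; exists g.
  move=> x; rewrite inE => Xx; have [h1 h2] := hg (f x) (hf _ Xx).
  by apply: injf => //; rewrite inE.
apply/subspace_continuousP => y Yy W Wy.
pose K := X `&` ~` (interior W).
have cK : compact K by apply: compact_closedI => //; apply: open_closedC; exact: open_interior.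
have clK : closed (f @` K).
  apply: compact_closed => //; apply: continuous_compact => //.
  by apply: continuous_subspaceW cf => x [].
have nK : ~ (f @` K) y.
  move=> [x [Xx nWx] E]; apply: nWx; have [h1 h2] := hg y Yy.
  have -> : x = g y by apply: injf; rewrite ?inE // h2.
  exact: Wy.
have : nbhs y (~` (f @` K)) by apply: open_nbhs_nbhs; split=> //; exact: closed_openC.
rewrite /nbhs /= /within /=; apply: filterS => y' nKy' Yy'.
have [h1 h2] := hg y' Yy'; apply: interior_subset; apply: contrapT => nW.
by apply: nKy'; exists (g y').
Qed.

(** k = 1 gives T0 and k = -1 its complementary triangle, so that their topology is treated once. *)
Definition Sreg (k : R) : set S2 := [set None] `|` Some @` side_of k.

Lemma SregE k z : Sreg k (Some z) <-> side_of k z.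
Proof. by split=> [[//|[w h [<-]]]|h] //; right; exists z. Qed.

Lemma region_T0 : region (T0 R) = Sreg 1.
Proof.
congr (_ `|` _); congr (_ @` _); apply/seteqP; split=> t.
  by move=> [h1 h2 h3]; apply/T0fE; split=> //; rewrite normcE lecR in h3.
by move=> /T0fE[h1 h2 h3]; split=> //; rewrite normcE lecR.
Qed.

Lemma closed_noneU (F : set C) : closed F -> closed ([set None] `|` Some @` F : set S2).
Proof.
move=> cF [z|]; last by left.
move=> clz; right; exists z => //; apply: cF => U /nbhsC[e e0 he].
have zU : nbhs (Some z : S2) (Some @` [set w | normc (w - z) < e]).
  by apply/nbhsS_some; exists e => // w hw; exists w.
have [x [h1 [v vz E]]] := clz _ zU; move: h1; rewrite -E => -[//|[t Ft [Et]]].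
by exists v; split; [rewrite -Et|exact: he].
Qed.

Lemma compactS (A : set S2) : closed A -> compact A.
Proof.
move=> cA; apply: (subclosed_compact cA _ (@subsetT _ A)).
exact: one_point_compactification_compact.
Qed.

Lemma closed_Sreg k : closed (Sreg k).
Proof. by apply: closed_noneU; exact: side_of_closed. Qed.

Lemma inteE (T : topologicalType) (X : set T) : inte X = interior X.
Proof.
apply/seteqP; split=> x; rewrite /inte /boundary.
  move=> [Xx nb]; apply: contrapT => nI; apply: nb; split=> //; exact: subset_closure.
by move=> Ix; split; [exact: interior_subset|move=> []].
Qed.

Lemma interior_Sreg k : k ^+ 2 = 1 -> interior (Sreg k) = Some @` side_of_i k.
Proof.
move=> k1; apply/seteqP; split=> [[z|]|_ [z hz <-]].
- move=> /nbhsS_some[e e0 he].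
  have e2 : 0 < e / 2 by rewrite divr_gt0.
  have ee : e / 2 < e by rewrite ltr_pdivrMr // ltr_pMr // ltr1n.
  (* Displacing z to the left, to the right and towards the arc turns each weak inequality into a
     strict one. *)
  have mv (d : C) : normc d <= e / 2 -> side_of k (z + d).
    move=> hd; apply/SregE/he; rewrite [z + d]addrC addrK; exact: le_lt_trans ee.
  exists z => //; have na (x : R) : `|x| = e / 2 -> normc x%:C <= e / 2 by rewrite normc_real => ->.
  have [|/andP[h1 _] _] := mv (- (e / 2)%:C).
    by rewrite normcN na // gtr0_norm.
  have [|/andP[_ h2] _] := mv (e / 2)%:C.
    by rewrite na // gtr0_norm.
  have nk : `|k| = 1.
    by apply/eqP; rewrite -(eqrXn2 (n := 2)) // real_normK ?num_real // k1 expr1n.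
  have [|_ h3] := mv (- ((k * (e / 2))%:C * 'i%C)).
    by rewrite normcN normcM normc_i mulr1 na // normrM nk mul1r gtr0_norm.
  move: h1 h2 h3; rewrite !cE /= !mulr0 ?mul0r ?subr0 ?sub0r ?addr0 ?oppr0 ?addr0 ?mulr1 => h1 h2 h3.
  split; first by apply/andP; split; lra.
  have E : k * (Im z - k * (e / 2) - arcf (Re z)) = k * (Im z - arcf (Re z)) - k ^+ 2 * (e / 2) by ring.
  by move: h3; rewrite E k1; lra.
(* Infinity is not interior: real numbers far to the left lie outside the strip. *)
- move=> /nbhsS_none[_ [M hM]].
  have /SregE[/andP[h _] _] := hM (- (`|M| + 1)%:C) ltac:(rewrite normcN normc_real ger0_norm ?addr_ge0 //; have := ler_norm M; lra).
  by move: h; rewrite cReN /=; have := normr_ge0 M; lra.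
apply/nbhsS_some; have /nbhsC[e e0 he] := open_nbhs_nbhs (conj (@side_of_i_open R k) hz).
by exists e => // w /he /side_of_iW hw; apply/SregE.
Qed.

Lemma closure_Sreg_i k : k ^+ 2 = 1 -> closure (Some @` side_of_i k : set S2) = Sreg k.
Proof.
move=> k1; apply/seteqP; split.
  move=> x cx; apply: closed_Sreg => U /cx[_ [[z /side_of_iW hz <-] Uz]].
  by exists (Some z); split=> //; apply/SregE.
move=> [z /SregE hz|_] U.
  move=> /nbhsS_some[e e0 he]; have [s hs sz] := side_dense k1 hz e0.
  by exists (Some s); split; [exists s|exact: he].
move=> /nbhsS_none[_ [M hM]].
pose y : R := `|M| + 2; have y0 : 0 <= `|M| := normr_ge0 M.
have hx : 0 <= (4^-1 : R) <= 2^-1 by apply/andP; split; lra.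
have /andP[a1 a2] := arcf_bounds hx; have /andP[s1 s2] := sqrt3_bounds R.
have nk : `|k| = 1.
  by apply/eqP; rewrite -(eqrXn2 (n := 2)) // real_normK ?num_real // k1 expr1n.
exists (Some (4^-1 +i* (arcf 4^-1 + k * y))); split.
  eexists; last by reflexivity.
  split=> /=; first by apply/andP; split; lra.
  by rewrite addrC addKr mulrA -expr2 k1 /y; lra.
apply: hM; have := Im_le_normc (4^-1 +i* (arcf 4^-1 + k * y)) => /=.
have := ler_norm M; have : `|k * y| = y by rewrite normrM nk mul1r ger0_norm // /y; lra.
have := lerB_dist (k * y) (- arcf 4^-1); rewrite opprK normrN (ger0_norm (arcf_ge0 _)).
rewrite [k * y + _]addrC /y; lra.
Qed.

Definition F0 : S2 -> S2 := pbar_on (T0 R).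

Lemma HHE z : HH (Some z : S2) <-> 0 < Im z.
Proof. by split=> [[w /= h [<-]]|h] //; exists z. Qed.

Lemma HH_none : ~ HH (None : S2). Proof. by case. Qed.

Lemma T0f_Im t : T0f t -> 0 < Im t. Proof. by move=> /T0fE[]. Qed.

Lemma F0_some t : T0f t -> F0 (Some t) = Some (f0 t).
Proof.
move=> ht; rewrite /F0 /pbar_on ifT; first exact/f0E/T0f_strip.
by rewrite inE; apply/HHE/T0f_Im.
Qed.

Lemma f0_far (M : R) t : T0f t -> `|M| + 3 < normc t -> M < normc (f0 t).
Proof.
move=> /T0f_strip /f0_dist h1 h2; have := lenB (conjc t) (- (f0 t - conjc t)).
by rewrite opprK normcN normcJ' subrKC; have := ler_norm M; lra.
Qed.

(** Without properness of this filter the [lim] in [pbar_on] would not be determined by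
    convergence. *)
Lemma cusp_proper : ProperFilter (within (region (T0 R) `&` @HH R) (nbhs (None : S2))).
Proof.
apply: within_nbhs_proper; rewrite region_T0 => U hU.
have := @closure_Sreg_i 1 (expr1n _ _); move=> /seteqP[_ /(_ None)].
move=> /(_ (or_introl erefl) U hU) [_ [[z hz <-] Uz]]; exists (Some z); split=> //.
have hz' := side_of_iW hz.
by split; [apply/SregE|apply/HHE/T0f_Im].
Qed.

Lemma pbar_cusp : @pbar R @ within (region (T0 R) `&` @HH R) (nbhs (None : S2)) --> (None : S2).
Proof.
move=> U /nbhsS_none[UN [M hM]]; rewrite region_T0.
change (nbhs (None : S2) [set y | (Sreg 1 `&` @HH R) y -> U (pbar y)]).
apply/nbhsS_none; split; first by move=> [_ /HH_none].
exists (`|M| + 3) => w hw [/SregE hT _]; rewrite f0E; last exact: T0f_strip.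
by apply/hM/f0_far.
Qed.

Lemma F0_none : F0 None = None.
Proof.
rewrite /F0 /pbar_on ifF; last by apply/negbTE; rewrite notin_setE; exact: HH_none.
have pF := cusp_proper; exact (cvg_lim (@hausdorffS R) pbar_cusp).
Qed.

Lemma F0_continuous : {within region (T0 R), continuous F0}.
Proof.
apply/subspace_continuousP; rewrite region_T0 => -[t /SregE ht|_] U.
  change (nbhs (F0 (Some t)) U -> nbhs (Some t : S2) [set y | Sreg 1 y -> U (F0 y)]).
  rewrite F0_some // => /nbhsS_some[e e0 he].
  have /continuous_epsC /(_ e e0)[r r0 hr] := f0_continuous (T0f_strip ht).
  by apply/nbhsS_some; exists r => // w hw /SregE hT; rewrite F0_some //; apply/he/hr.
change (nbhs (F0 None) U -> nbhs (None : S2) [set y | Sreg 1 y -> U (F0 y)]).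
rewrite F0_none => /nbhsS_none[UN [M hM]].
apply/nbhsS_none; split; first by rewrite /= F0_none.
by exists (`|M| + 3) => w hw /SregE hT; rewrite F0_some //; apply/hM/f0_far.
Qed.

Lemma F0_image_closed : closed (F0 @` region (T0 R)).
Proof.
apply: compact_closed; first exact: hausdorffS.
apply: continuous_compact; first exact: F0_continuous.
by rewrite region_T0; apply: compactS; exact: closed_Sreg.
Qed.

(** The image of the interior is open since p' has no zero there. Inside [Ui] it coincides with the
    image of the compact triangle, since boundary points do not land in [Ui]; so it is also
    relatively closed. *)
Lemma f0_Ui_surj w : Ui w -> exists2 t, T0i t & f0 t = w.
Proof.
have [t0 h0 h1] := f0_base R => hw.
pose O : set C := [set w | exists2 t, T0i t & f0 t = w].
have oO : open O.
  rewrite openE => z [t Tt <-]; have [x x0 hx] := f0_open Tt ltr01.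
  by apply/nbhsC; exists x => // v /hx[s [Ts _ Es]]; exists s.
pose F : set C := [set w | (F0 @` region (T0 R)) (Some w)].
have cF : closed F.
  apply: (@closed_comp _ _ (Some : C -> S2)); last exact: F0_image_closed.
  by move=> z _ U /nbhsS_some[e e0 he]; apply/nbhsC; exists e.
apply: (side_clopen oO cF _ h1 hw); last by exists t0.
move=> z hz; split=> [[t Tt <-]|].
  exists (Some t); first by rewrite region_T0; apply/SregE/side_of_iW.
  by rewrite F0_some //; exact: side_of_iW.
move=> [[t|]]; rewrite region_T0; last by rewrite F0_none.
move=> /SregE Tt; rewrite F0_some // => -[E].
exists t => //; apply: contrapT => nT; apply: (f0_bd Tt nT); by rewrite E.
Qed.

(** An interior point sent into [Uf] but not into [Ui] would share its image with a boundary point,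
    against injectivity. So being sent into [Ui] and being sent outside [Uf] are complementary open
    conditions. *)
Lemma f0_T0i t : T0i t -> Ui (f0 t).
Proof.
have [t0 h0 h1] := f0_base R => ht.
pose O : set C := [set t | T0i t /\ Ui (f0 t)].
pose F : set C := ~` [set t | T0i t /\ ~ Uf (f0 t)].
have op (A : set C) : open A -> open [set t | T0i t /\ A (f0 t)].
  rewrite !openE => oA z [Tz Az]; have /nbhsC[e e0 he] := oA _ Az.
  have /continuous_epsC /(_ e e0)[r r0 hr] := f0_continuous (T0f_strip (side_of_iW Tz)).
  have /nbhsC[e1 e10 he1] := open_nbhs_nbhs (conj (@side_of_i_open R 1) Tz).
  apply/nbhsC; exists (Num.min r e1); first by rewrite lt_min r0.
  by move=> v; rewrite lt_min => /andP[v1 v2]; split; [exact: he1|exact/he/hr].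
have oO : open O by apply: op; exact: side_of_i_open.
have cF : closed F.
  by apply: open_closedC; apply: (op (~` Uf)); apply: closed_openC; exact: side_of_closed.
suff : O t by case.
apply: (side_clopen oO cF _ h0 ht); last by [].
move=> z Tz; split=> [[_ h] [_ hn]|nz]; first exact: hn (side_of_iW h).
split=> //; apply: contrapT => nU; apply: nz; split=> // hU.
have [s [Ts nTs E]] := f0_bd_surj hU nU.
by apply: nTs; rewrite (f0_inj (T0f_strip Ts) (T0f_strip (side_of_iW Tz)) E).
Qed.

Lemma f0_T0f t : T0f t -> Uf (f0 t).
Proof.
move=> ht; apply: side_of_closed => U /nbhsC[e e0 he].
have /continuous_epsC /(_ e e0)[r r0 hr] := f0_continuous (T0f_strip ht).
have [s hs st] := side_dense (expr1n _ _) ht r0.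
by exists (f0 s); split; [exact/side_of_iW/f0_T0i|exact/he/hr].
Qed.

Lemma F0_bij : set_bij (region (T0 R)) (Sreg (-1)) F0.
Proof.
rewrite region_T0; split.
- move=> [t /SregE ht|_]; last by rewrite F0_none; left.
  by rewrite F0_some //; apply/SregE/f0_T0f.
- move=> [t|] [s|]; rewrite !inE ?F0_none.
  + move=> /SregE ht /SregE hs; rewrite !F0_some // => -[E].
    by rewrite (f0_inj (T0f_strip ht) (T0f_strip hs) E).
  + by move=> /SregE ht _; rewrite F0_some.
  + by move=> _ /SregE hs; rewrite F0_some.
  + by [].
move=> [w /SregE hw|_]; last by exists None; [left|exact: F0_none].
have [/f0_Ui_surj[t /side_of_iW ht <-]|/f0_bd_surj[//|t [ht _ <-]]] := pselect (Ui w).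
  by exists (Some t); [exact/SregE|rewrite F0_some].
by exists (Some t); [exact/SregE|rewrite F0_some].
Qed.

Lemma F0_homeo : homeomorphism_onto (region (T0 R)) (Sreg (-1)) F0.
Proof.
apply: compact_homeo; [exact: None|by rewrite region_T0; apply: compactS; exact: closed_Sreg| | |].
- exact: hausdorffS.
- exact: F0_bij.
- exact: F0_continuous.
Qed.

End SphereTriangle.

(** * T0 as a circular arc triangle *)

Section FundamentalSides.
Variable R : realType.
Local Notation C := R[i].
Local Notation S2 := (sphere R).
Local Notation s3 := (Num.sqrt (3 : R)).
Local Notation T0f := (side_of (1 : R)).
Local Notation T0i := (side_of_i (1 : R)).
Local Notation I01 := (`[0, 1]%classic : set R).
Implicit Types (z w t : C) (x y : R).
#[local] Opaque f0.

Lemma ord3P (k : 'I_3) : [\/ k = 0, k = 1 | k = 2].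
Proof.
by case: k => [[|[|[|//]]] hk]; [constructor 1|constructor 2|constructor 3]; exact: val_inj.
Qed.

Lemma homeomorphism_inv (S U : topologicalType) (u0 : U) (X : set S) (Y : set U) (f : S -> U) :
  homeomorphism_onto X Y f -> exists g : U -> S,
  [/\ homeomorphism_onto Y X g, {in X, cancel f g} & {in Y, cancel g f}].
Proof.
move=> [[hf injf surjf] cf [g fK cg]]; exists g.
have gK : {in Y, cancel g f}.
  by move=> y; rewrite inE => /surjf[x Xx <-]; rewrite fK // inE.
split=> //; split=> //; last by exists f.
split.
- by move=> y /surjf[x Xx <-]; rewrite fK // inE.
- by move=> y y' Yy Yy' /(congr1 f); rewrite !gK.
- by move=> x Xx; exists (f x); [exact: hf|rewrite fK // inE].
Qed.

Definition arc (A : set S2) (a b : S2) : Prop :=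
  exists2 h : R -> S2, homeomorphism_onto I01 A h & h 0 = a /\ h 1 = b.

Lemma arc_of (A : set S2) (h : R -> S2) : set_bij I01 A h -> {within I01, continuous h} ->
  arc A (h 0) (h 1).
Proof.
move=> bh ch; exists h => //; apply: compact_homeo => //; first exact: 0.
  exact: segment_compact.
exact: hausdorffS.
Qed.

Lemma arc_sym (A : set S2) a b : arc A a b -> arc A b a.
Proof.
move=> [h [[hh injh surjh] ch _] [h0 h1]].
have rv s : I01 s -> I01 (1 - s).
  by rewrite /= !in_itv /= => /andP[? ?]; apply/andP; split; lra.
have := @arc_of A (fun s => h (1 - s)); rewrite subr0 subrr h0 h1; apply.
  split.
  - by move=> s /rv; exact: hh.
  - move=> s s'; rewrite !inE => /rv ss /rv ss' /injh; rewrite !inE => /(_ ss ss').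
    by move=> /addrI /oppr_inj.
  - by move=> z /surjh[s ss <-]; exists (1 - s); [exact: rv|congr h; ring].
apply/subspace_continuousP => s /rv ss U.
change (nbhs (h (1 - s)) U -> nbhs s [set y | I01 y -> U (h (1 - y))]) => hU.
have /subspace_continuousP /(_ _ ss _ hU) := ch.
change (nbhs (1 - s) [set y | I01 y -> U (h y)] -> nbhs s [set y | I01 y -> U (h (1 - y))]).
move=> /nbhs_ballP[e /= e0 he]; apply/nbhs_ballP; exists e => // y.
rewrite -ball_normE /= => hy /rv; apply: he; rewrite -ball_normE /=.
by rewrite (_ : 1 - s - (1 - y) = - (s - y)) ?normrN //; ring.
Qed.

Definition edge (k : 'I_3) : set S2 := Sreg 1 `&` circle_pts (T0_circle R k).

Lemma edge0E (z : S2) : edge 0 z <-> exists2 x, 0 <= x <= 2^-1 & z = Some (x +i* arcf x).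
Proof.
split=> [[h [t /= ht E]]|[x hx ->]].
  rewrite -E in h *; move/SregE: h => Tt.
  have nt : normc t = 1 by move: ht; rewrite subr0 normcE => -[].
  exists (Re t); first by case: Tt.
  congr Some; apply: eqReIm => //=; apply/eqP.
  have /T0fE[h1 h2 h3] := Tt.
  rewrite -(eqrXn2 (n := 2)) ?arcf_ge0 ?(ltW h2) // arcf_sqr //.
  by have := sqr_normcE t; rewrite nt => E1; apply/eqP; lra.
split; first by apply/SregE; split; rewrite //= subrr mulr0.
exists (x +i* arcf x) => //=; rewrite subr0 normcE; congr _%:C.
by apply/eqP; rewrite -(eqrXn2 (n := 2)) ?normc_ge0 // sqr_normcE /= arcf_sqr // subrKC expr1n.
Qed.

Lemma edge0_arc : arc (edge 0) (vertex (T0 R) 1) (vertex (T0 R) 2).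
Proof.
pose h (s : R) : S2 := Some (s / 2 +i* arcf (s / 2)).
have -> : vertex (T0 R) 1 = h 0.
  by rewrite /h mul0r arcf0 /=; congr Some; apply: eqReIm.
have -> : vertex (T0 R) 2 = h 1 by rewrite /h mul1r arcf_half.
apply: arc_of.
  split.
  - by move=> s; rewrite /= in_itv /= => /andP[s0 s1]; apply/edge0E; exists (s / 2) => //; apply/andP; split; lra.
  - by move=> s s' _ _ [] /(congr1 (fun x => x * 2)); rewrite !divfK.
  - move=> z /edge0E[x /andP[x0 x1] ->]; exists (2 * x).
      by rewrite /= in_itv /=; apply/andP; split; lra.
    by rewrite /h mulrC mulKf.
apply: continuous_subspaceT => s.
apply: (@continuous_comp _ _ _ (fun s : R => s / 2 +i* arcf (s / 2) : C) (Some : C -> S2)); last first.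
  exact: one_point_compactification_some_continuous.
have c2 : {for s, continuous (fun s : R => s / 2)} by apply: mulrr_continuous.
apply: continuousC_at => //=.
by apply: (@continuous_comp _ _ _ (fun s : R => s / 2) (@arcf R)) => //; exact: continuous_arcf.
Qed.

Definition ray x0 y0 : set S2 := [set None] `|` Some @` [set t | Re t = x0 /\ y0 <= Im t].

Lemma ray_arc x0 y0 : arc (ray x0 y0) (Some (x0 +i* y0)) None.
Proof.
(* s / (1 - s) increases from 0 to infinity on [0, 1). *)
pose h (s : R) : S2 := if s < 1 then Some (x0 +i* (y0 + s / (1 - s))) else None.
have h0 : h 0 = Some (x0 +i* y0) by rewrite /h ltr01 mul0r addr0.
have h1 : h 1 = None by rewrite /h ltxx.
rewrite -h0 -h1; apply: arc_of.
  split.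
  - move=> s; rewrite /= in_itv /= => /andP[s0 s1]; rewrite /h; case: ltP => [s1'|_]; last by left.
    right; eexists; last by reflexivity.
    by split=> //=; rewrite lerDl divr_ge0 // subr_ge0.
  - move=> s s'; rewrite !inE /= !in_itv /= => /andP[a1 a2] /andP[b1 b2].
    rewrite /h; case: ltP => [k1|k1]; case: ltP => [k2|k2] //; last by move=> _; lra.
    move=> [] /addrI E; have n1 : 1 - s != 0 by rewrite gt_eqF // subr_gt0.
    have n2 : 1 - s' != 0 by rewrite gt_eqF // subr_gt0.
    by move/eqP: E; rewrite eqr_div // => /eqP; lra.
  - move=> [z|]; last by exists 1; [rewrite /= in_itv /= ler01 lexx|].
    move=> [//|[t [/= h2 h3] [<-]]]; pose v := Im t - y0.
    have v0 : 0 <= v by rewrite subr_ge0.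
    have v1 : 0 < 1 + v by lra.
    have E : 1 - v / (1 + v) = (1 + v)^-1 by field; rewrite gt_eqF.
    exists (v / (1 + v)).
      rewrite /= in_itv /= divr_ge0 ?(ltW v1) //= ler_pdivrMr //; lra.
    rewrite /h ltr_pdivrMr // mul1r ltrDr ltr01 E invrK divfK ?gt_eqF //.
    by congr Some; apply: eqReIm => //=; rewrite /v subrKC.
apply/subspace_continuousP => s; rewrite /= in_itv /= => /andP[s0 s1] U.
change (nbhs (h s) U -> nbhs s [set y | I01 y -> U (h y)]).
have [k1|k1] := ltP s 1.
  rewrite {1}/h k1 => hU.
  have c : {for s, continuous (fun s : R => x0 +i* (y0 + s / (1 - s)) : C)}.
    apply: continuousC_at => /=; first exact: cst_continuous.
    apply: cvgD; first exact: cvg_cst.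
    apply: cvgM; first exact: cvg_id.
    apply: cvgV; first by rewrite gt_eqF // subr_gt0.
    by apply: cvgB; [exact: cvg_cst|exact: cvg_id].
  have k2 : nbhs s [set y | U (Some (x0 +i* (y0 + y / (1 - y))))] by exact: (c (Some @^-1` U) hU).
  have k3 : nbhs s [set y | y < 1] by exact: lt_nbhsl.
  refine (filterS _ (filterI k2 k3)) => y [/= y1 y2] _.
  by rewrite /h y2.
have -> : s = 1 by lra.
rewrite h1 => /nbhsS_none[UN [M hM]]; apply/nbhs_ballP.
pose K : R := `|M| + `|y0| + 1.
have K0 : 0 < K by rewrite ltr_wpDl // addr_ge0.
exists (1 + K)^-1; first by rewrite /= invr_gt0 addr_gt0.
move=> y; rewrite -ball_normE /= => hy; rewrite in_itv /= => /andP[y0' y1].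
rewrite /h; case: ltP => // y1'; apply: hM.
have d0 : 0 < 1 - y by rewrite subr_gt0.
have K1 : 0 < 1 + K by rewrite addr_gt0.
have d1 : (1 - y) * (1 + K) < 1.
  have := le_lt_trans (ler_norm _) hy; rewrite -(ltr_pM2r K1) mulVf //; exact: lt0r_neq0.
have : K < y / (1 - y) by rewrite ltr_pdivlMr //; lra.
have := Im_le_normc (x0 +i* (y0 + y / (1 - y))) => /=.
have := ler_norm M; have := ler_norm (- y0); rewrite normrN /K.
have := ler_norm (y0 + y / (1 - y)); lra.
Qed.

Lemma edge_ray k x0 y0 : circle_pts (T0_circle R k) = [set None] `|` Some @` [set t | Re t = x0] ->
  0 <= x0 <= 2^-1 -> arcf x0 = y0 -> edge k = ray x0 y0.
Proof.
move=> E hx hy; rewrite /edge E; apply/seteqP; split=> -[z|] //; try by split; left.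
- move=> [/SregE Tz [//|[t /= h [Et]]]]; right; exists z => //=; rewrite -Et h; split=> //.
  by case: Tz => _; rewrite -Et h hy mul1r subr_ge0.
- by move=> _; left.
- move=> [//|[t [/= h1 h2] [<-]]]; split; last by right; exists t.
  by apply/SregE; split; rewrite h1 // hy mul1r subr_ge0.
Qed.

Lemma edge1E : edge 1 = ray 2^-1 (s3 / 2).
Proof.
apply: edge_ray; last exact: arcf_half; last by rewrite lexx invr_ge0 ler0n.
by congr (_ `|` _); congr (_ @` _); apply/seteqP; split=> t /=; rewrite oppr0 cReM /= mul0r subr0 mul1r.
Qed.

Lemma edge2E : edge 2 = ray 0 1.
Proof.
apply: edge_ray; last exact: arcf0; last by rewrite lexx invr_ge0 ler0n.
by congr (_ `|` _); congr (_ @` _); apply/seteqP; split=> t /=; rewrite oppr0 cReM /= mul0r subr0 mul1r.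
Qed.

Lemma edge_arc k : arc (edge k) (vertex (T0 R) (ordS k)) (vertex (T0 R) (ord_pred k)).
Proof.
case: (ord3P k) => ->.
- rewrite (_ : ordS 0 = 1); last exact: val_inj.
  rewrite (_ : ord_pred 0 = 2); last exact: val_inj.
  exact: edge0_arc.
- rewrite (_ : ordS 1 = 2); last exact: val_inj.
  rewrite (_ : ord_pred 1 = 0); last exact: val_inj.
  by rewrite edge1E; exact: ray_arc.
- rewrite (_ : ordS 2 = 0); last exact: val_inj.
  rewrite (_ : ord_pred 2 = 1); last exact: val_inj.
  rewrite edge2E; apply: arc_sym; have := ray_arc 0 1.
  by congr (arc _ _ _); congr Some; apply: eqReIm.
Qed.

Lemma edge_meet k : edge k `&` edge (ordS k) = [set vertex (T0 R) (ord_pred k)].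
Proof.
have m01 (z : S2) : edge 0 z -> edge 1 z -> z = Some (rho R).
  move=> /edge0E[x hx ->]; rewrite edge1E => -[//|[t [/= h1 h2] [E]]].
  by have -> : x = 2^-1 by [rewrite -h1 E]; rewrite arcf_half.
have m20 (z : S2) : edge 0 z -> edge 2 z -> z = Some (ii R).
  move=> /edge0E[x hx ->]; rewrite edge2E => -[//|[t [/= h1 h2] [E]]].
  by have -> : x = 0 by [rewrite -h1 E]; rewrite arcf0.
have m12 (z : S2) : edge 1 z -> edge 2 z -> z = None.
  rewrite edge1E edge2E; case: z => [z|] // [//|[t [/= h1 _] [<-]]] [//|[u [/= h2 _] [E]]].
  by move: h1; rewrite -E h2 => /esym/eqP; rewrite invr_eq0 pnatr_eq0.
have v1 : edge 0 (Some (ii R)) by apply/edge0E; exists 0; rewrite ?lexx ?invr_ge0 ?ler0n ?arcf0.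
have v2 : edge 0 (Some (rho R)) by apply/edge0E; exists 2^-1; rewrite ?lexx ?invr_ge0 ?ler0n ?arcf_half.
have v1' : edge 2 (Some (ii R)) by rewrite edge2E; right; exists (ii R).
have v2' : edge 1 (Some (rho R)) by rewrite edge1E; right; exists (rho R).
have v0 : edge 1 None by rewrite edge1E; left.
have v0' : edge 2 None by rewrite edge2E; left.
case: (ord3P k) => ->.
- rewrite (_ : ordS 0 = 1); last exact: val_inj.
  rewrite (_ : ord_pred 0 = 2); last exact: val_inj.
  by apply/seteqP; split=> [z [a b]|_ ->]; [exact: m01|split].
- rewrite (_ : ordS 1 = 2); last exact: val_inj.
  rewrite (_ : ord_pred 1 = 0); last exact: val_inj.
  by apply/seteqP; split=> [z [a b]|_ ->]; [exact: m12|split].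
- rewrite (_ : ordS 2 = 0); last exact: val_inj.
  rewrite (_ : ord_pred 2 = 1); last exact: val_inj.
  by apply/seteqP; split=> [z [a b]|_ ->]; [exact: m20|split].
Qed.

Lemma boundary_T0 : boundary (region (T0 R)) = \bigcup_i edge i.
Proof.
rewrite region_T0 /boundary -(closure_id _).1; last exact: closed_Sreg.
rewrite interior_Sreg ?expr1n //; apply/seteqP; split.
- move=> [t [/SregE Tt nT]|_]; last by exists 1 => //; rewrite edge1E; left.
  have nT' : ~ T0i t by move=> h; apply: nT; exists t.
  case: (T0f_bdP Tt nT') => [h|h|[h _]].
  + exists 2 => //; rewrite edge2E; right; exists t => //; split=> //.
    by case: Tt => _; rewrite h arcf0 mul1r subr_ge0.
  + exists 1 => //; rewrite edge1E; right; exists t => //; split=> //.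
    by case: Tt => _; rewrite h arcf_half mul1r subr_ge0.
  + exists 0 => //; split; first exact/SregE.
    by exists t => //=; rewrite subr0 normcE h.
- move=> z [k _]; case: (ord3P k) => -> ek; (split; first by case: ek).
  + case/edge0E: ek => x _ -> [t [_ h] [E]].
    by move: h; rewrite E /= subrr mulr0 ltxx.
  + move: ek; rewrite edge1E => -[->|[u [/= h _] <-]] [t [/andP[_ h1] _]] //.
    by move=> [E]; move: h1; rewrite E h ltxx.
  + move: ek; rewrite edge2E => -[->|[u [/= h _] <-]] [t [/andP[h1 _] _]] //.
    by move=> [E]; move: h1; rewrite E h ltxx.
Qed.

(* Collapse the ray coordinate Im t - arcf (Re t) to tau in (0, 1], use Re t as
   an angle, and stretch the resulting half disk vertically to the disk. *)
Definition tau_of t : R := (1 + (Im t - arcf (Re t)))^-1.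
Definition abs_of t : R := tau_of t * (4 * Re t - 1).
Definition ord_of t : R := tau_of t * Num.sqrt (1 - (4 * Re t - 1) ^+ 2).
Definition to_disk (z : S2) : C :=
  if z is Some t then abs_of t +i* (2 * ord_of t - Num.sqrt (1 - abs_of t ^+ 2)) else - 'i%C.

Lemma to_disk_facts t : T0f t ->
  [/\ 0 < tau_of t <= 1, abs_of t ^+ 2 + ord_of t ^+ 2 = tau_of t ^+ 2, 0 <= ord_of t &
      0 <= 1 - abs_of t ^+ 2].
Proof.
move=> [/andP[x0 x1]]; rewrite mul1r => u0.
have v0 : 0 < 1 + (Im t - arcf (Re t)) by lra.
have t0 : 0 < tau_of t by rewrite invr_gt0.
have t1 : tau_of t <= 1 by rewrite invf_le1 //; lra.
have X1 : 0 <= 1 - (4 * Re t - 1) ^+ 2 by nra.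
have E : abs_of t ^+ 2 + ord_of t ^+ 2 = tau_of t ^+ 2.
  by rewrite /abs_of /ord_of !exprMn sqr_sqrtr //; ring.
split=> //; first by rewrite t0.
  by rewrite mulr_ge0 ?sqrtr_ge0 // ltW.
have := sqr_ge0 (ord_of t); have : tau_of t ^+ 2 <= 1 by rewrite expr_le1 // ltW.
lra.
Qed.

Lemma to_disk_bij : set_bij (Sreg 1) [set t : C | `|t| <= 1] to_disk.
Proof.
split.
- move=> [t /SregE Tt|_] /=; last by rewrite normrN normcE normc_i.
  have [/andP[t0 t1] E o0 a1] := to_disk_facts Tt.
  rewrite normcE lecR; apply: normc_le => //=.
  move: a1; set s := Num.sqrt _ => a1; have s0 : 0 <= s := sqrtr_ge0 _.
  have s2 : s ^+ 2 = 1 - abs_of t ^+ 2 by rewrite sqr_sqrtr.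
  have : tau_of t ^+ 2 <= 1 by rewrite expr_le1 // ltW.
  (* 0 <= ord <= s places the point in the upper half disk, and then 2 ord - s lies in [-s, s], the
     vertical chord of the disk. *)
  move=> k; have os : ord_of t <= s by rewrite -ler_sqr ?nnegrE // s2; lra.
  have : ord_of t * ord_of t <= ord_of t * s by rewrite ler_wpM2l.
  have -> : abs_of t ^+ 2 = 1 - s ^+ 2 by rewrite s2; ring.
  by rewrite expr1n; have := mulr_ge0 o0 s0; nra.
- have inj0 t : T0f t -> to_disk (Some t) = to_disk None -> False.
    move=> Tt; have [/andP[t0 t1] E o0 a1] := to_disk_facts Tt.
    move=> [] h1; rewrite h1 oppr0 expr0n /= subr0 sqrtr1 => h2.
    have o : ord_of t = 0 by lra.
    by move: E; rewrite h1 o oppr0 expr0n /= addr0 => /esym/eqP; rewrite expf_eq0 /= gt_eqF.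
  move=> [t|] [s|]; rewrite !inE.
  + move=> /SregE Tt /SregE Ts [] E1; rewrite -E1 => /addIr /(mulfI (_ : 2 != 0)).
    rewrite pnatr_eq0 => /(_ isT) E2.
    have [/andP[t0 t1] Et ot _] := to_disk_facts Tt.
    have [/andP[s0 s1] Es os _] := to_disk_facts Ts.
    have Et2 : tau_of t = tau_of s.
      by apply/eqP; rewrite -(eqrXn2 (n := 2)) ?(ltW t0) ?(ltW s0) // -Et -Es E1 E2.
    have /(congr1 (fun x => (x + 1) / 4)) Ex : 4 * Re t - 1 = 4 * Re s - 1.
      apply: (mulfI (_ : tau_of t != 0)); first by rewrite gt_eqF.
      by rewrite {2}Et2 -/(abs_of s) -E1.
    have Rx : Re t = Re s by move: Ex; rewrite !subrK ![4 * _]mulrC !mulfK ?pnatr_eq0.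
    congr Some; apply: eqReIm => //.
    by move/invr_inj: Et2; rewrite Rx => /addrI /addIr.
  + by move=> /SregE Tt _ /inj0 -/(_ Tt).
  + by move=> _ /SregE Ts /esym /inj0 -/(_ Ts).
  + by [].
move=> w; rewrite /= normcE lecR => nw.
have [a Ea] : exists a, a = Re w by eexists.
have [b' Eb] : exists b, b = Im w by eexists.
have nw2 : a ^+ 2 + b' ^+ 2 <= 1.
  by rewrite Ea Eb -sqr_normcE expr_le1 ?normc_ge0.
have a1 : 0 <= 1 - a ^+ 2 by have := sqr_ge0 b'; lra.
pose s := Num.sqrt (1 - a ^+ 2).
have s0 : 0 <= s := sqrtr_ge0 _.
have s2 : s ^+ 2 = 1 - a ^+ 2 by rewrite sqr_sqrtr.
have : `|b'| <= s by rewrite -ler_sqr ?nnegrE // real_normK ?num_real // s2; lra.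
rewrite ler_norml => /andP[b1 b2].
(* This undoes the vertical stretch. In the half disk, T is the distance of (a, b) from 0 and a / T
   the cosine of its angle; T = 0 corresponds to the cusp. *)
pose b := (b' + s) / 2.
have b0 : 0 <= b by rewrite /b; lra.
have bs : b <= s by rewrite /b; lra.
have ab : 0 <= a ^+ 2 + b ^+ 2 by rewrite addr_ge0 ?sqr_ge0.
pose T := Num.sqrt (a ^+ 2 + b ^+ 2).
have T0 : 0 <= T := sqrtr_ge0 _.
have T2 : T ^+ 2 = a ^+ 2 + b ^+ 2 by rewrite sqr_sqrtr.
have T1 : T <= 1.
  by rewrite -(ler_pXn2r (n := 2)) ?nnegrE // T2 expr1n; have : b ^+ 2 <= s ^+ 2 by [rewrite ler_sqr ?nnegrE]; lra.
have [Tz|Tn] := eqVneq T 0.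
  exists None; first by left.
  move: T2; rewrite Tz expr0n /= => /esym /eqP; rewrite paddr_eq0 ?sqr_ge0 //.
  rewrite !sqrf_eq0 => /andP[/eqP az /eqP bz].
  have s1 : s = 1 by rewrite /s az expr0n subr0 sqrtr1.
  by apply: eqReIm; rewrite /= -?Ea -?Eb ?az ?oppr0 //; move: bz; rewrite /b s1; lra.
have Tp : 0 < T by rewrite lt_def Tn.
pose X := a / T.
have X2 : 1 - X ^+ 2 = (b / T) ^+ 2.
  have aux (c d v : R) : v != 0 -> v ^+ 2 = c ^+ 2 + d ^+ 2 -> 1 - (c / v) ^+ 2 = (d / v) ^+ 2.
    move=> v0 Ev; rewrite !expr_div_n -[1](divff (expf_neq0 2 v0)) -mulrBl {1}Ev.
    by rewrite addrAC subrr add0r.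
  exact: aux.
have : `|X| <= 1.
  by rewrite -ler_sqr ?nnegrE // real_normK ?num_real // expr1n; have := sqr_ge0 (b / T); lra.
rewrite ler_norml => /andP[Xl Xu].
pose x := (X + 1) / 4.
pose t : C := x +i* (arcf x + (T^-1 - 1)).
have tauE : tau_of t = T by rewrite /tau_of /= [arcf x + _]addrC addrK subrKC invrK.
have E4 (Y : R) : 4 * ((Y + 1) / 4) - 1 = Y by field.
have ET (c : R) : T * (c / T) = c by rewrite mulrC divfK.
have absE : abs_of t = a by rewrite /abs_of tauE /= /x E4 ET.
have ordE : ord_of t = b.
  rewrite /ord_of tauE /= /x E4 X2 sqrtr_sqr ger0_norm ?ET //.
  exact: divr_ge0 b0 T0.
exists (Some t).
  apply/SregE; split; rewrite /=; first by rewrite /x; apply/andP; split; lra.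
  by rewrite mul1r [arcf x + _]addrC addrK subr_ge0 invf_ge1.
rewrite /to_disk absE ordE -/s; apply: eqReIm; rewrite /= -?Ea -?Eb //.
by rewrite /b; lra.
Qed.

Lemma to_disk_continuous : {within Sreg 1, continuous to_disk}.
Proof.
apply/subspace_continuousP => -[t /SregE Tt|_] U.
  change (nbhs (to_disk (Some t)) U -> nbhs (Some t : S2) [set y | Sreg 1 y -> U (to_disk y)]) => hU.
  have c : {for t, continuous (fun t => to_disk (Some t))}.
    have ca (f : C -> R) : {for t, continuous f} -> {for t, continuous (fun t => Num.sqrt (1 - f t ^+ 2))}.
      move=> cf; apply: (@continuous_comp _ _ _ (fun t => 1 - f t ^+ 2) (@Num.sqrt R)); last exact: sqrt_continuous.
      have -> : (fun t => 1 - f t ^+ 2) = (fun t => -1 * (f t * f t - 1)) by apply/funext => v; ring.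
      apply: continuous_mulB; last exact: cst_continuous.
      exact: (cvgM cf cf).
    have c4 : {for t, continuous (fun t : C => 4 * Re t - 1)}.
      have -> : (fun t : C => 4 * Re t - 1) = (fun t : C => 4 * (Re t - 4^-1)) by apply/funext => v; field.
      by apply: continuous_mulB; [exact: continuous_Re|exact: cst_continuous].
    have ct : {for t, continuous tau_of}.
      have hu : 1 + (Im t - arcf (Re t)) != 0 by case: Tt => _; rewrite mul1r => h; rewrite gt_eqF //; lra.
      apply: (@continuous_comp _ _ _ (fun t => 1 + (Im t - arcf (Re t))) (fun x : R => x^-1)); last exact: inv_continuous.
      have -> : (fun t => 1 + (Im t - arcf (Re t))) = (fun t => 1 * (1 * (Im t - arcf (Re t)) - (-1))) by apply/funext => v; ring.
      by apply: continuous_mulB; [exact: continuous_height|exact: cst_continuous].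
    have cab : {for t, continuous abs_of} by exact: (cvgM ct c4).
    have cor : {for t, continuous ord_of} by exact: (cvgM ct (ca _ c4)).
    apply: continuousC_at => //=.
    have -> : (fun t => 2 * ord_of t - Num.sqrt (1 - abs_of t ^+ 2)) = (fun t => 1 * (2 * (ord_of t - 0) - Num.sqrt (1 - abs_of t ^+ 2))) by apply/funext => v; ring.
    by apply: continuous_mulB; [apply: continuous_mulB; [|exact: cst_continuous]|exact: ca].
  have /nbhsC[e e0 he] := c U hU; apply/nbhsS_some; exists e => // w hw _; exact: he.
change (nbhs (to_disk None) U -> nbhs (None : S2) [set y | Sreg 1 y -> U (to_disk y)]).
move=> /nbhsC[e e0 he]; apply/nbhsS_none; split; first by move=> _; apply: he; rewrite subrr normc0.
(* Beyond this modulus tau < e/4, and the two coordinates differ from their limits by at most tau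
   and 3 tau. *)
exists (4 + 4 / e) => t ht /SregE Tt; apply: he.
have [/andP[t0 t1] E o0 a1] := to_disk_facts Tt.
case: (Tt) => hx; rewrite mul1r => u0; have /andP[_ r1] := arcf_bounds hx.
have Im0 := T0f_Im Tt; have := normc_le_ReIm t; rewrite (gtr0_norm Im0).
have /andP[x0 x1] := hx; rewrite (ger0_norm x0) => nt.
have tE : tau_of t * 4 < e.
  rewrite /tau_of mulrC ltr_pdivrMr; last by lra.
  have : 4 / e < 1 + (Im t - arcf (Re t)) by lra.
  by rewrite ltr_pdivrMr // mulrC.
have at1 : `|abs_of t| <= tau_of t.
  rewrite -ler_sqr ?nnegrE ?(ltW t0) // real_normK ?num_real // -E.
  by rewrite lerDl sqr_ge0.
have ot : ord_of t <= tau_of t.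
  by rewrite -ler_sqr ?nnegrE ?(ltW t0) // -E lerDr sqr_ge0.
have a2 : abs_of t ^+ 2 <= tau_of t.
  apply: (@le_trans _ _ (tau_of t ^+ 2)); first by rewrite -E lerDl sqr_ge0.
  by rewrite expr2 ler_piMl // ltW.
have s1 : 1 - abs_of t ^+ 2 <= Num.sqrt (1 - abs_of t ^+ 2).
  rewrite -ler_sqr ?nnegrE ?sqrtr_ge0 // sqr_sqrtr // expr2 ler_piMl //.
  by rewrite gerBl sqr_ge0.
have s2 : Num.sqrt (1 - abs_of t ^+ 2) <= 1.
  by rewrite -[X in _ <= X](sqrtr1 R) ler_wsqrtr // gerBl sqr_ge0.
rewrite opprK; apply: le_lt_trans tE; apply: le_trans (normc_le_ReIm _) _.
rewrite !cE /= addr0.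
have : `|2 * ord_of t - Num.sqrt (1 - abs_of t ^+ 2) + 1| <= 3 * tau_of t.
  rewrite ger0_norm; lra.
lra.
Qed.

Lemma jordan_T0 : closed_jordan_region (region (T0 R)).
Proof.
rewrite region_T0; have cS := compactS (@closed_Sreg R 1); split=> //.
have := compact_homeo (None : S2) cS (@hausdorffC R) to_disk_bij to_disk_continuous.
by move=> /(homeomorphism_inv (0 : C))[g [hg _ _]]; exists g.
Qed.

End FundamentalSides.

(** * Holomorphic maps of the sphere *)

Section Holomorphy.
Variable R : realType.
Local Notation C := R[i].
Local Notation S2 := (sphere R).
Implicit Types (z w t d h : C) (a b c : S2) (u v : C -> C) (f g : S2 -> S2).
#[local] Opaque f0.

(** The o(h) form of the derivative, equivalent to [derivable]. The weaker remainder compared with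
    [sder] is all that library derivability in charts supplies. *)
Definition cder u z d := forall e : R, 0 < e -> exists2 r : R, 0 < r &
  forall h, normc h < r -> normc (u (z + h) - u z - d * h) <= e * normc h.

Lemma sder_cder u z d : sder u z d -> cder u z d.
Proof.
move=> [K [r [K0 r0 hK]]] e e0.
exists (Num.min r (e / (K + 1))); first by rewrite lt_min r0 divr_gt0 // ltr_wpDl.
move=> h; rewrite lt_min => /andP[h1 h2]; apply: le_trans (hK h (ltW h1)) _.
rewrite ltr_pdivlMr ?ltr_wpDl // in h2.
by rewrite expr2 mulrA ler_wpM2r ?normc_ge0 //; have := normc_ge0 h; lra.
Qed.

Lemma cder_derivable u z : (exists d, cder u z d) <-> derivable u z (1 : C).
Proof.
split=> [[d hd]|].
  apply/cvg_ex; exists d; apply/cvgrPdist_lt => eps eps0.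
  have e0 : 0 < Re eps by move: eps0; rewrite ltcE => /andP[].
  have [r r0 hr] := hd (Re eps / 2) (divr_gt0 e0 (ltr0n R 2)).
  change (nbhs (0 : C) [set h | h != 0 -> `|d - h^-1 *: (u (h *: (1 : C) + z) - u z)| < eps]).
  apply/nbhsC; exists r => // h; rewrite subr0 => hh h0.
  have nh : 0 < normc h by rewrite normc_gt0.
  have {}hr := hr h hh; rewrite normcE (_ : eps = (Re eps)%:C); last first.
    by move: eps0; rewrite ltcE => /andP[/eqP i0 _]; apply: eqReIm.
  rewrite ltcR normcBC /GRing.scale /= mulr1 [h + z]addrC.
  have -> : h^-1 * (u (z + h) - u z) - d = h^-1 * (u (z + h) - u z - d * h) by field.
  rewrite normcM normcV mulrC ltr_pdivrMr //; apply: le_lt_trans hr _.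
  by rewrite ltr_pM2r //; lra.
move=> /cvg_ex[d /cvgrPdist_lt hd]; exists d => e e0.
have e1 : (0 : C) < e%:C by rewrite ltcR.
have : nbhs (0 : C) [set h | h != 0 -> `|d - h^-1 *: (u (h *: (1 : C) + z) - u z)| < e%:C] by exact: hd.
move=> /nbhsC[r r0 hr]; exists r => // h hh.
have [->|h0] := eqVneq h 0; first by rewrite addr0 subrr mulr0 subr0 normc0 mulr0.
have nh : 0 < normc h by rewrite normc_gt0.
have := hr h; rewrite subr0 => /(_ hh h0).
rewrite normcE ltcR normcBC /GRing.scale /= mulr1 [h + z]addrC.
have -> : h^-1 * (u (z + h) - u z) - d = h^-1 * (u (z + h) - u z - d * h) by field.
by rewrite normcM normcV mulrC ltr_pdivrMr // => /ltW.
Qed.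

Lemma cder_ext u v z d : nbhs z [set t | u t = v t] -> cder u z d -> cder v z d.
Proof.
move=> /nbhsC[r r0 hr] hu e e0; have [r' r'0 hr'] := hu e e0.
exists (Num.min r r'); first by rewrite lt_min r0.
move=> h; rewrite lt_min => /andP[h1 h2].
have <- : u z = v z by apply: hr; rewrite subrr normc0.
have <- : u (z + h) = v (z + h) by apply: hr; rewrite [z + h]addrC addrK.
exact: hr'.
Qed.

Lemma cder_comp u v z d d' : cder u z d -> cder v (u z) d' -> cder (v \o u) z (d' * d).
Proof.
move=> hu hv e e0.
have n0 := normc_ge0 d; have n0' := normc_ge0 d'.
have k0 : 0 < 2 * (normc d + 1) by rewrite mulr_gt0 // ltr_wpDl.
have k0' : 0 < 2 * (normc d' + 1) by rewrite mulr_gt0 // ltr_wpDl.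
pose e1 := Num.min 1 (e / (2 * (normc d' + 1))).
have e10 : 0 < e1 by rewrite lt_min ltr01 divr_gt0.
have e11 : e1 <= 1 by rewrite ge_min lexx.
have e12 : e1 * (2 * (normc d' + 1)) <= e by rewrite -ler_pdivlMr // ge_min lexx orbT.
have [r r0 hr] := hu e1 e10.
have [r' r'0 hr'] := hv (e / (2 * (normc d + 1))) (divr_gt0 e0 k0).
exists (Num.min r (r' / (normc d + 1))); first by rewrite lt_min r0 divr_gt0 // ltr_wpDl.
move=> h; rewrite lt_min ltr_pdivlMr ?ltr_wpDl // => /andP[/hr h1 h2].
have nh := normc_ge0 h.
pose k := u (z + h) - u z.
have nk : normc k <= (normc d + 1) * normc h.
  have := normcD (k - d * h) (d * h); rewrite subrK normcM => h3.
  have : e1 * normc h <= 1 * normc h by rewrite ler_wpM2r.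
  by rewrite -/k in h1; lra.
have := hr' k; rewrite (_ : u z + k = u (z + h)); last by rewrite /k subrKC.
move=> /(_ ltac:(lra)) h3; rewrite /=.
have -> : v (u (z + h)) - v (u z) - d' * d * h = (v (u (z + h)) - v (u z) - d' * k) + d' * (k - d * h).
  by ring.
apply: le_trans (normcD _ _) _; rewrite normcM.
have q1 : e / (2 * (normc d + 1)) * normc k <= e / 2 * normc h.
  have -> : e / 2 * normc h = e / (2 * (normc d + 1)) * ((normc d + 1) * normc h).
    by field; rewrite gt_eqF // ltr_wpDl.
  by rewrite ler_wpM2l // divr_ge0 // ltW.
have q2 : normc d' * normc (k - d * h) <= normc d' * (e1 * normc h) by rewrite ler_wpM2l.
have q3 : e1 * (2 * (normc d' + 1)) * normc h <= e * normc h by rewrite ler_wpM2r.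
have q4 : 0 <= e1 * normc h by rewrite mulr_ge0 // ltW.
lra.
Qed.

Lemma cder_conj u z d : cder u z d -> cder (conjc \o u \o conjc) (conjc z) (conjc d).
Proof.
move=> hu e /hu[r r0 hr]; exists r => // h hh /=.
have -> : conjc (u (conjc (conjc z + h))) - conjc (u (conjc (conjc z))) - conjc d * h =
    conjc (u (z + conjc h) - u z - d * conjc h).
  by rewrite !cJD !cJN cJM !conjcK.
by rewrite normcJ' -(normcJ' h); apply: hr; rewrite normcJ'.
Qed.

Lemma sinvK : involutive (@sinv R).
Proof.
move=> [z|] /=; last by rewrite eqxx.
by case: (eqVneq z 0) => [->|z0] //=; rewrite invr_eq0 (negbTE z0) invrK.
Qed.

Lemma cinv_continuous z : z != 0 -> {for z, continuous (fun t : C => t^-1)}.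
Proof. by move=> z0; apply: sder_continuous (sder_inv z0). Qed.

Lemma sinv_continuous : continuous (@sinv R).
Proof.
move=> [z|] U.
  rewrite /sinv /=; case: (eqVneq z 0) => [->|z0].
    move=> /nbhsS_none[UN [M hM]]; apply/nbhsS_some.
    exists (`|M| + 1)^-1; first by rewrite invr_gt0 ltr_wpDl.
    move=> w; rewrite subr0 /= => hw; case: eqVneq => [//|w0]; apply: hM.
    have nw : 0 < normc w by rewrite normc_gt0.
    rewrite normcV; apply: (@lt_trans _ _ (`|M| + 1)).
      by rewrite ltr_pwDr // ler_norm.
    by rewrite -[X in X < _]invrK ltf_pV2 ?posrE // invr_gt0 ltr_wpDl.
  move=> hU; have k1 : nbhs z [set t | U (Some t^-1)] by exact: (cinv_continuous z0 hU).
  have k2 : nbhs z [set t : C | t != 0].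
    apply/nbhsC; exists (normc z); first by rewrite normc_gt0.
    by move=> w; apply: contraTneq => ->; rewrite sub0r normcN ltxx.
  change (nbhs z [set t | U (if t == 0 then None else Some t^-1)]).
  by refine (filterS _ (filterI k1 k2)) => t [/= h1 /negbTE ->].
move=> /nbhsS_some[e e0 he]; apply/nbhsS_none; split; first by apply: he; rewrite subrr normc0.
exists e^-1 => w hw /=; have w0 : w != 0.
  by rewrite -normc_gt0; apply: lt_trans hw; rewrite invr_gt0.
rewrite (negbTE w0); apply: he; rewrite subr0 normcV.
by rewrite -[X in _ < X]invrK ltf_pV2 ?posrE ?invr_gt0 ?normc_gt0.
Qed.

Lemma sconj_continuous : continuous (@sconj R).
Proof.
move=> [z|] U /=.
  move=> /nbhsS_some[e e0 he]; apply/nbhsS_some; exists e => // w hw; apply: he.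
  by rewrite -cJN -cJD normcJ'.
move=> /nbhsS_none[UN [M hM]]; apply/nbhsS_none; split=> //.
by exists M => w hw; apply: hM; rewrite normcJ'.
Qed.

Lemma sconjK : involutive (@sconj R).
Proof. by case=> [z|] //=; rewrite conjcK. Qed.

Definition saff z : S2 -> S2 := omap (fun t => z - t).

Lemma saff_continuous z : continuous (saff z).
Proof.
move=> [w|] U /=.
  move=> /nbhsS_some[e e0 he]; apply/nbhsS_some; exists e => // v hv; apply: he.
  by rewrite (_ : z - v - (z - w) = w - v); [rewrite normcBC|ring].
move=> /nbhsS_none[UN [M hM]]; apply/nbhsS_none; split=> //.
exists (M + normc z) => w hw; apply: hM.
by have := lenB w z; rewrite (normcBC z); lra.
Qed.

Lemma unchartK a : unchart a (chart a a) = a.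
Proof. by case: a => [z|] //=; rewrite eqxx. Qed.

Lemma unchart_continuous a : {for chart a a, continuous (unchart a)}.
Proof.
case: a => [z|]; first exact: one_point_compactification_some_continuous.
by move=> U hU; exact: (@sinv_continuous (Some 0)).
Qed.

Lemma chartK_near a : nbhs a [set z | unchart a (chart a z) = z].
Proof.
case: a => [z|]; first by apply/nbhsS_some; exists 1.
apply/nbhsS_none; split; first by rewrite /= eqxx.
exists 0 => w; rewrite normc_gt0 => w0.
change (sinv (Some (odflt 0 (sinv (Some w)))) = Some w).
by rewrite /sinv (negbTE w0) /= invr_eq0 (negbTE w0) invrK.
Qed.

Lemma holo_def f a : holomorphic_at f a <->
  {for a, continuous f} /\ exists d, cder (fun t => chart (f a) (f (unchart a t))) (chart a a) d.
Proof. by rewrite /holomorphic_at; split=> -[h1 /cder_derivable h2]. Qed.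

(** In charts the composite is the product of the two local expressions only near the point, where
    continuity keeps f within the range in which chart and inverse chart cancel. *)
Lemma holo_comp f g a : holomorphic_at f a -> holomorphic_at g (f a) -> holomorphic_at (g \o f) a.
Proof.
move=> /holo_def[cf [d hd]] /holo_def[cg [d' hd']]; apply/holo_def; split.
  exact: continuous_comp.
exists (d' * d) => /=.
pose u t := chart (f a) (f (unchart a t)); pose v s := chart (g (f a)) (g (unchart (f a) s)).
have ua : u (chart a a) = chart (f a) (f a) by rewrite /u unchartK.
apply: (@cder_ext (v \o u)); last by apply: cder_comp => //; rewrite ua.
have cfu : {for chart a a, continuous (f \o unchart a)}.
  apply: continuous_comp; first exact: unchart_continuous.
  by rewrite unchartK.
have := @chartK_near (f a); rewrite -{1}(unchartK a) => /cfu.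
change (nbhs (chart a a) [set t | unchart (f a) (chart (f a) (f (unchart a t))) = f (unchart a t)] ->
  nbhs (chart a a) [set t | (v \o u) t = chart (g (f a)) (g (f (unchart a t)))]).
by apply: filterS => t /= ht; rewrite /v /u ht.
Qed.

Lemma holo_ext f g a : nbhs a [set z | f z = g z] -> holomorphic_at f a -> holomorphic_at g a.
Proof.
move=> h /holo_def[cf [d hd]].
have E : f a = g a by exact: nbhs_singleton h.
apply/holo_def; split.
  move=> U; rewrite -E => /cf hU.
  by refine (filterS _ (filterI h hU)) => z [/= hz]; rewrite hz.
exists d; apply: cder_ext hd; rewrite -E.
have := h; rewrite -{1}(unchartK a) => /unchart_continuous.
change (nbhs (chart a a) [set t | f (unchart a t) = g (unchart a t)] ->
  nbhs (chart a a) [set t | chart (f a) (f (unchart a t)) = chart (f a) (g (unchart a t))]).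
by apply: filterS => t /= ->.
Qed.

Lemma holo_conj f a : holomorphic_at f a -> holomorphic_at (@sconj R \o f \o @sconj R) (sconj a).
Proof.
move=> /holo_def[cf [d hd]]; apply/holo_def; split.
  apply: continuous_comp; first exact: sconj_continuous.
  apply: continuous_comp; last exact: sconj_continuous.
  by rewrite sconjK.
exists (conjc d); have := cder_conj hd => /=; rewrite sconjK.
have cJ b (z : S2) : conjc (chart b z) = chart (sconj b) (sconj z).
  case: b z => [b|] [z|]; [by []|exact: conjc0| |exact: conjc0].
  change (conjc (odflt 0 (sinv (Some z))) = odflt 0 (sinv (Some (conjc z)))).
  by rewrite /sinv conjc_eq0; case: eqP => _; [exact: conjc0|exact: cJV].
have uJ b t : sconj (unchart (sconj b) t) = unchart b (conjc t).
  by case: b => [b|] //=; rewrite conjc_eq0; case: eqP => //= _; rewrite cJV.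
rewrite cJ; apply: cder_ext; apply: filterS filterT => t _ /=.
by rewrite cJ uJ.
Qed.

Lemma cder_id z : cder id z 1.
Proof. by apply/sder_cder/sder_id. Qed.

Lemma holo_sinv a : holomorphic_at (@sinv R) a.
Proof.
apply/holo_def; split; first exact: sinv_continuous.
(* At 0 and at infinity the source and the target use opposite charts, in which the inversion is the
   identity. *)
have idc b t : sinv b = None \/ b = None -> chart (sinv b) (sinv (unchart b t)) = t.
  case: b => [z|] /= [] //; last by rewrite -[if _ then _ else _]/(sinv (Some t)) sinvK.
  by case: eqP => // _ _; rewrite -[if _ then _ else _]/(sinv (Some t)) /chart sinvK.
have [h|h] := pselect (sinv a = None \/ a = None).
  exists 1; apply: (@cder_ext id); last exact: cder_id.
  by apply: filterS filterT => t _ /=; rewrite idc.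
case: a h => [z|] h; last by case: h; right.
have z0 : z != 0 by apply/eqP => E; case: h; left; rewrite E /= eqxx.
exists (- z ^- 2); apply: (@cder_ext (fun t => t^-1)); last first.
  by apply: sder_cder; exact: sder_inv.
rewrite /= (negbTE z0) /=; apply/nbhsC; exists (normc z); first by rewrite normc_gt0.
move=> w hw; have w0 : w != 0 by apply: contraTneq hw => ->; rewrite sub0r normcN ltxx.
by rewrite /= (negbTE w0).
Qed.

Lemma holo_saff z a : holomorphic_at (saff z) a.
Proof.
apply/holo_def; split; first exact: saff_continuous.
case: a => [w|] /=.
  exists (-1) => e e0; exists 1 => // h _.
  have -> : z - (w + h) - (z - w) - -1 * h = 0 by ring.
  by rewrite normc0 mulr_ge0 ?normc_ge0 // ltW.
(* At infinity the chart expression is h / (z h - 1), with derivative -1 at 0. *)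
exists (-1) => e e0.
have n0 := normc_ge0 z.
exists (Num.min (2 * (normc z + 1))^-1 (e / (2 * (normc z + 1)))).
  by rewrite lt_min invr_gt0 divr_gt0 // mulr_gt0 // ltr_wpDl.
have k0 : 0 < 2 * (normc z + 1) by rewrite mulr_gt0 // ltr_wpDl.
move=> h; rewrite lt_min ltr_pdivlMr // => /andP[h1 h2].
have [->|h0] := eqVneq h 0; first by rewrite addr0 subrr mulr0 subr0 normc0 mulr0.
rewrite !add0r eqxx /= subr0.
rewrite (negbTE h0) /chart /=.
have nh : 0 < normc h by rewrite normc_gt0.
have h3 : normc h * (2 * (normc z + 1)) < 1 by rewrite -ltr_pdivlMr // div1r.
have nzh : normc (z * h) <= 1 / 2 by rewrite normcM; lra.
have d1 : 1 / 2 <= normc (z * h - 1).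
  by have := lenB 1 (z * h); rewrite normc1 (normcBC 1); lra.
have d0 : z * h - 1 != 0 by rewrite -normc_gt0; lra.
have E : z - h^-1 = (z * h - 1) / h by field.
have -> : (z - h^-1 == 0) = false by rewrite E mulf_eq0 invr_eq0 (negbTE d0) (negbTE h0).
rewrite /= E invf_div mulN1r opprK.
have -> : h / (z * h - 1) + h = z * h * h / (z * h - 1) by field.
rewrite !normcM normcV ler_pdivrMr; last by lra.
have q : normc z * normc h * normc h <= e / 2 * normc h by rewrite ler_wpM2r //; lra.
have : e * normc h * (1 / 2) <= e * normc h * normc (z * h - 1).
  by rewrite ler_wpM2l // mulr_ge0 // ltW.
lra.
Qed.

Lemma holo_pc t : side_of_i 1 t -> holomorphic_at (@sconj R \o @F0 R) (Some t).
Proof.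
move=> Tt; have [e e0 he] := T0i_open_pc Tt.
apply: (@holo_ext (omap (@pc R))).
  apply/nbhsS_some; exists e => // s /ltW /he[Ts _] /=.
  by rewrite F0_some; [rewrite /= f0_conj|exact: side_of_iW].
have [_ [d _ sd]] := he t ltac:(by rewrite subrr normc0 ltW).
apply/holo_def; split.
  move=> U /nbhsS_some[x x0 hx].
  have /continuous_epsC /(_ x x0)[r r0 hr] := sder_continuous sd.
  by apply/nbhsS_some; exists r => // s /hr; exact: hx.
by exists d => /=; exact: sder_cder.
Qed.

(** Local surjectivity with control of the distance yields continuity of the inverse; the derivative
    1 / p' then follows from the expansion of p. *)
Lemma F0_inv_holo (G : S2 -> S2) w : {in region (T0 R), cancel (@F0 R) G} ->
  side_of_i (-1) w -> holomorphic_at (@sconj R \o G) (Some w).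
Proof.
move=> FK hw; have [t Tt Ew] := f0_Ui_surj hw.
have Gf s : side_of_i 1 s -> G (Some (f0 s)) = Some s.
  move=> /side_of_iW Ts; rewrite -F0_some // FK // inE region_T0; exact/SregE.
have Tr : side_of_i 1 t /\ t != rho R by split=> //; exact: T0i_neq_rho.
have d0 : pd t != 0 by apply: pd_neq0; [exact/T0f_strip/side_of_iW|case: Tr].
have sd : cder (@pc R) t (pd t) by apply/sder_cder/pc_sder/strip_small/T0f_strip/side_of_iW.
have nd : 0 < normc (pd t) by rewrite normc_gt0.
suff : holomorphic_at (G \o @sconj R) (Some (conjc w)).
  move=> /holo_conj; rewrite /= conjcK; apply: holo_ext; apply: filterS filterT => z _ /=.
  by rewrite sconjK.
pose V (v : C) : C := odflt 0 (G (Some (conjc v))).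
(* Near conj w the map G o conj is inverse to the univalent function pc. *)
have near (e : R) : 0 < e -> exists2 x : R, 0 < x & forall h, normc h < x ->
    exists s, [/\ side_of_i 1 s, normc (s - t) <= e, pc s = conjc w + h & G (Some (conjc (conjc w + h))) = Some s].
  move=> e0; have [x x0 hx] := f0_open Tt e0.
  exists x => // h hh; have [|s [Ts st Es]] := hx (w + conjc h).
    by rewrite Ew addrC addKr normcJ'.
  exists s; split=> //; first by rewrite -f0_conj Es cJD conjcK.
  by rewrite cJD conjcK -Es Gf.
have Gw : G (Some (conjc (conjc w))) = Some t by rewrite conjcK -Ew Gf.
have pt : pc t = conjc w by rewrite -Ew f0_conj.
apply/holo_def; split.
  move=> U; rewrite /= Gw => /nbhsS_some[e e0 he]; apply/nbhsS_some.
  have [x x0 hx] := near (e / 2) (divr_gt0 e0 (ltr0n R 2)).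
  exists x => // v hv; have [s [_ st _ Gs]] := hx (v - conjc w) hv.
  by rewrite subrKC in Gs; rewrite /= Gs; apply: he; lra.
exists (pd t)^-1; rewrite /= Gw; change (cder V (conjc w) (pd t)^-1) => e e0.
pose e1 := Num.min (normc (pd t) / 2) (e * (normc (pd t) ^+ 2 / 2)).
have e10 : 0 < e1 by rewrite lt_min divr_gt0 // mulr_gt0 // divr_gt0 // exprn_gt0.
have e11 : e1 <= normc (pd t) / 2 by rewrite ge_min lexx.
have e12 : e1 <= e * (normc (pd t) ^+ 2 / 2) by rewrite ge_min lexx orbT.
have [r r0 hr] := sd e1 e10.
have [x x0 hx] := near (r / 2) (divr_gt0 r0 (ltr0n R 2)).
exists x => // h /hx[s [_ st Es Gs]]; rewrite /V Gs Gw /=.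
have := hr (s - t) ltac:(lra); rewrite subrKC Es pt [conjc w + h]addrC addrK => hh.
have ns := normc_ge0 (s - t).
(* The derivative bounds the displacement of the preimage linearly: |s - t| <= 2 |h| / |p'|. *)
have b1 : normc (s - t) * (normc (pd t) / 2) <= normc h.
  have := lenB (pd t * (s - t)) (- (h - pd t * (s - t))); rewrite opprK subrKC normcN normcM => q.
  have : e1 * normc (s - t) <= normc (pd t) / 2 * normc (s - t) by rewrite ler_wpM2r.
  lra.
have -> : s - t - (pd t)^-1 * h = - ((h - pd t * (s - t)) / pd t) by field.
rewrite normcN normcM normcV ler_pdivrMr //; apply: le_trans hh _.
have q1 : e1 * normc (s - t) <= e * (normc (pd t) ^+ 2 / 2) * normc (s - t) by rewrite ler_wpM2r.
have q2 : e * normc (pd t) * (normc (s - t) * (normc (pd t) / 2)) <= e * normc (pd t) * normc h.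
  by rewrite ler_wpM2l // mulr_ge0 // ltW.
rewrite expr2 in q1; lra.
Qed.

End Holomorphy.

(** * Transport by the reflection group *)

Section Transport.
Variable R : realType.
Local Notation C := R[i].
Local Notation S2 := (sphere R).
Implicit Types (z w t : C) (a : S2) (A b D : R).
#[local] Opaque f0.

(* The Hermitian form A |t|^2 + 2 Re (conj (b1 + i b2) t) + D, whose sign cuts
   out the disks of the sphere; at infinity only A matters. *)
Definition feval A b1 b2 D (a : S2) : R :=
  if a is Some t then A * (Re t ^+ 2 + Im t ^+ 2) + 2 * (b1 * Re t + b2 * Im t) + D else A.

(** Positive discriminant: the zero set is a true circle or line, neither empty nor a single
    point. *)
Definition feval_proper A b1 b2 D : Prop := 0 < b1 ^+ 2 + b2 ^+ 2 - A * D.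

(** Preimages of circles and of their disks are again of this kind. Only signs are compared because
    a form is pulled back up to a positive factor. *)
Definition pullback_forms (S : S2 -> S2) : Prop :=
  forall A b1 b2 D, feval_proper A b1 b2 D -> exists A' b1' b2' D',
    feval_proper A' b1' b2' D' /\
    forall a, Num.sg (feval A b1 b2 D (S a)) = Num.sg (feval A' b1' b2' D' a).

(** What is needed to carry the statement from T0 to S(T0). Antiholomorphy of f is expressed by
    holomorphy of conj o f; conjugation by S preserves it whether S is holomorphic or
    antiholomorphic. *)
Definition transports (S S' : S2 -> S2) : Prop :=
  [/\ cancel S S' /\ cancel S' S, continuous S /\ continuous S',
      (forall a, HH a -> HH (S a) /\ pbar (S a) = S (pbar a)) /\
        (forall a, HH a -> HH (S' a)),
      pullback_forms S /\ pullback_forms S' &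
      forall (f : S2 -> S2) a, holomorphic_at (@sconj R \o f) a ->
        holomorphic_at (@sconj R \o (S \o f \o S')) (S a)].

Lemma pullback_forms_comp S1 S2' : pullback_forms S1 -> pullback_forms S2' ->
  pullback_forms (S1 \o S2').
Proof.
move=> h1 h2 A b1 b2 D /h1[A1 [c1 [c2 [D1 [/h2[A2 [d1 [d2 [D2 [p E2]]]]] E1]]]]].
by exists A2, d1, d2, D2; split=> // a; rewrite /= E1 E2.
Qed.

Lemma transports_id : transports id id.
Proof.
split=> //.
- by split=> a; exact: cvg_id.
- by split=> A b1 b2 D p; exists A, b1, b2, D.
Qed.

Lemma transports_comp S1 S1' S S' : transports S1 S1' -> transports S S' ->
  transports (S1 \o S) (S' \o S1').
Proof.
move=> [[k1 k1'] [c1 c1'] [e1 e1'] [p1 p1'] h1] [[k k'] [c c'] [e e'] [p p'] h]; split.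
- by split; [exact: can_comp|exact: can_comp].
- by split=> a; apply: continuous_comp; [exact: c|exact: c1|exact: c1'|exact: c'].
- split=> a Ha; last by apply/e'/e1'.
  have [H1 E1] := e a Ha; have [H2 E2] := e1 _ H1.
  by split=> //=; rewrite E2 E1.
- by split; exact: pullback_forms_comp.
- by move=> f a /h /h1.
Qed.

Lemma sconj_forms : pullback_forms (@sconj R).
Proof.
move=> A b1 b2 D p; exists A, b1, (- b2), D; split; first by rewrite /feval_proper sqrrN.
by move=> [t|] //=; congr Num.sg; rewrite cReJ cImJ; ring.
Qed.

(** The holomorphic factor of a generating reflection, which is this map followed by complex
    conjugation. *)
Definition mobius (k : 'I_3) : S2 -> S2 :=
  if k == 0 then @sinv R else if k == 1 then saff 1 else saff 0.

Lemma mobius_holo k a : holomorphic_at (mobius k) a.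
Proof.
by rewrite /mobius; case: ifP => _; [exact: holo_sinv|case: ifP => _; exact: holo_saff].
Qed.

Lemma reflE k a : reflection (T0_circle R k) a = sconj (mobius k a).
Proof.
case: (ord3P k) => ->; rewrite ?refl0E ?refl1E ?refl2E /mobius /=.
- by [].
- by case: a => [t|] //=; rewrite /sconj /= cJD cJN cJ1.
- by case: a => [t|] //=; rewrite /sconj /= sub0r cJN.
Qed.

Lemma mobius_conj k a : mobius k (sconj a) = sconj (mobius k a).
Proof.
rewrite /mobius; case: (ord3P k) => -> /=.
- case: a => [t|] /=; last by congr Some; apply: eqReIm; rewrite /= ?oppr0.
  by rewrite conjc_eq0; case: eqP => //= _; rewrite /sconj /= cJV.
- by case: a => [t|] //=; rewrite /sconj /= cJD cJN cJ1.
- by case: a => [t|] //=; rewrite /sconj /= !sub0r cJN.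
Qed.

Lemma mobiusK k : involutive (mobius k).
Proof.
move=> a; rewrite /mobius; case: (ord3P k) => -> /=.
- exact: sinvK.
- by case: a => [t|] //=; rewrite opprB subrKC.
- by case: a => [t|] //=; rewrite !sub0r opprK.
Qed.

Lemma reflK k : involutive (reflection (T0_circle R k)).
Proof. by move=> a; rewrite !reflE mobius_conj sconjK mobiusK. Qed.

Lemma refl_HH k a : HH a -> HH (reflection (T0_circle R k) a).
Proof.
move=> [t /= t0 <-]; case: (ord3P k) => ->.
- have n0 : t != 0 by apply: contraTneq t0 => ->; rewrite ltxx.
  rewrite refl0E /= (negbTE n0); apply/HHE; rewrite cImJ.
  rewrite -cImN.
  exact: Im_invN.
- by rewrite refl1E; apply/HHE; rewrite cImD cImN cImJ /= opprK add0r.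
- by rewrite refl2E; apply/HHE; rewrite cImN cImJ opprK.
Qed.

Lemma refl_forms k : pullback_forms (reflection (T0_circle R k)).
Proof.
case: (ord3P k) => -> A b1 b2 D p.
(* Inversion in the unit circle exchanges A and D, up to the positive factor |t|^2. *)
- exists D, b1, b2, A; split; first by rewrite /feval_proper mulrC.
  move=> a; rewrite refl0E; case: a => [t|] /=; last first.
    by congr Num.sg; rewrite oppr0; ring.
  case: eqVneq => [->|t0] /=; first by congr Num.sg; ring.
  have n0 : 0 < Re t ^+ 2 + Im t ^+ 2 by rewrite -sqr_normcE exprn_gt0 // normc_gt0.
  have [E1 E2] : Re (conjc t^-1) = Re t / (Re t ^+ 2 + Im t ^+ 2) /\ Im (conjc t^-1) = Im t / (Re t ^+ 2 + Im t ^+ 2).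
    by rewrite cReJ cImJ; move: t {t0 n0} => [x y]; rewrite /= opprK.
  rewrite E1 E2 -[LHS]mul1r -(gtr0_sg n0) -sgrM; congr Num.sg.
  move: (Re t) (Im t) n0 => x y n0; by field; rewrite gt_eqF.
- exists A, (- A - b1), b2, (A + 2 * b1 + D); split.
    by move: p; rewrite /feval_proper; have -> : (- A - b1) ^+ 2 + b2 ^+ 2 - A * (A + 2 * b1 + D) = b1 ^+ 2 + b2 ^+ 2 - A * D by ring.
  move=> a; rewrite refl1E; case: a => [t|] //=; congr Num.sg.
  by rewrite !cE /= ; ring.
- exists A, (- b1), b2, D; split; first by rewrite /feval_proper sqrrN.
  move=> a; rewrite refl2E; case: a => [t|] //=; congr Num.sg.
  by rewrite !cE; ring.
Qed.

Lemma refl_continuous k : continuous (reflection (T0_circle R k)).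
Proof.
have -> : reflection (T0_circle R k) = @sconj R \o mobius k by apply/funext => a; exact: reflE.
move=> a; apply: continuous_comp; last exact: sconj_continuous.
rewrite /mobius; case: ifP => _; first exact: sinv_continuous.
by case: ifP => _; exact: saff_continuous.
Qed.

Lemma refl_transports k : transports (reflection (T0_circle R k)) (reflection (T0_circle R k)).
Proof.
split.
- by split; exact: reflK.
- by split; exact: refl_continuous.
- split=> a Ha; last exact: refl_HH.
  by split; [exact: refl_HH|case: Ha => t t0 <-; exact: pbar_refl].
- by split; exact: refl_forms.
move=> f a hf; set r := reflection _.
have mr c : mobius k (r c) = sconj c.
  by rewrite /r reflE mobius_conj mobiusK.
have h1 : holomorphic_at (mobius k) (r a) by exact: mobius_holo.
have h2 : holomorphic_at (@sconj R \o (@sconj R \o f) \o @sconj R) (mobius k (r a)).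
  by rewrite mr; exact: holo_conj.
have h3 := holo_comp (holo_comp h1 h2) (@mobius_holo k _).
apply: holo_ext h3; apply: filterS filterT => b _ /=.
by rewrite sconjK /r !reflE sconjK.
Qed.

Lemma group_transports S : reflection_group S -> exists S', transports S S'.
Proof.
elim=> [|k {}S _ [S' hS]]; first by exists id; exact: transports_id.
by exists (S' \o reflection (T0_circle R k)); exact: transports_comp (refl_transports k) hS.
Qed.

Lemma disk_form (K : gcircle R) (X : set S2) : disk_bounded_by K X -> exists A b1 b2 D,
  [/\ feval_proper A b1 b2 D, forall a, X a <-> feval A b1 b2 D a <= 0 &
      forall a, circle_pts K a <-> feval A b1 b2 D a = 0].
Proof.
have key (P : C -> Prop) (t : C) (B : Prop) : (exists2 u, P u & Some u = Some t :> S2) <-> P t.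
  by split=> [[u h [<-]]|h] //; exists t.
case: K => [c r|c b] [/= p [->|->]].
- exists 1, (- Re c), (- Im c), (normc c ^+ 2 - r ^+ 2).
  have E t : feval 1 (- Re c) (- Im c) (normc c ^+ 2 - r ^+ 2) (Some t) = normc (t - c) ^+ 2 - r ^+ 2.
    by rewrite /= !sqr_normcE !cE; ring.
  split; first by rewrite /feval_proper !sqrrN -sqr_normcE mul1r opprB subrKC exprn_gt0.
    move=> [t|]; last by split=> [[]|] //=; rewrite ler10.
    rewrite E subr_le0 ler_pXn2r ?nnegrE ?normc_ge0 ?(ltW p) //.
    by split=> [[u h [<-]]|h]; [rewrite -lecR -normcE|exists t => //=; rewrite normcE lecR].
  move=> [t|]; last by split=> [[]|/=/eqP] //; rewrite oner_eq0.
  rewrite E; split=> [[u h [<-]]|/eqP].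
    by move: h; rewrite /= normcE => -[->]; rewrite subrr.
  rewrite subr_eq0 eqrXn2 ?normc_ge0 ?(ltW p) // => /eqP h.
  by exists t => //=; rewrite normcE h.
- exists (-1), (Re c), (Im c), (r ^+ 2 - normc c ^+ 2).
  have E t : feval (-1) (Re c) (Im c) (r ^+ 2 - normc c ^+ 2) (Some t) = r ^+ 2 - normc (t - c) ^+ 2.
    by rewrite /= !sqr_normcE !cE; ring.
  split; first by rewrite /feval_proper -sqr_normcE mulN1r opprK subrKC exprn_gt0.
    move=> [t|]; last by split=> [_|_]; [rewrite /= lerN10|left].
    rewrite E subr_le0 ler_pXn2r ?nnegrE ?normc_ge0 ?(ltW p) //.
    by split=> [[//|[u h [<-]]]|h]; [rewrite -lecR -normcE|right; exists t => //=; rewrite normcE lecR].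
  move=> [t|]; last by split=> [[]|/=/eqP] //; rewrite oppr_eq0 oner_eq0.
  rewrite E; split=> [[u h [<-]]|/eqP].
    by move: h; rewrite /= normcE => -[->]; rewrite subrr.
  rewrite subr_eq0 eq_sym eqrXn2 ?normc_ge0 ?(ltW p) // => /eqP h.
  by exists t => //=; rewrite normcE h.
- exists 0, (Re c / 2), (Im c / 2), (- b).
  have E t : feval 0 (Re c / 2) (Im c / 2) (- b) (Some t) = Re (conjc c * t) - b.
    by rewrite /= cReM cReJ cImJ; field.
  split.
  - rewrite /feval_proper mul0r subr0 !expr_div_n -mulrDl -sqr_normcE divr_gt0 // ?exprn_gt0 //.
    by rewrite normc_gt0.
  - move=> [t|]; last by split=> // _; left.
    rewrite E subr_le0; split=> [[//|[u h [<-]]] //|h]; by right; exists t.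
  - move=> [t|]; last by split=> // _; left.
    rewrite E; split=> [[//|[u /= h [<-]]]|/eqP]; first by rewrite h subrr.
    by rewrite subr_eq0 => /eqP h; right; exists t.
- exists 0, (- (Re c / 2)), (- (Im c / 2)), b.
  have E t : feval 0 (- (Re c / 2)) (- (Im c / 2)) b (Some t) = b - Re (conjc c * t).
    by rewrite /= cReM cReJ cImJ; field.
  split.
  - rewrite /feval_proper mul0r subr0 !sqrrN !expr_div_n -mulrDl -sqr_normcE divr_gt0 // ?exprn_gt0 //.
    by rewrite normc_gt0.
  - move=> [t|]; last by split=> // _; left.
    rewrite E subr_le0; split=> [[//|[u h [<-]]] //|h]; by right; exists t.
  - move=> [t|]; last by split=> // _; left.
    rewrite E; split=> [[//|[u /= h [<-]]]|/eqP]; first by rewrite h subrr.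
    by rewrite subr_eq0 => /eqP h; right; exists t.
Qed.

Lemma form_circle A b1 b2 D : feval_proper A b1 b2 D ->
  exists2 K, proper_circle K & forall a, feval A b1 b2 D a = 0 -> circle_pts K a.
Proof.
rewrite /feval_proper => p; have [A0|A0] := eqVneq A 0.
  exists (Line (b1 +i* b2) (- D / 2)).
    rewrite /= eq_complex /=; apply/negP => /andP[/eqP e1 /eqP e2].
    by move: p; rewrite A0 e1 e2 expr0n /= mul0r subr0 addr0 ltxx.
  move=> [t|] /= h; last by left.
  right; exists t => //=; rewrite cReM /=.
  by move: h; rewrite A0 mul0r add0r; lra.
have A2 : 0 < A ^+ 2 by rewrite exprn_even_gt0.
have nA : 0 < `|A| by rewrite normr_gt0.
exists (Circle ((- (b1 / A)) +i* (- (b2 / A))) (Num.sqrt (b1 ^+ 2 + b2 ^+ 2 - A * D) / `|A|)).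
  by rewrite /= divr_gt0 // sqrtr_gt0.
move=> [t|] /= h; last by move: A0; rewrite h eqxx.
exists t => //=; rewrite normcE; congr _%:C; apply/eqP.
rewrite -(eqrXn2 (n := 2)) ?normc_ge0 ?divr_ge0 ?sqrtr_ge0 //.
rewrite expr_div_n sqr_sqrtr ?(ltW p) // real_normK ?num_real // sqr_normcE !cE /= !opprK.
apply/eqP; apply: (mulIf (lt0r_neq0 A2)); rewrite divfK ?(lt0r_neq0 A2) //.
have -> : ((Re t + b1 / A) ^+ 2 + (Im t + b2 / A) ^+ 2) * A ^+ 2 =
   A * (A * (Re t ^+ 2 + Im t ^+ 2) + 2 * (b1 * Re t + b2 * Im t) + D) + b1 ^+ 2 + b2 ^+ 2 - A * D.
  by field.
by rewrite h mulr0 add0r.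
Qed.

Lemma F0_edge k a : edge k a -> circle_pts (T0_circle R k) (F0 a).
Proof.
case=> + ca; case: a ca => [t|] ca; last by rewrite F0_none.
move=> /SregE Tt; rewrite F0_some //; have st := T0f_strip Tt.
have one (v : C) : Re (conjc (1 : C) * v) = Re v by rewrite cReM /= oppr0 mul0r subr0 mul1r.
case: (ord3P k) ca => ->.
- move=> [u + [Eu]]; rewrite Eu /= subr0 normcE => -[h].
  by exists (f0 t) => //=; rewrite subr0 normcE f0_edge2.
- move=> [//|[u h [Eu]]]; have {}h : Re t = 2^-1 by rewrite -one -Eu.
  by right; exists (f0 t) => //; change (Re (conjc 1 * f0 t) = 2^-1); rewrite one; exact: f0_edge1.
- move=> [//|[u h [Eu]]]; have {}h : Re t = 0 by rewrite -one -Eu.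
  by right; exists (f0 t) => //; change (Re (conjc 1 * f0 t) = 0); rewrite one; exact: f0_edge0.
Qed.

End Transport.

(** * Images of circular arc triangles *)

Section ImageTriangles.
Variable R : realType.
Local Notation C := R[i].
Local Notation S2 := (sphere R).
Implicit Types (z w t : C) (a : S2) (k : 'I_3).
#[local] Opaque f0.

Lemma within_comp (S U V : topologicalType) (X : set S) (Y : set U) (f : S -> U) (g : U -> V) :
  (forall x, X x -> Y (f x)) -> {within X, continuous f} -> {within Y, continuous g} ->
  {within X, continuous (g \o f)}.
Proof.
move=> fXY /subspace_continuousP cf /subspace_continuousP cg; apply/subspace_continuousP.
move=> x Xx W hW; have := cf x Xx _ (cg (f x) (fXY x Xx) W hW).
change (nbhs x [set y | X y -> Y (f y) -> W (g (f y))] -> nbhs x [set y | X y -> W (g (f y))]).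
by apply: filterS => y hy Xy; exact: hy Xy (fXY y Xy).
Qed.

Lemma homeo_trans (S U V : topologicalType) (X : set S) (Y : set U) (Z : set V)
    (f : S -> U) (g : U -> V) :
  homeomorphism_onto X Y f -> homeomorphism_onto Y Z g -> homeomorphism_onto X Z (g \o f).
Proof.
move=> [[hf injf surjf] cf [f' fK cf']] [[hg injg surjg] cg [g' gK cg']]; split.
- split.
  + by move=> x /hf /hg.
  + move=> x y; rewrite !inE => Xx Xy /injg E; apply: injf; rewrite ?inE //.
    by apply: E; rewrite inE; exact: hf.
  + by move=> z /surjg[y /surjf[x Xx <-] <-]; exists x.
- exact: within_comp cf cg.
exists (f' \o g').
  by move=> x; rewrite inE => Xx /=; rewrite gK ?fK // inE //; exact: hf.
apply: within_comp cg' cf' => z /surjg[y Yy <-].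
by rewrite gK // inE.
Qed.

Lemma homeo_sub (S U : topologicalType) (X A : set S) (Y : set U) (f : S -> U) :
  A `<=` X -> homeomorphism_onto X Y f -> homeomorphism_onto A (f @` A) f.
Proof.
move=> AX [[hf injf surjf] cf [g fK cg]]; split.
- split; first by move=> x Ax; exists x.
    by move=> x y; rewrite !inE => /AX Xx /AX Xy; apply: injf; rewrite inE.
  by move=> y.
- exact: continuous_subspaceW cf.
exists g; first by move=> x; rewrite inE => /AX Xx; apply: fK; rewrite inE.
by apply: continuous_subspaceW cg => _ [x /AX /hf + <-].
Qed.

Lemma homeo_ext (S U : topologicalType) (X : set S) (Y : set U) (f g : S -> U) :
  (forall x, X x -> f x = g x) -> homeomorphism_onto X Y f -> homeomorphism_onto X Y g.
Proof.
move=> E [[hf injf surjf] cf [h fK ch]]; split.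
- split; first by move=> x Xx; rewrite -E //; exact: hf.
    by move=> x y; rewrite !inE => Xx Xy; rewrite -!E //; apply: injf; rewrite inE.
  by move=> y /surjf[x Xx <-]; exists x; rewrite ?E.
- by apply: subspace_eq_continuous cf => x; rewrite inE => /E.
by exists h => // x; rewrite inE => Xx; rewrite -E // fK // inE.
Qed.

(* Pulling back forms along S' says that S maps circles to circles. *)
Definition circular_homeo (S S' : S2 -> S2) : Prop :=
  [/\ cancel S S', cancel S' S, continuous S, continuous S' & pullback_forms S'].

Lemma sconj_circular : circular_homeo (@sconj R) (@sconj R).
Proof.
split; try exact: sconjK; try exact: sconj_continuous; exact: sconj_forms.
Qed.

Lemma transports_circular S S' : transports S S' -> circular_homeo S S'.
Proof. by move=> [[? ?] [? ?] _ [? ?] _]. Qed.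

Section Image.
Variables S S' : S2 -> S2.
Hypothesis hS : circular_homeo S S'.

Lemma homeo_image (A : set S2) : homeomorphism_onto A (S @` A) S.
Proof.
have [SK S'K cS cS' _] := hS; split.
- split; [by move=> x Ax; exists x|by move=> x y _ _ /(can_inj SK)|by move=> y].
- exact: continuous_subspaceT.
exists S'; first by move=> x _.
exact: continuous_subspaceT.
Qed.

Lemma homeo_preimage (A : set S2) : homeomorphism_onto (S @` A) A S'.
Proof.
have [SK S'K cS cS' _] := hS; split.
- split; first by move=> _ [x Ax <-]; rewrite SK.
    by move=> x y _ _ /(can_inj S'K).
  by move=> y Ay; exists (S y); [exists y|exact: SK].
- exact: continuous_subspaceT.
exists S; first by move=> x _.
exact: continuous_subspaceT.
Qed.

Lemma closure_image (A : set S2) : closure (S @` A) = S @` closure A.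
Proof.
have [SK S'K cS cS' _] := hS; apply/seteqP; split=> a.
  move=> ha; exists (S' a); last exact: S'K.
  move=> U /cS' /ha[_ [[x Ax <-] /=]]; rewrite SK => Ux.
  by exists x.
move=> [x hx <-] U /cS /hx[y [Ay Uy]].
by exists (S y); split=> //; exists y.
Qed.

Lemma interior_image (A : set S2) : interior (S @` A) = S @` interior A.
Proof.
have [SK S'K cS cS' _] := hS; apply/seteqP; split=> a.
  move=> ha; exists (S' a); last exact: S'K.
  have := ha; rewrite /interior /= -{1}(S'K a) => /cS.
  change (nbhs (S' a) [set x | (S @` A) (S x)] -> nbhs (S' a) A).
  by apply: filterS => x [y Ay] /(can_inj SK) <-.
move=> [x hx <-]; have : nbhs (S' (S x)) A by rewrite SK.
move=> /cS'; change (nbhs (S x) [set y | A (S' y)] -> nbhs (S x) (S @` A)).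
by apply: filterS => y /= h; exists (S' y).
Qed.

Lemma boundary_image (A : set S2) : boundary (S @` A) = S @` boundary A.
Proof.
have [SK S'K cS cS' _] := hS.
rewrite /boundary closure_image interior_image; apply/seteqP; split.
  by move=> _ [[x h1 <-] h2]; exists x => //; split=> // h3; apply: h2; exists x.
move=> _ [x [h1 h2] <-]; split; first by exists x.
by move=> [y h3] /(can_inj SK) E; apply: h2; rewrite -E.
Qed.

Lemma circular_arc_image (A : set S2) a b : circular_arc A a b -> circular_arc (S @` A) (S a) (S b).
Proof.
move=> [[K pK AK] [h hh [h0 h1]]]; have [SK S'K cS cS' fS'] := hS; split.
  (* The carrying circle is written as the zero set of a form; pulling the form back along [S']
     yields the circle that carries the image. *)
  have [A1 [b1 [b2 [D1 [p _ E]]]]] := disk_form (conj pK (or_introl erefl)).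
  have [A2 [c1 [c2 [D2 [p2 E2]]]]] := fS' _ _ _ _ p.
  have [K' pK' hK'] := form_circle p2; exists K' => //.
  move=> _ [x Ax <-]; apply: hK'; apply/eqP; rewrite -sgr_eq0 -E2 SK sgr_eq0.
  by apply/eqP/E/AK.
exists (S \o h); last by rewrite /= h0 h1.
exact: homeo_trans hh (homeo_image A).
Qed.

Lemma triangle_sides_image (T : triangle R) s : triangle_sides T s ->
  triangle_sides (image_triangle S T) (fun k => S @` s k).
Proof.
move=> [h1 h2 h3]; have [SK _ _ _ _] := hS; split.
- rewrite /= boundary_image h1; apply/seteqP; split.
    by move=> _ [x [k _ sx] <-]; exists k => //; exists x.
  by move=> _ [k _ [x sx <-]]; exists x => //; exists k.
- by move=> k; exact: circular_arc_image.
move=> k; apply/seteqP; split.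
  move=> _ [[x sx <-] [y sy /(can_inj SK) E]]; rewrite E in sy.
  by have : (s k `&` s (ordS k)) x by []; rewrite h3 => ->.
move=> _ ->; have [sx sy] : (s k `&` s (ordS k)) (vertex T (ord_pred k)) by rewrite h3.
by split; exists (vertex T (ord_pred k)).
Qed.

Lemma circular_arc_triangle_image (T : triangle R) : circular_arc_triangle T ->
  circular_arc_triangle (image_triangle S T).
Proof.
move=> [[cT [h hh]] [s hs]]; split; last first.
  by exists (fun k => S @` s k); exact: triangle_sides_image.
have [_ _ cS _ _] := hS; split.
  by apply: continuous_compact => //; exact: continuous_subspaceT.
by exists (S \o h); exact: homeo_trans hh (homeo_image _).
Qed.

End Image.

Lemma proper_T0_circle k : proper_circle (T0_circle R k).
Proof.
by case: (ord3P k) => -> /=; rewrite ?ltr01 // oner_eq0.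
Qed.

Lemma T0_circular : circular_arc_triangle (T0 R).
Proof.
split; first exact: jordan_T0.
exists (@edge R); split; [exact: boundary_T0| |exact: edge_meet].
move=> k; split; last exact: edge_arc.
by exists (T0_circle R k); [exact: proper_T0_circle|move=> a []].
Qed.

Lemma vertex_T0 k : region (T0 R) (vertex (T0 R) k) /\ F0 (vertex (T0 R) k) = vertex (T0 R) k.
Proof.
have v1 : vertex (T0 R) 1 = Some (ii R) by congr Some; apply: eqReIm.
have v2 : vertex (T0 R) 2 = Some (rho R) by [].
rewrite region_T0; case: (ord3P k) => ->.
- by split; [left|exact: F0_none].
- have h := T0f_ii R; rewrite v1 F0_some // f0_ii; split=> //; exact/SregE.
- have h := T0f_rho R; rewrite v2 F0_some // f0_rho; split=> //; exact/SregE.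
Qed.

Definition T0c : triangle R := Triangle (Sreg (-1)) (vertex (T0 R)).

Lemma sqrN1 : (-1 : R) ^+ 2 = 1. Proof. by rewrite sqrrN expr1n. Qed.

Lemma edge_sub k : edge k `<=` region (T0 R).
Proof. by move=> a []; rewrite region_T0. Qed.

(** The parametrisations of T0 and of its edges are composed with [F0]. The image edges are circular
    arcs because [F0] keeps each edge on its own circle, and they join the same vertices, which are
    fixed. *)
Lemma T0c_circular : circular_arc_triangle T0c.
Proof.
have [[cT [h hh]] [s _]] := T0_circular; have FH := F0_homeo R; split.
  by split; [exact/compactS/closed_Sreg|exists (@F0 R \o h); exact: homeo_trans hh FH].
have [[hF injF surjF] _ _] := FH.
exists (fun k => @F0 R @` edge k); split.
- have bT := boundary_T0 R; rewrite region_T0 /boundary in bT.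
  rewrite -(closure_id _).1 in bT; last exact: closed_Sreg.
  rewrite interior_Sreg ?expr1n // in bT.
  rewrite /boundary -(closure_id _).1; last exact: closed_Sreg.
  rewrite interior_Sreg ?sqrN1 //; apply/seteqP; split.
    move=> a [/surjF[x Tx <-] nU].
    have : (Sreg 1 `\` Some @` side_of_i 1) x.
      rewrite region_T0 in Tx; split=> // -[t Tt Et]; apply: nU; rewrite -Et F0_some; last exact: side_of_iW.
      by exists (f0 t) => //; exact: f0_T0i.
    by rewrite bT => -[k _ ex]; exists k => //; exists x.
  move=> _ [k _ [x ex <-]]; split; first by apply/hF/edge_sub/ex.
  have : (Sreg 1 `\` Some @` side_of_i 1) x by rewrite bT; exists k.
  move=> [Tx nx] [w /f0_Ui_surj[t Tt Ew] E]; apply: nx; exists t => //.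
  apply: injF; rewrite ?inE ?region_T0 //; first by apply/SregE/side_of_iW.
  by rewrite F0_some ?Ew //; exact: side_of_iW.
- move=> k; split.
    exists (T0_circle R k); first exact: proper_T0_circle.
    by move=> _ [x ex <-]; exact: F0_edge.
  have [g hg [g0 g1]] := edge_arc R k; exists (@F0 R \o g).
    exact: homeo_trans hg (homeo_sub (@edge_sub k) FH).
  by rewrite /= g0 g1 !(vertex_T0 _).2.
move=> k; apply/seteqP; split.
  move=> _ [[x ex <-] [y ey E]].
  have Exy : y = x by apply: (injF _ _ (mem_set (edge_sub ey)) (mem_set (edge_sub ex)) E).
  rewrite Exy in ey; have : (edge k `&` edge (ordS k)) x by [].
  by rewrite edge_meet => ->; rewrite (vertex_T0 _).2.
move=> _ ->; have [h1 h2] : (edge k `&` edge (ordS k)) (vertex (T0 R) (ord_pred k)) by rewrite edge_meet.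
by split; exists (vertex (T0 R) (ord_pred k)) => //; rewrite (vertex_T0 _).2.
Qed.

End ImageTriangles.

(** * The complementary triangle *)

Section Complementary.
Variable R : realType.
Local Notation C := R[i].
Local Notation S2 := (sphere R).
Local Notation s3 := (Num.sqrt (3 : R)).
Implicit Types (z w t : C) (a : S2) (k : 'I_3).
#[local] Opaque f0.

Lemma arc_ends (A : set S2) a b : circular_arc A a b -> A a /\ A b.
Proof.
move=> [_ [h [[hh _ _] _ _] [<- <-]]].
by split; apply: hh; rewrite /= in_itv /= ?lexx ler01.
Qed.

(** The two circles meet only at vertex 0, so the chosen sides share no other vertex. This leaves
    the sides 1 and 2, in either order. *)
Lemma touching_sides (T : triangle R) s (k1 k2 : 'I_3) (K1 K2 : set S2) :
  triangle_sides T s -> vertex T 1 <> vertex T 0 -> vertex T 2 <> vertex T 0 ->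
  s k1 `<=` K1 -> s k2 `<=` K2 -> K1 `&` K2 = [set vertex T 0] ->
  [/\ K1 (vertex T 0), K2 (vertex T 0) &
    (K1 (vertex T 1) /\ K2 (vertex T 2)) \/ (K1 (vertex T 2) /\ K2 (vertex T 1))].
Proof.
move=> [_ harc hmeet] n1 n2 h1 h2 hK.
have [v1 v2] : K1 (vertex T 0) /\ K2 (vertex T 0).
  by have : [set vertex T 0] (vertex T 0) by []; rewrite -hK.
have no a : K1 a -> K2 a -> a = vertex T 0.
  by move=> k1a k2a; have : (K1 `&` K2) a by []; rewrite hK.
have ends k := arc_ends (harc k).
have e0 : s 0 (vertex T 1) /\ s 0 (vertex T 2).
  have := ends 0; rewrite (_ : ordS 0 = 1); last exact: val_inj.
  by rewrite (_ : ord_pred 0 = 2); last exact: val_inj.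
have e1 : s 1 (vertex T 2).
  by have := ends 1; rewrite (_ : ordS 1 = 2); [case|exact: val_inj].
have e2 : s 2 (vertex T 1).
  have := ends 2; rewrite (_ : ord_pred 2 = 1); last exact: val_inj.
  by case.
split=> //; case: (ord3P k1) (ord3P k2) h1 h2 => -> [] -> h1 h2.
- by case: n1; apply: no; [apply: h1; case: e0|apply: h2; case: e0].
- by case: n2; apply: no; [apply: h1; case: e0|apply: h2].
- by case: n1; apply: no; [apply: h1; case: e0|apply: h2].
- by case: n2; apply: no; [apply: h1|apply: h2; case: e0].
- by case: n2; apply: no; [apply: h1|apply: h2].
- by right; split; [apply: h1|apply: h2].
- by case: n1; apply: no; [apply: h1|apply: h2; case: e0].
- by left; split; [apply: h1|apply: h2].
- by case: n1; apply: no; [apply: h1|apply: h2].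
Qed.

(* The lines are parallel; if they were not vertical, both would have to be the
   line through i and rho. *)
Lemma half_planes (p q D p' q' D' : R) :
  0 < p ^+ 2 + q ^+ 2 -> 0 < p' ^+ 2 + q' ^+ 2 ->
  (forall x y, side_of 1 (x +i* y : C) -> p * x + q * y + D <= 0 /\ p' * x + q' * y + D' <= 0) ->
  (forall x y, p * x + q * y + D = 0 -> p' * x + q' * y + D' = 0 -> False) ->
  q + D = 0 -> p' * 2^-1 + q' * (s3 / 2) + D' = 0 ->
  [/\ q = 0, q' = 0, p < 0, 0 < p' & (D = 0 /\ D' = - (p' / 2))].
Proof.
move=> n n' hT hN hi hr.
have TY y : 1 <= y -> p * 0 + q * y + D <= 0 /\ p' * 0 + q' * y + D' <= 0.
  by move=> y1; apply: hT; apply: strip_ge => //=; rewrite lexx invr_ge0 ler0n.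
have /andP[b1 b2] := sqrt3_bounds R; have s2 := sqrt3_sqr R.
have Tr : side_of 1 (2^-1 +i* (s3 / 2) : C) by exact: T0f_rho.
have [r1 r2] := hT _ _ Tr.
have [i1 i2] := TY 1 (lexx 1).
(* Otherwise Cramer's rule gives a common finite point of the two lines. *)
have par : p * q' - q * p' = 0.
  apply/eqP; apply/negP => /negP d0.
  by apply: (hN ((q * D' - D * q') / (p * q' - q * p')) ((D * p' - p * D') / (p * q' - q * p'))); field.
(* T0 contains the vertical ray above i, so a half plane containing T0 cannot have a positive
   coefficient of y. *)
have low (a b c : R) : (forall y, 1 <= y -> a * 0 + b * y + c <= 0) -> b <= 0.
  move=> h; rewrite leNgt; apply/negP => b0.
  have := h (1 + (`|c| + 1) / b); rewrite lerDl divr_ge0 ?addr_ge0 ?(ltW b0) // => /(_ isT).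
  rewrite mulr0 add0r mulrDr mulr1 [b * _]mulrC divfK ?gt_eqF //.
  by have := ler_norm (- c); rewrite normrN; lra.
have q0 : q <= 0 by apply: (low p q D) => y /TY[].
have q'0 : q' <= 0 by apply: (low p' q' D') => y /TY[].
have qz : q = 0.
  apply/eqP; apply/negP => /negP qn.
  have qlt : q < 0 by rewrite lt_neqAle qn.
  have q'lt : q' < 0.
    rewrite lt_neqAle q'0 andbT; apply/eqP => E; move: par; rewrite E mulr0 sub0r => /eqP.
    rewrite oppr_eq0 mulf_eq0 (negbTE qn) /= => /eqP p'0.
    by move: n'; rewrite p'0 E expr0n /= addr0 ltxx.
  (* Each half plane contains the vertex on the boundary line of the other; this gives m/2 + sqrt 3
     / 2 - 1 both signs, so that i lies on both lines. *)
  pose m := p / q.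
  have pm : p = m * q by rewrite /m divfK.
  have pm' : p' = m * q'.
    apply: (mulIf qn); rewrite mulrAC -pm; apply/eqP; rewrite -subr_eq0 -oppr_eq0 opprB.
    by rewrite [p' * q]mulrC par.
  have m1 : 0 <= m * 2^-1 + s3 / 2 - 1.
    have : q * (m * 2^-1 + s3 / 2 - 1) <= 0 by move: r1; rewrite pm; lra.
    by rewrite nmulr_rle0.
  have m2 : m * 2^-1 + s3 / 2 - 1 <= 0.
    have : 0 <= q' * (m * 2^-1 + s3 / 2 - 1) by move: i2; rewrite pm' in hr *; lra.
    by rewrite nmulr_rge0.
  apply: (hN 0 1); first by lra.
  have E : m * 2^-1 + s3 / 2 = 1 by lra.
  have : q' * (m * 2^-1 + s3 / 2) = q' * 1 by rewrite E.
  by rewrite pm' in hr *; lra.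
have Dz : D = 0 by lra.
have pn : p != 0 by apply: contraTneq n => ->; rewrite qz expr0n /= addr0 ltxx.
have q'z : q' = 0.
  by apply/eqP; move/eqP: par; rewrite qz mul0r subr0 mulf_eq0 (negbTE pn).
have p'n : p' != 0 by apply: contraTneq n' => ->; rewrite q'z expr0n /= addr0 ltxx.
rewrite qz q'z !mul0r in r1 r2 i1 i2 hr.
split=> //; last by split=> //; lra.
  by rewrite lt_neqAle pn /=; lra.
by rewrite lt_def p'n /=; lra.
Qed.

(** The intersection of the two touching disks in the model case of T0; they touch at infinity. *)
Definition vstrip : set S2 := [set None] `|` Some @` [set t | 0 <= Re t <= 2^-1].

Lemma closure_vstrip : closure (vstrip `\` Sreg 1) = Sreg (-1) :> set S2.
Proof.
apply/seteqP; split.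
  rewrite [X in _ `<=` X](closure_id _).1; last exact: closed_Sreg.
  apply: closure_subset => a [[->|[t /= ht <-]]] nT; first by case: nT; left.
  apply/SregE; split=> //; rewrite mulN1r opprB subr_ge0 leNgt; apply/negP => h.
  by apply: nT; apply/SregE; split=> //; rewrite mul1r subr_ge0 ltW.
rewrite -(closure_Sreg_i (sqrN1 R)); apply: closure_subset => _ [t [/andP[h1 h2] h3] <-]; split.
  by right; exists t => //=; rewrite !ltW.
by move=> /SregE[_]; move: h3; rewrite mulN1r mul1r oppr_gt0 => h3; rewrite leNgt h3.
Qed.

(** Vanishing at infinity kills the quadratic coefficients, so the two disks are half planes and
    [half_planes] applies. *)
Lemma forms_strip A b1 b2 D A' b1' b2' D' :
  feval_proper A b1 b2 D -> feval_proper A' b1' b2' D' ->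
  (forall a, Sreg 1 a -> feval A b1 b2 D a <= 0 /\ feval A' b1' b2' D' a <= 0) ->
  (forall a, feval A b1 b2 D a = 0 -> feval A' b1' b2' D' a = 0 -> a = None) ->
  feval A b1 b2 D None = 0 -> feval A' b1' b2' D' None = 0 ->
  feval A b1 b2 D (Some (ii R)) = 0 -> feval A' b1' b2' D' (Some (rho R)) = 0 ->
  forall a, (feval A b1 b2 D a <= 0 /\ feval A' b1' b2' D' a <= 0) <-> vstrip a.
Proof.
move=> n n' hT hN /= A0 A0'; rewrite A0 A0' !mul0r !add0r => hi hr.
rewrite /feval_proper A0 mul0r subr0 in n; rewrite /feval_proper A0' mul0r subr0 in n'.
have [||||||q0 q0' p0 p0' [D0 D0']] :=
    @half_planes (2 * b1) (2 * b2) D (2 * b1') (2 * b2') D'.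
- by rewrite !exprMn -mulrDr mulr_gt0 // exprn_gt0.
- by rewrite !exprMn -mulrDr mulr_gt0 // exprn_gt0.
- move=> x y hxy; have := hT (Some (x +i* y)) ((SregE _ _).2 hxy).
  by rewrite /= A0 A0' => -[h1 h2]; split; lra.
- move=> x y h1 h2; have := hN (Some (x +i* y)); rewrite /= A0 A0' => h.
  by have // : Some (x +i* y) = None :> S2 by apply: h; lra.
- by move: hi => /=; lra.
- by move: hr => /=; lra.
have c0 : b2 = 0 by lra.
have c0' : b2' = 0 by lra.
move=> [t|] /=; last by rewrite ?A0 ?A0'; split=> _; [left|rewrite lexx].
rewrite ?A0 ?A0' c0 c0' D0 D0' !mul0r !add0r !addr0; split.
  move=> [h1 h2]; right; exists t => //=; apply/andP; split.
    by have : 0 <= (- (2 * b1)) * Re t by [lra]; rewrite pmulr_rge0 // oppr_gt0.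
  have : 0 <= (2 * b1') * (2^-1 - Re t) by lra.
  by rewrite pmulr_rge0 // subr_ge0.
move=> [//|[u /= /andP[h1 h2] [E]]]; rewrite E in h1 h2.
have k1 : 0 <= (- (2 * b1)) * Re t by rewrite mulr_ge0 // oppr_ge0 ltW.
have k2 : 0 <= (2 * b1') * (2^-1 - Re t) by rewrite mulr_ge0 ?subr_ge0 // ltW.
by split; lra.
Qed.

Lemma complementary_region (S S' : S2 -> S2) (T' : triangle R) : transports S S' ->
  complementary_triangle (image_triangle S (T0 R)) T' -> T' = image_triangle S (T0c R).
Proof.
move=> hS [s [K1 [K2 [D1 [D2 [hs [hD1 hD2 [k1 hk1] [k2 hk2] hK] hT hT' hv]]]]]].
have hc := transports_circular hS.
have [[SK S'K] _ _ [fS _] _] := hS.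
have [A [b1 [b2 [D [p E1 E2]]]]] := disk_form hD1.
have [A' [b1' [b2' [D' [p' E1' E2']]]]] := disk_form hD2.
(* The disks are pulled back along S, so that the comparison takes place at T0, where the touching
   point is infinity. *)
have [B [c1 [c2 [F [n hB]]]]] := fS _ _ _ _ p.
have [B' [c1' [c2' [F' [n' hB']]]]] := fS _ _ _ _ p'.
have d1 a : D1 (S a) <-> feval B c1 c2 F a <= 0.
  by rewrite E1 -sgr_le0 hB sgr_le0.
have d2 a : D2 (S a) <-> feval B' c1' c2' F' a <= 0.
  by rewrite E1' -sgr_le0 hB' sgr_le0.
have q1 a : circle_pts K1 (S a) <-> feval B c1 c2 F a = 0.
  by rewrite E2; split=> h; apply/eqP; rewrite -sgr_eq0; [rewrite -hB|rewrite hB]; rewrite sgr_eq0 h.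
have q2 a : circle_pts K2 (S a) <-> feval B' c1' c2' F' a = 0.
  by rewrite E2'; split=> h; apply/eqP; rewrite -sgr_eq0; [rewrite -hB'|rewrite hB']; rewrite sgr_eq0 h.
have v1 : vertex (T0 R) 1 = Some (ii R) by congr Some; apply: eqReIm.
have v2 : vertex (T0 R) 2 = Some (rho R) by [].
have n1 : S (vertex (T0 R) 1) <> S (vertex (T0 R) 0) by move/(can_inj SK); rewrite v1.
have n2 : S (vertex (T0 R) 2) <> S (vertex (T0 R) 0) by move/(can_inj SK); rewrite v2.
have [w1 w2 w3] := touching_sides hs n1 n2 hk1 hk2 hK.
have hT0 a : Sreg 1 a -> feval B c1 c2 F a <= 0 /\ feval B' c1' c2' F' a <= 0.
  move=> Ta; have [|g1 g2] := hT (S a); last by split; [apply/d1|apply/d2].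
  by exists a; rewrite ?region_T0.
have hN a : feval B c1 c2 F a = 0 -> feval B' c1' c2' F' a = 0 -> a = None.
  move=> /q1 g1 /q2 g2; have : (circle_pts K1 `&` circle_pts K2) (S a) by [].
  by rewrite hK => /(can_inj SK).
have hst a : (D1 `&` D2) (S a) <-> vstrip a.
  have -> : (D1 `&` D2) (S a) <-> feval B c1 c2 F a <= 0 /\ feval B' c1' c2' F' a <= 0.
    by split=> -[/d1 ? /d2 ?].
  have : (circle_pts K1 (S (Some (ii R))) /\ circle_pts K2 (S (Some (rho R)))) \/
         (circle_pts K1 (S (Some (rho R))) /\ circle_pts K2 (S (Some (ii R)))).
    by rewrite -v1 -v2.
  move=> [[/q1 g1 /q2 g2]|[/q1 g1 /q2 g2]].
    by apply: forms_strip => //; [exact/q1|exact/q2].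
  (* The first circle carries the side through rho here, so the two forms exchange their roles. *)
  have := forms_strip n' n _ _ ((q2 _).1 w2) ((q1 _).1 w1) g2 g1 a.
  rewrite and_comm; apply; first by move=> b /hT0[].
  by move=> b g3 g4; exact: hN.
case: T' hT' hv => Y v /= hY hv; rewrite hv /image_triangle; congr Triangle.
have -> : region (T0c R) = Sreg (-1) by [].
rewrite hY -closure_vstrip -(closure_image hc); congr closure.
have hreg b : region (T0 R) b <-> Sreg 1 b by rewrite region_T0.
apply/seteqP; split.
  move=> a [ha nT]; exists (S' a); last exact: S'K.
  split; first by apply/hst; rewrite S'K.
  by move=> /hreg h; apply: nT; exists (S' a) => //; exact: S'K.
move=> _ [a [/hst ha nT] <-]; split=> //.
by move=> [b /hreg Tb /(can_inj SK) E]; apply: nT; rewrite -E.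
Qed.

End Complementary.

(** * The map on an arbitrary triangle of the tessellation *)

Section Main.
Variable R : realType.
Local Notation C := R[i].
Local Notation S2 := (sphere R).
Implicit Types (z w t : C) (a : S2) (k : 'I_3).
#[local] Opaque f0.
Variables S S' : S2 -> S2.
Hypothesis hS : transports S S'.
Local Notation T := (image_triangle S (T0 R)).

Lemma cusp_notin_HH : ~ HH (S None).
Proof.
have [[SK S'K] _ [_ eH] _ _] := hS.
by move=> /eH; rewrite SK; exact: HH_none.
Qed.

Lemma cusp_image_proper : ProperFilter (within (region T `&` @HH R) (nbhs (S None))).
Proof.
have [[SK S'K] [cS cS'] [eH _] _ _] := hS.
apply: within_nbhs_proper => U /cS hU.
have := @closure_Sreg_i R 1 (expr1n _ _); move=> /seteqP[_ /(_ None)].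
move=> /(_ (or_introl erefl) _ hU) [_ [[z hz <-] Uz]]; exists (S (Some z)); split=> //.
have hz' := side_of_iW hz.
split; last by have [] := eH (Some z) ((HHE z).2 (T0f_Im hz')).
by exists (Some z) => //; rewrite region_T0; exact/SregE.
Qed.

(** In the upper half-plane this is equivariance. At the cusp [pbar_on] is a limit, and the
    continuity of S and of its inverse transports the convergence at infinity. *)
Lemma pbar_on_image a : region (T0 R) a -> pbar_on T (S a) = S (F0 a).
Proof.
have [[SK S'K] [cS cS'] [eH eH'] _ _] := hS.
rewrite region_T0; case: a => [t /SregE Tt|_].
  have Ht : HH (Some t : S2) by apply/HHE/T0f_Im.
  have [HS E] := eH _ Ht; rewrite /pbar_on ifT ?inE // E F0_some //.
  by rewrite f0E //; exact: T0f_strip.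
rewrite /pbar_on ifF; last by apply/negbTE; rewrite notin_setE; exact: cusp_notin_HH.
have pF := cusp_image_proper; rewrite F0_none.
suff h : @pbar R @ within (region T `&` @HH R) (nbhs (S None)) --> S None.
  exact (cvg_lim (@hausdorffS R) h).
move=> U /cS /(@pbar_cusp R).
change (nbhs (None : S2) [set y | (region (T0 R) `&` @HH R) y -> U (S (pbar y))] ->
  nbhs (S None) [set y | (region T `&` @HH R) y -> U (pbar y)]).
rewrite -{1}(SK None) => /cS'.
change (nbhs (S None) [set z | (region (T0 R) `&` @HH R) (S' z) -> U (S (pbar (S' z)))] ->
  nbhs (S None) [set y | (region T `&` @HH R) y -> U (pbar y)]).
apply: filterS => z /= hz [[x Tx Ez] /eH' Hz]; rewrite -Ez SK in hz Hz *.
by have [_ ->] := eH _ Hz; exact: hz (conj Tx Hz).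
Qed.

Lemma pbar_on_vertex k : pbar_on T (vertex T k) = vertex T k.
Proof. by have [h E] := vertex_T0 R k; rewrite /= pbar_on_image // E. Qed.

Lemma pbar_on_conformal : anti_conformal_map T (image_triangle S (T0c R)) (pbar_on T).
Proof.
have hc := transports_circular hS; have hJ := sconj_circular R.
have [[SK S'K] [cS cS'] _ _ hol] := hS.
have FH := F0_homeo R; have [[hF injF surjF] _ [G FK _]] := FH.
(* P is a global formula that agrees with the conjugate of [pbar_on] on the triangle only. *)
pose P := @sconj R \o (S \o @F0 R \o S').
have PE a : region T a -> P a = (@sconj R \o pbar_on T) a.
  by move=> [x Tx <-]; rewrite /P /= SK pbar_on_image.
have inT : inte (region T) = S @` (Some @` side_of_i 1).
  have -> : region T = S @` Sreg 1 by rewrite -region_T0.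
  by rewrite inteE (interior_image hc) interior_Sreg // expr1n.
have inT' : inte (region (image_triangle (@sconj R) (image_triangle S (T0c R)))) =
    @sconj R @` (S @` (Some @` side_of_i (-1))).
  by rewrite inteE /= (interior_image hJ) (interior_image hc) interior_Sreg // sqrN1.
have hom : homeomorphism_onto (region T) (region (image_triangle (@sconj R) (image_triangle S (T0c R))))
    (@sconj R \o pbar_on T).
  apply: homeo_ext PE _.
  apply: homeo_trans (homeo_image hJ _).
  apply: homeo_trans (homeo_image hc _).
  exact: homeo_trans (homeo_preimage hc _) FH.
split=> //.
- split; first by apply: (circular_arc_triangle_image hc); exact: T0_circular.
  by apply: (circular_arc_triangle_image hJ); apply: (circular_arc_triangle_image hc); exact: T0c_circular.
- apply/seteqP; split.
    by move=> _ [_ [k _ <-] <-]; exists k => //; exact: (congr1 (@sconj R) (esym (pbar_on_vertex k))).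
  by move=> _ [k _ <-]; exists (vertex T k); [exists k|exact: (congr1 (@sconj R) (pbar_on_vertex k))].
have fin w : side_of_i (-1) w -> exists2 t, side_of_i 1 t & F0 (Some t) = Some w.
  by move=> /f0_Ui_surj[t Tt <-]; exists t => //; rewrite F0_some //; exact: side_of_iW.
have reg t : side_of_i 1 t -> region (T0 R) (Some t).
  by move=> h; rewrite region_T0; apply/SregE/side_of_iW.
rewrite inT inT'; split.
- split.
  + move=> _ [_ [t Tt <-] <-]; rewrite /= pbar_on_image; last exact: reg.
    rewrite F0_some; last exact: side_of_iW.
    eexists; last by reflexivity.
    eexists; last by reflexivity.
    by exists (f0 t) => //; exact: f0_T0i.
  + have [[_ inj _] _ _] := hom; move=> x y; rewrite !inE.
    move=> [_ [t Tt <-] Ex] [_ [u Tu <-] Ey]; apply: inj; rewrite inE.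
      by exists (Some t) => //; exact: reg.
    by exists (Some u) => //; exact: reg.
  + move=> _ [_ [_ [w /fin[t Tt Ft] <-] <-] <-]; exists (S (Some t)).
      by exists (Some t) => //; exists t.
    by rewrite /= pbar_on_image ?Ft //; exact: reg.
(* Holomorphy is a local property, so the agreement with P must hold on a neighbourhood; interior
   points provide one. *)
- move=> a Ta; have : nbhs a (region T).
    by have : interior (region T) a by rewrite -inteE inT.
  move: Ta => [_ [t Tt <-] <-] nT.
  apply: (@holo_ext _ P); first by refine (filterS _ nT) => b /PE.
  exact/hol/holo_pc.
(* The inverse of conj o S o F0 o S', with G inverting F0 on T0. *)
exists (S \o G \o S' \o @sconj R).
  move=> x; rewrite inE => -[_ [t Tt <-] <-].
  by rewrite /= sconjK pbar_on_image ?SK ?FK ?inE //; exact: reg.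
move=> _ [_ [_ [w Uw <-] <-] <-].
have h1 : holomorphic_at (@sconj R \o (S \o G \o S')) (S (Some w)).
  by apply: hol; apply: F0_inv_holo.
have := holo_conj h1; apply: holo_ext; apply: filterS filterT => b _ /=.
by rewrite sconjK.
Qed.

End Main.

Theorem corollary1p2 (R : realType) (T T' : triangle R) :
  in_tessellation T -> complementary_triangle T T' ->
  anti_conformal_map T T' (pbar_on T) /\
  (forall i : 'I_3, pbar_on T (vertex T i) = vertex T i).
Proof.
move=> [S /group_transports[S' hS] ->] /(complementary_region hS) ->.
by split; [exact: pbar_on_conformal hS|exact: pbar_on_vertex hS].
Qed.
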